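(* Let $0<M<\frac{1}{2(\ln 4-1)}$, let $\beta,\mu,\lambda\in\mathbb{R}_{\ge 0}$, let $\lambda_1,\dots,\lambda_q\in\mathbb{R}_{\ge 0}$, let $m\in\mathbb{N}$, let $N\ge 5$ be an integer, and put $t=\lfloor (N-1)/2\rfloor$ and $P_q(w)=\lambda_1w+\lambda_2w^2+\cdots+\lambda_qw^q$. Let $f=h+\overline g\in\mathcal{P}^0_{\mathcal H}(M)$ with $h(z)=\sum_{n\ge1}a_nz^n$, $g(z)=\sum_{n\ge1}b_nz^n$ ($a_1=1$, $b_1=0$). Then $$\beta|f(z)|^m+\sum_{n=N}^{\infty}(|a_n|+|b_n|)r^n+\mu\,\mathrm{sgn}(t)\sum_{n=1}^{t}(|a_n|+|b_n|)^2\frac{r^N}{1-r}+\lambda\Big(1+\frac{r}{1-r}\Big)\sum_{n=t+1}^{\infty}(|a_n|+|b_n|)^2r^{2n}+P_q\Big(\frac{S_r}{\pi}\Big)\le d\big(f(0),\partial f(\mathbb{D})\big)$$ for $|z|=r\le R$, where $R=R^{\lambda_1,\dots,\lambda_q}_{\beta,\mu,\lambda,m,N}(M)$ is the unique root in $(0,1)$ of the equation $\Phi(r)=0$, with $$\Phi(r)=\beta\,(G_M(r))^m+2M\Big(r+(1-r)\ln(1-r)-\sum_{n=2}^{N-1}\frac{r^n}{n(n-1)}\Big)+\mu\,\Phi^N_{M,t}(r)+4M^2\lambda\Big(1+\frac{r}{1-r}\Big)G_t(r)+P_q(F_M(r))-1-2M(1-2\ln2),$$ where $$G_M(r)=r+2M\big(r+(1-r)\ln(1-r)\big),$$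 $$\Phi^N_{M,t}(r)=\frac{r^N}{1-r}\,\mathrm{sgn}(t)\Big(1+4M^2\sum_{n=2}^{t}\frac{1}{n^2(n-1)^2}\Big),$$ $$G_t(r)=(r^2+1)\,\mathrm{Li}_2(r^2)+2(r^2-1)\ln(1-r^2)-3r^2-\sum_{n=2}^{t}\frac{r^{2n}}{n^2(n-1)^2},$$ $$F_M(r)=r^2+4M^2\Big[r^2\,\mathrm{Li}_2(r^2)-\big(r^2+(1-r^2)\ln(1-r^2)\big)\Big].$$ The constant $R$ is best possible.
   Context: $\mathbb{D}=\{z\in\mathbb{C}:|z|<1\}$ and $\mathbb{D}_r=\{z:|z|<r\}$. $\mathcal{H}_0$ is the class of complex-valued harmonic functions $f=h+\overline g$ on $\mathbb{D}$, with $h,g$ analytic in $\mathbb{D}$, $h(0)=h'(0)-1=0$ and $g(0)=g'(0)=0$; so $f(z)=\sum_{n\ge1}a_nz^n+\overline{\sum_{n\ge1}b_nz^n}$ with $a_1=1$, $b_1=0$. For $M>0$, $$\mathcal{P}^0_{\mathcal H}(M)=\{f=h+\overline g\in\mathcal{H}_0:\ \mathrm{Re}(zh''(z))>-M+|zg''(z)|,\ z\in\mathbb{D}\}.$$ $S_r=\iint_{\mathbb{D}_r}(|h'(z)|^2-|g'(z)|^2)\,dx\,dy$. $d(f(0),\partial f(\mathbb{D}))$ is the Euclidean distance from $f(0)$ to the boundary of $f(\mathbb{D})$. $\mathrm{Li}_2(x)=\sum_{k\ge1}x^k/k^2$ is the dilogarithm. $\mathrm{sgn}$ is the sign function ($\mathrm{sgn}(0)=0$).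 $\mathbb{R}_{\ge0}=\{x\in\mathbb{R}:x\ge0\}$. ''Best possible'' means that $R$ cannot be replaced by a larger number so that the inequality still holds for all $f$ in the class and all $|z|=r$ up to that number.
   Formalization: The root R is claimed to exist only if Φ>0 somewhere on (0,1) (it fails for β=μ=λ=λ_i=0 and small M); R is claimed best possible only for M≤1/ln 4, since for larger M the extremal f has d(f(0),∂f(D)) > 1+2M(1-2ln 2) and R is not sharp. *)

(* Defs.v *)
(* Stdlib reals with Coquelicot; complex numbers are Coquelicot's [C]. *)
From Stdlib Require Import Reals.
From Coquelicot Require Import Coquelicot.
Open Scope R_scope.

Definition unit_disk (z : C) : Prop := Cmod z < 1.

Definition analytic_on_disk (h : C -> C) : Prop :=
  forall z : C, unit_disk z -> @ex_derive C_AbsRing C_NormedModule h z.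

Definition power_expansion (h : C -> C) (a : nat -> C) : Prop :=
  forall z : C, unit_disk z -> @is_pseries C_AbsRing C_NormedModule a z (h z).

(* [f] together with its canonical decomposition; since g(0) = 0 is imposed,
   [h] and [g] are determined on the disk by [f]. *)
Definition in_H0 (f h g : C -> C) : Prop :=
  analytic_on_disk h /\ analytic_on_disk g /\
  (forall z : C, unit_disk z -> f z = (h z + Cconj (g z))%C) /\
  h (RtoC 0) = RtoC 0 /\ C_derive h (RtoC 0) = RtoC 1 /\
  g (RtoC 0) = RtoC 0 /\ C_derive g (RtoC 0) = RtoC 0.

Definition in_P0H (M : R) (f h g : C -> C) : Prop :=
  in_H0 f h g /\
  forall z : C, unit_disk z ->
    Re (z * C_derive (C_derive h) z)%C
      > - M + Cmod (z * C_derive (C_derive g) z)%C.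

(* The double integral over |x + iy| < r, as an iterated Riemann integral. *)
Definition disk_integral (F : C -> R) (r : R) : R :=
  RInt (fun x : R =>
          RInt (fun y : R => F (x, y)) (- sqrt (r ^ 2 - x ^ 2)) (sqrt (r ^ 2 - x ^ 2)))
       (- r) r.

Definition S_area (h g : C -> C) (r : R) : R :=
  disk_integral (fun z : C => Cmod (C_derive h z) ^ 2 - Cmod (C_derive g z) ^ 2) r.

Definition disk_image (f : C -> C) (w : C) : Prop :=
  exists z : C, unit_disk z /\ w = f z.

Definition boundary (A : C -> Prop) (w : C) : Prop :=
  forall eps : R, 0 < eps ->
    (exists u : C, A u /\ Cmod (u - w)%C < eps) /\
    (exists u : C, ~ A u /\ Cmod (u - w)%C < eps).

(* Valued in [Rbar], so that the distance to an empty set is +oo. *)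
Definition dist_to (w : C) (A : C -> Prop) : Rbar :=
  Glb_Rbar (fun d : R => exists u : C, A u /\ d = Cmod (u - w)%C).

Definition Li2 (x : R) : R := Series (fun k : nat => x ^ (S k) / (INR (S k)) ^ 2).

Definition P_poly (q : nat) (lam : nat -> R) (w : R) : R :=
  sum_n_m (fun i : nat => lam i * w ^ i) 1 q.

Definition t_of (N : nat) : nat := ((N - 1) / 2)%nat.

Definition bohr_lhs (beta mu lambda : R) (q : nat) (lam : nat -> R) (m N : nat)
    (f h g : C -> C) (a b : nat -> C) (z : C) : R :=
  let t := t_of N in
  let r := Cmod z in
  let c := fun n : nat => Cmod (a n) + Cmod (b n) in
  beta * Cmod (f z) ^ m
  + Series (fun k : nat => c (N + k)%nat * r ^ (N + k))
  + mu * sign (INR t) * sum_n_m (fun n : nat => c n ^ 2) 1 t * (r ^ N / (1 - r))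
  + lambda * (1 + r / (1 - r))
      * Series (fun k : nat => c (t + 1 + k)%nat ^ 2 * r ^ (2 * (t + 1 + k)))
  + P_poly q lam (S_area h g r / PI).

Definition bohr_ineq (beta mu lambda : R) (q : nat) (lam : nat -> R) (m N : nat)
    (f h g : C -> C) (a b : nat -> C) (z : C) : Prop :=
  Rbar_le (Finite (bohr_lhs beta mu lambda q lam m N f h g a b z))
          (dist_to (f (RtoC 0)) (boundary (disk_image f))).

Definition G_M (M r : R) : R := r + 2 * M * (r + (1 - r) * ln (1 - r)).

Definition Phi_Mt (M : R) (N t : nat) (r : R) : R :=
  r ^ N / (1 - r) * sign (INR t)
  * (1 + 4 * M ^ 2 * sum_n_m (fun n : nat => 1 / (INR n ^ 2 * (INR n - 1) ^ 2)) 2 t).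

Definition G_t (t : nat) (r : R) : R :=
  (r ^ 2 + 1) * Li2 (r ^ 2) + 2 * (r ^ 2 - 1) * ln (1 - r ^ 2) - 3 * r ^ 2
  - sum_n_m (fun n : nat => r ^ (2 * n) / (INR n ^ 2 * (INR n - 1) ^ 2)) 2 t.

Definition F_M (M r : R) : R :=
  r ^ 2 + 4 * M ^ 2 *
    (r ^ 2 * Li2 (r ^ 2) - (r ^ 2 + (1 - r ^ 2) * ln (1 - r ^ 2))).

Definition Phi (M beta mu lambda : R) (q : nat) (lam : nat -> R) (m N : nat)
    (r : R) : R :=
  let t := t_of N in
  beta * G_M M r ^ m
  + 2 * M * (r + (1 - r) * ln (1 - r)
             - sum_n_m (fun n : nat => r ^ n / (INR n * (INR n - 1))) 2 (N - 1))
  + mu * Phi_Mt M N t r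
  + 4 * M ^ 2 * lambda * (1 + r / (1 - r)) * G_t t r
  + P_poly q lam (F_M M r)
  - 1 - 2 * M * (1 - 2 * ln 2).

(* No [R' > Rad] works: the inequality fails for some member of the class at
   some point z of the disk with |z| <= R'. *)
Definition best_possible (M beta mu lambda : R) (q : nat) (lam : nat -> R) (m N : nat)
    (Rad : R) : Prop :=
  forall R' : R, Rad < R' ->
    exists (f h g : C -> C) (a b : nat -> C) (z : C),
      in_P0H M f h g /\ power_expansion h a /\ power_expansion g b /\
      unit_disk z /\ Cmod z <= R' /\
      ~ bohr_ineq beta mu lambda q lam m N f h g a b z.

(* On the hypotheses used with these definitions.
   - Phi < 0 near 0 and Phi is strictly increasing on (0,1), so a root exists
     exactly when Phi is positive somewhere; this can fail, e.g. when
     beta = mu = lambda = 0, all lam i = 0 and M is small.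
   - Let F(z) = z + 2M (z + (1-z) ln(1-z)) and
     L = 1 + 2M (1 - 2 ln 2) = |F(-1)|, the lower bound for the distance.
     If M <= 1 / ln 4 then Re F' > 0 on the disk and F(-1) is a boundary point of
     the image, at distance L.  If M > 1 / ln 4 then F' vanishes inside (-1,0),
     F(-1) is an interior point of the image, the distance for F exceeds L, and
     the radius is no longer best possible. *)

(* Main.v *)
Require Import Defs.
From Stdlib Require Import Reals Lra Lia Classical ClassicalEpsilon FunctionalExtensionality.
From Coquelicot Require Import Coquelicot.
Open Scope R_scope.

(** Write f = h + conj g, h = sum a_n z^n, g = sum b_n z^n, and let r = |z|. Everything
    rests on comparing f with F(z) = z + 2M sum_(n >= 2) z^n / (n (n-1)), which lies in the
    class because z F''(z) = 2M z / (1 - z).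

    For |ep| = 1 the function 1 + (z h'' + ep z g'') / M has positive real part on the disk
    and takes the value 1 at 0. Two classical facts about such functions are obtained by
    integrating their real part on a circle against a nonnegative trigonometric polynomial
    ([positive_kernel]): the n-th coefficient has modulus at most 2 ([caratheodory_coef]),
    and the real part is at least (1 - r) / (1 + r) ([harnack]).
    The first one, with ep chosen to align the phases, gives
    |a_n| + |b_n| <= 2M / (n (n-1)) ([class_coef_le]). The second one, integrated along a
    radius, gives Re h' - |g'| >= 1 - 2M ln (1 + r) ([class_first_derivative]), and
    integrated once more, |f(z)| >= growth M r = r - 2M ((1 + r) ln (1 + r) - r)
    ([class_growth]).

    The value growth M 1 is L = 1 + 2M (1 - 2 ln 2) ([dist_bound]), and the boundary of the
    image stays at distance at least L from f(0) = 0, because the image contains the open disk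
    of radius L ([class_covers]). Univalence is not available when M is large, but the covering
    needs less: choose rho with growth M rho > |w| such that Re h' > |g'| on |z| <= rho.
    A minimiser of |f - v| over that disk which is interior must satisfy f = v, since
    otherwise moving along v - f decreases the distance; and it is interior as long as v is
    close to a value already known to be attained. So the segment from 0 to w is covered
    by finitely many small steps ([harmonic_covering]).

    The area S_r is an iterated integral. The monomials z^j conj(z)^k have explicit primitives
    in y, up to a monomial of lower degree in conj z, so each one reduces to an integral over
    a semicircle; they are orthogonal, and uniform convergence gives
    S_r = pi sum n (|a_n|^2 - |b_n|^2) r^(2n) ([S_area_series]). Hence |S_r / pi| <= F_M(r).

    Replacing each ingredient of the left-hand side by its bound yields an expression in
    the numbers 2M / (n (n-1)) alone. Summing the series (through the expansions of ln (1 - x)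
    and of the dilogarithm) identifies it with Phi(r) + L ([Phi_split]). It increases
    strictly with r, so Phi has at most one zero, and the inequality holds up to that zero.
    At a positive real point all the bounds are attained by F, so the left-hand side for F is
    exactly Phi(r) + L. If 2M ln 2 <= 1 then Re F' > 0, so F is injective and real exactly
    on the real axis; therefore -L = F(-1) is not a value of F but a limit of values,
    i.e. a boundary point at distance L ([ext_boundary]), and beyond the zero of Phi the
    inequality fails for F ([ext_best_possible]). *)

(** * Power series over the complex numbers *)

Fixpoint partial_sum (u : nat -> R) (n : nat) : R :=
  match n with O => 0 | S k => partial_sum u k + u k end.

Fixpoint partial_pseries (a : nat -> C) (z : C) (n : nat) : C :=
  match n with O => RtoC 0 | S k => (partial_pseries a z k + a k * z ^ k)%C end.

(** Convergence of the complex series as a real limit, so that all estimates are made on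
    moduli of partial sums. *)
Definition pseries_to (a : nat -> C) (z l : C) : Prop :=
  is_lim_seq (fun n => Cmod (partial_pseries a z n - l)%C) 0.

Definition summable (a : nat -> C) : Prop :=
  forall r, 0 <= r < 1 -> ex_series (fun n => Cmod (a n) * r ^ n).

Definition deriv_coef (a : nat -> C) (n : nat) : C := (INR (S n) * a (S n))%C.

(** Summed componentwise, which makes the sum a total function of z. *)
Definition pseries_sum (a : nat -> C) (z : C) : C :=
  (Series (fun n => Re (a n * z ^ n)%C), Series (fun n => Im (a n * z ^ n)%C)).

Lemma re_minus (u v : C) : Re (u - v)%C = Re u - Re v.
Proof. reflexivity. Qed.

Lemma partial_sum_ext u v n : (forall k, u k = v k) -> partial_sum u n = partial_sum v n.
Proof. intros H. induction n as [|n IH]; simpl; [reflexivity|]. now rewrite IH, H. Qed.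

Lemma partial_sum_sum_n u n : partial_sum u (S n) = sum_n u n.
Proof.
  induction n as [|n IH].
  - rewrite sum_O; simpl; ring.
  - rewrite sum_Sn, <- IH; reflexivity.
Qed.

Lemma partial_sum_lim u l : is_series u l -> is_lim_seq (partial_sum u) l.
Proof.
  intros H. apply is_lim_seq_incr_1.
  apply is_lim_seq_ext with (sum_n u); [|exact H].
  intros n; symmetry; apply partial_sum_sum_n.
Qed.

Lemma partial_sum_lim_inv u (l : R) : is_lim_seq (partial_sum u) l -> is_series u l.
Proof.
  intros H. apply is_lim_seq_incr_1 in H.
  apply (is_lim_seq_ext _ (sum_n u)) in H; [exact H|].
  intros n; apply partial_sum_sum_n.
Qed.

Lemma partial_sum_le u v n : (forall k, (k < n)%nat -> u k <= v k) -> partial_sum u n <=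
    partial_sum v n.
Proof.
  induction n as [|n IH]; intros H; simpl; [lra|].
  assert (H1 := H n ltac:(lia)).
  assert (H2 := IH (fun k hk => H k ltac:(lia))). lra.
Qed.

Lemma partial_sum_le_series u l n :
  (forall k, 0 <= u k) -> is_series u l -> partial_sum u n <= l.
Proof.
  intros Hu H. apply (is_lim_seq_incr_compare _ _ (partial_sum_lim _ _ H)).
  intros k; simpl; specialize (Hu k); lra.
Qed.

Lemma partial_pseries_sum_n a z n :
  partial_pseries a z (S n) = sum_n (G := C_AbelianMonoid) (fun k => (a k * z ^ k)%C) n.
Proof.
  induction n as [|n IH].
  - rewrite sum_O. simpl. ring.
  - rewrite sum_Sn, <- IH; reflexivity.
Qed.

Lemma is_pseries_pseries_to a z l :
  @is_pseries C_AbsRing C_NormedModule a z l <-> pseries_to a z l.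
Proof.
  assert (E : forall n, partial_pseries a z (S n) =
     @sum_n (NormedModule.AbelianMonoid C_AbsRing C_NormedModule)
       (fun k => scal (pow_n (K := C_AbsRing) z k) (a k)) n).
  { intros n. rewrite partial_pseries_sum_n. apply sum_n_ext. intros k.
    change (a k * z ^ k = z ^ k * a k)%C. ring. }
  unfold pseries_to. split; intros H.
  - apply is_lim_seq_incr_1, is_lim_seq_spec. intros eps.
    assert (Hs : 0 < sqrt 2) by (apply sqrt_lt_R0; lra).
    assert (He : 0 < eps / sqrt 2) by (apply Rdiv_lt_0_compat; [apply eps|exact Hs]).
    destruct (proj1 (filterlim_locally _ _) H (mkposreal _ He)) as [n0 Hn].
    exists n0. intros n hn. specialize (Hn n hn).
    apply C_NormedModule_mixin_compat2 in Hn.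
    rewrite E, Rminus_0_r, Rabs_pos_eq by apply Cmod_ge_0.
    eapply Rlt_le_trans; [exact Hn|]. simpl. right. field. lra.
  - apply is_lim_seq_incr_1 in H. apply is_lim_seq_spec in H.
    apply filterlim_locally. intros eps.
    destruct (H eps) as [n0 Hn]. exists n0. intros n hn.
    apply C_NormedModule_mixin_compat1. specialize (Hn n hn).
    rewrite Rminus_0_r, Rabs_pos_eq in Hn by apply Cmod_ge_0.
    rewrite E in Hn. exact Hn.
Qed.

Lemma lim_zero_le (u v : nat -> R) :
  (forall n, 0 <= u n <= v n) -> is_lim_seq v 0 -> is_lim_seq u 0.
Proof.
  intros H Hv. apply is_lim_seq_le_le with (fun _ => 0) v; auto.
  apply is_lim_seq_const.
Qed.

Lemma pseries_to_unique a z l l' : pseries_to a z l -> pseries_to a z l' -> l = l'.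
Proof.
  intros H H'.
  assert (Hz : Cmod (l - l')%C = 0).
  { apply Rle_antisym; [|apply Cmod_ge_0].
    assert (K := is_lim_seq_plus' _ _ _ _ H H'). rewrite Rplus_0_r in K.
    apply (is_lim_seq_le (fun _ => Cmod (l - l')%C) _ (Cmod (l - l')%C) 0 ) in K;
      [exact K| |apply is_lim_seq_const].
    intros n.
    replace (l - l')%C with (- (partial_pseries a z n - l) + (partial_pseries a z n - l'))%C by
        ring.
    eapply Rle_trans; [apply Cmod_triangle|]. rewrite Cmod_opp. lra. }
  apply Cmod_eq_0 in Hz. replace l with (l - l' + l')%C by ring. rewrite Hz. ring.
Qed.

Lemma partial_pseries_Cmod_le a z r n :
  Cmod z <= r -> Cmod (partial_pseries a z n) <= partial_sum (fun k => Cmod (a k) * r ^ k) n.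
Proof.
  intros Hz; induction n as [|n IH]; simpl; [rewrite Cmod_0; lra|].
  eapply Rle_trans; [apply Cmod_triangle|]. apply Rplus_le_compat; [exact IH|].
  rewrite Cmod_mult, Cmod_pow. apply Rmult_le_compat_l; [apply Cmod_ge_0|].
  apply pow_incr; split; [apply Cmod_ge_0|exact Hz].
Qed.

Lemma partial_pseries_diff_le a z r n k :
  Cmod z <= r ->
  Cmod (partial_pseries a z (n + k) - partial_pseries a z n)%C
    <= partial_sum (fun k => Cmod (a k) * r ^ k) (n + k) - partial_sum (fun k => Cmod (a k) * r ^
        k) n.
Proof.
  intros Hz; induction k as [|k IH].
  - rewrite Nat.add_0_r.
    replace (partial_pseries a z n - partial_pseries a z n)%C with (RtoC 0) by ring. rewrite
        Cmod_0; lra.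
  - rewrite Nat.add_succ_r. simpl.
    replace (partial_pseries a z (n + k) + a (n + k)%nat * z ^ (n + k) - partial_pseries a z n)%C
      with ((partial_pseries a z (n + k) - partial_pseries a z n) + a (n + k)%nat * z ^ (n + k))%C
          by ring.
    eapply Rle_trans; [apply Cmod_triangle|].
    rewrite Cmod_mult, Cmod_pow.
    assert (Cmod (a (n + k)%nat) * Cmod z ^ (n + k) <= Cmod (a (n + k)%nat) * r ^ (n + k)).
    { apply Rmult_le_compat_l; [apply Cmod_ge_0|].
      apply pow_incr; split; [apply Cmod_ge_0|exact Hz]. }
    lra.
Qed.

(** The modulus series dominates the error of the n-th partial sum; this is what makes the
    convergence uniform on closed subdisks. *)
Lemma pseries_to_tail a z l r A n :
  Cmod z <= r -> is_series (fun k => Cmod (a k) * r ^ k) A -> pseries_to a z l ->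
  Cmod (partial_pseries a z n - l)%C <= A - partial_sum (fun k => Cmod (a k) * r ^ k) n.
Proof.
  intros Hz HA H.
  assert (K1 : is_lim_seq (fun k => Cmod (partial_pseries a z (k + n) - l)%C
     + (partial_sum (fun k => Cmod (a k) * r ^ k) (k + n) - partial_sum (fun k => Cmod (a k) * r ^
         k) n))
     (0 + (A - partial_sum (fun k => Cmod (a k) * r ^ k) n))).
  { apply is_lim_seq_plus'.
    - apply (is_lim_seq_incr_n (fun k => Cmod (partial_pseries a z k - l)%C) n), H.
    - apply is_lim_seq_minus'; [|apply is_lim_seq_const].
      apply (is_lim_seq_incr_n (partial_sum (fun k => Cmod (a k) * r ^ k)) n), partial_sum_lim, HA.
          }
  rewrite Rplus_0_l in K1.
  refine (is_lim_seq_le (fun _ => _) _ (Finite _) (Finite _) _ (is_lim_seq_const _) K1).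
  intros k. rewrite (Nat.add_comm k n).
  replace (partial_pseries a z n - l)%C
    with ((partial_pseries a z (n + k) - l) + - (partial_pseries a z (n + k) - partial_pseries a z
        n))%C by ring.
  eapply Rle_trans; [apply Cmod_triangle|]. rewrite Cmod_opp.
  apply Rplus_le_compat_l, partial_pseries_diff_le, Hz.
Qed.

Lemma pseries_to_Cmod_le a z l r A :
  Cmod z <= r -> is_series (fun k => Cmod (a k) * r ^ k) A -> pseries_to a z l -> Cmod l <= A.
Proof.
  intros Hz HA H. generalize (pseries_to_tail a z l r A 0 Hz HA H). simpl.
  replace (0 - l)%C with (- l)%C by ring. rewrite Cmod_opp. lra.
Qed.

Lemma summable_pseries_to a z : summable a -> Cmod z < 1 -> pseries_to a z (pseries_sum a z).
Proof.
  intros Ha Hz.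
  assert (Hr : ex_series (fun n => Cmod (a n * z ^ n)%C)).
  { apply ex_series_ext with (fun n => Cmod (a n) * Cmod z ^ n).
    - intros n; now rewrite Cmod_mult, Cmod_pow.
    - apply Ha; split; [apply Cmod_ge_0|exact Hz]. }
  assert (HR : is_series (fun n => Re (a n * z ^ n)%C) (Re (pseries_sum a z))).
  { apply Series_correct. apply (ex_series_le (K := R_AbsRing) (V := R_CompleteNormedModule)) with
      (2 := Hr).
    intros n. apply re_le_Cmod. }
  assert (HI : is_series (fun n => Im (a n * z ^ n)%C) (Im (pseries_sum a z))).
  { apply Series_correct. apply (ex_series_le (K := R_AbsRing) (V := R_CompleteNormedModule)) with
      (2 := Hr).
    intros n. eapply Rle_trans; [|apply Rmax_Cmod]. apply Rmax_r. }
  assert (ER : forall n, partial_sum (fun n => Re (a n * z ^ n)%C) n = Re (partial_pseries a z n)).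
  { induction n as [|n IH]; [reflexivity|]. cbn [partial_sum partial_pseries].
    now rewrite re_plus, IH. }
  assert (EI : forall n, partial_sum (fun n => Im (a n * z ^ n)%C) n = Im (partial_pseries a z n)).
  { induction n as [|n IH]; [reflexivity|]. cbn [partial_sum partial_pseries].
    now rewrite im_plus, IH. }
  apply partial_sum_lim in HR. apply partial_sum_lim in HI.
  unfold pseries_to.
  apply lim_zero_le with (fun n => Rabs (Re (partial_pseries a z n) - Re (pseries_sum a z))
                                   + Rabs (Im (partial_pseries a z n) - Im (pseries_sum a z))).
  - intros n. split; [apply Cmod_ge_0|].
    set (u := partial_pseries a z n). set (v := pseries_sum a z).
    replace (u - v)%C with (RtoC (Re u - Re v) + Ci * RtoC (Im u - Im v))%C
      by (apply injective_projections; simpl; unfold Re, Im; ring).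
    eapply Rle_trans; [apply Cmod_triangle|].
    rewrite Cmod_mult, Cmod_Ci, !Cmod_R. lra.
  - rewrite <- (Rplus_0_r 0) at 1.
    apply is_lim_seq_plus'.
    + apply (is_lim_seq_abs_0 (fun n => Re (partial_pseries a z n) - Re (pseries_sum a z))).
      replace 0 with (Re (pseries_sum a z) - Re (pseries_sum a z)) by ring.
      apply is_lim_seq_minus'; [|apply is_lim_seq_const].
      apply is_lim_seq_ext with (2 := HR). exact ER.
    + apply (is_lim_seq_abs_0 (fun n => Im (partial_pseries a z n) - Im (pseries_sum a z))).
      replace 0 with (Im (pseries_sum a z) - Im (pseries_sum a z)) by ring.
      apply is_lim_seq_minus'; [|apply is_lim_seq_const].
      apply is_lim_seq_ext with (2 := HI). exact EI.
Qed.

Lemma pseries_to_terms_lim a z l : pseries_to a z l -> is_lim_seq (fun n => Cmod (a n) * Cmod z ^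
    n) 0.
Proof.
  intros H.
  assert (K := is_lim_seq_plus' _ _ _ _ (proj1 (is_lim_seq_incr_1 _ _) H) H).
  rewrite Rplus_0_r in K. apply lim_zero_le with (2 := K). intros n. split.
  - apply Rmult_le_pos; [apply Cmod_ge_0|apply pow_le, Cmod_ge_0].
  - rewrite <- Cmod_pow, <- Cmod_mult.
    replace (a n * z ^ n)%C
      with ((partial_pseries a z (S n) - l) + - (partial_pseries a z n - l))%C by (cbn
          [partial_pseries]; ring).
    eapply Rle_trans; [apply Cmod_triangle|]. rewrite Cmod_opp. apply Rle_refl.
Qed.

Lemma lim_seq_bounded (u : nat -> R) :
  is_lim_seq u 0 -> exists B, forall n, Rabs (u n) <= B.
Proof.
  intros H. apply is_lim_seq_spec in H. destruct (H (mkposreal 1 Rlt_0_1)) as [n0 Hn].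
  assert (Hfin : forall m, exists B, forall n, (n < m)%nat -> Rabs (u n) <= B).
  { induction m as [|m [B HB]]; [exists 0; lia|].
    exists (Rmax B (Rabs (u m))). intros n hn.
    destruct (Nat.eq_dec n m) as [->|hne]; [apply Rmax_r|].
    eapply Rle_trans; [apply HB; lia|apply Rmax_l]. }
  destruct (Hfin n0) as [B HB]. exists (Rmax B 1). intros n.
  destruct (Nat.lt_ge_cases n n0) as [h|h].
  - eapply Rle_trans; [apply HB, h|apply Rmax_l].
  - specialize (Hn n h). rewrite Rminus_0_r in Hn. simpl in Hn.
    eapply Rle_trans; [apply Rlt_le, Hn|apply Rmax_r].
Qed.

(** Comparison with the geometric series of ratio r / rho for an intermediate radius rho. *)
Lemma bounded_terms_summable (a : nat -> C) :
  (forall rho, 0 < rho < 1 -> exists B, forall n, Cmod (a n) * rho ^ n <= B) -> summable a.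
Proof.
  intros H r Hr.
  destruct (H ((1 + r) / 2) ltac:(lra)) as [B HB].
  set (rho := (1 + r) / 2) in *. assert (Hrho : r < rho < 1) by (unfold rho; lra).
  apply (ex_series_le (K := R_AbsRing) (V := R_CompleteNormedModule))
    with (fun n => B * (r / rho) ^ n).
  - intros n. change (Rabs (Cmod (a n) * r ^ n) <= B * (r / rho) ^ n).
    assert (0 <= (r / rho) ^ n) by (apply pow_le, Rmult_le_pos; [|apply Rlt_le, Rinv_0_lt_compat];
        lra).
    rewrite Rabs_pos_eq by (apply Rmult_le_pos; [apply Cmod_ge_0|apply pow_le; lra]).
    replace (Cmod (a n) * r ^ n) with (Cmod (a n) * rho ^ n * (r / rho) ^ n).
    + apply Rmult_le_compat_r; auto.
    + unfold Rdiv. rewrite Rpow_mult_distr, pow_inv. field. apply pow_nonzero; lra.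
  - apply (ex_series_scal (K := R_AbsRing) (V := R_NormedModule) B). apply ex_series_geom.
    rewrite Rabs_pos_eq by (apply Rmult_le_pos; [|apply Rlt_le, Rinv_0_lt_compat]; lra).
    apply Rmult_lt_reg_r with rho; [lra|]. unfold Rdiv. rewrite Rmult_assoc, Rinv_l; lra.
Qed.

Lemma expansion_summable h a :
  (forall z, Cmod z < 1 -> pseries_to a z (h z)) -> summable a.
Proof.
  intros H. apply bounded_terms_summable. intros rho Hrho.
  assert (Hz : Cmod (RtoC rho) < 1) by (rewrite Cmod_R, Rabs_pos_eq; lra).
  destruct (lim_seq_bounded _ (pseries_to_terms_lim _ _ _ (H _ Hz))) as [B HB].
  exists B. intros n. specialize (HB n).
  rewrite Cmod_R, (Rabs_pos_eq rho) in HB by lra.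
  eapply Rle_trans; [apply Rle_abs|exact HB].
Qed.

Lemma summable_radius a r : summable a -> 0 <= r < 1 ->
  Rbar_lt (Rabs r) (CV_radius (fun n => Cmod (a n))).
Proof.
  intros Ha Hr.
  destruct (CV_radius_bounded (fun n => Cmod (a n))) as [Hub _].
  set (rho := (1 + r) / 2). assert (Hrho : r < rho < 1) by (unfold rho; lra).
  apply Rbar_lt_le_trans with (Finite rho).
  - simpl. rewrite Rabs_pos_eq; lra.
  - apply Hub. destruct (lim_seq_bounded _ (ex_series_lim_0 _ (Ha rho ltac:(lra)))) as [B HB].
    exists B. exact HB.
Qed.

(** The moduli of the derived coefficients are the derived coefficients of the moduli, and a
    real power series keeps its radius of convergence when differentiated. *)
Lemma summable_deriv_coef a : summable a -> summable (deriv_coef a).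
Proof.
  intros Ha r Hr.
  assert (H := ex_pseries_derive _ _ (summable_radius a r Ha Hr)).
  apply ex_pseries_R in H. apply ex_series_ext with (2 := H).
  intros n. unfold PS_derive, deriv_coef.
  rewrite Cmod_mult, Cmod_R, Rabs_pos_eq by apply pos_INR. reflexivity.
Qed.

(** * Termwise differentiation *)

(** The second-order Taylor remainder of a power. From n to n + 1 the remainder is
    multiplied by z + w, and n z^(n-1) w^2 is added to it. *)
Lemma pow_remainder (z w : C) (rho : R) n :
  Cmod z <= rho -> Cmod (z + w)%C <= rho ->
  Cmod ((z + w) ^ S (S n) - z ^ S (S n) - INR (S (S n)) * z ^ S n * w)%C
    <= INR (S (S n)) * INR (S n) * rho ^ n * Cmod w ^ 2.
Proof.
  intros Hz Hzw. assert (Hrho : 0 <= rho) by (eapply Rle_trans; [apply Cmod_ge_0|exact Hz]).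
  induction n as [|n IH].
  - replace ((z + w) ^ 2 - z ^ 2 - INR 2 * z ^ 1 * w)%C with (w ^ 2)%C.
    + rewrite Cmod_pow. simpl. assert (0 <= Cmod w) by apply Cmod_ge_0. nra.
    + simpl INR. rewrite RtoC_plus. simpl. ring.
  - replace ((z + w) ^ S (S (S n)) - z ^ S (S (S n)) - INR (S (S (S n))) * z ^ S (S n) * w)%C
      with ((z + w) * ((z + w) ^ S (S n) - z ^ S (S n) - INR (S (S n)) * z ^ S n * w)
            + INR (S (S n)) * z ^ S n * w ^ 2)%C.
    2:{ rewrite (S_INR (S (S n))), RtoC_plus. simpl. ring. }
    eapply Rle_trans; [apply Cmod_triangle|].
    rewrite !Cmod_mult, !Cmod_pow, Cmod_R, Rabs_pos_eq by apply pos_INR.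
    set (E := Cmod ((z + w) ^ S (S n) - z ^ S (S n) - INR (S (S n)) * z ^ S n * w)%C) in *.
    assert (H1 : Cmod (z + w)%C * E
       <= rho * (INR (S (S n)) * INR (S n) * rho ^ n * Cmod w ^ 2)).
    { apply Rmult_le_compat; auto; apply Cmod_ge_0. }
    assert (H2 : INR (S (S n)) * Cmod z ^ S n * Cmod w ^ 2
       <= INR (S (S n)) * rho ^ S n * Cmod w ^ 2).
    { apply Rmult_le_compat_r; [apply pow_le, Cmod_ge_0|].
      apply Rmult_le_compat_l; [apply pos_INR|].
      apply pow_incr; split; [apply Cmod_ge_0|exact Hz]. }
    assert (H3 : INR (S (S (S n))) * INR (S (S n)) * rho ^ S n * Cmod w ^ 2 =
       rho * (INR (S (S n)) * INR (S n) * rho ^ n * Cmod w ^ 2)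
       + INR (S (S n)) * rho ^ S n * Cmod w ^ 2
       + INR (S (S n)) * rho ^ S n * Cmod w ^ 2).
    { rewrite (S_INR (S (S n))), (S_INR (S n)). simpl. ring. }
    assert (H4 : 0 <= INR (S (S n)) * rho ^ S n * Cmod w ^ 2).
    { apply Rmult_le_pos; [apply Rmult_le_pos; [apply pos_INR|apply pow_le, Hrho]|].
      apply pow_le, Cmod_ge_0. }
    lra.
Qed.

Lemma partial_pseries_remainder a (z w : C) rho n :
  Cmod z <= rho -> Cmod (z + w)%C <= rho ->
  Cmod (partial_pseries a (z + w) (S (S n)) - partial_pseries a z (S (S n)) - w * partial_pseries
      (deriv_coef a) z (S n))%C
    <= partial_sum (fun k => Cmod (deriv_coef (deriv_coef a) k) * rho ^ k) n * Cmod w ^ 2.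
Proof.
  intros Hz Hzw. induction n as [|n IH].
  - replace (partial_pseries a (z + w) 2 - partial_pseries a z 2 - w * partial_pseries (deriv_coef
      a) z 1)%C with (RtoC 0).
    + rewrite Cmod_0; simpl; lra.
    + unfold deriv_coef; cbn [partial_pseries]. change (INR 1) with 1. ring.
  - replace (partial_pseries a (z + w) (S (S (S n))) - partial_pseries a z (S (S (S n))) - w *
      partial_pseries (deriv_coef a) z (S (S n)))%C
     with ((partial_pseries a (z + w) (S (S n)) - partial_pseries a z (S (S n)) - w *
         partial_pseries (deriv_coef a) z (S n))
       + a (S (S n)) * ((z + w) ^ S (S n) - z ^ S (S n) - INR (S (S n)) * z ^ S n * w))%C.
    2:{ cbn [partial_pseries]. change (deriv_coef a (S n)) with (INR (S (S n)) * a (S (S n)))%C.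
        ring. }
    cbn [partial_sum]. rewrite Rmult_plus_distr_r.
    eapply Rle_trans; [apply Cmod_triangle|]. apply Rplus_le_compat; [exact IH|].
    rewrite Cmod_mult.
    eapply Rle_trans; [apply Rmult_le_compat_l; [apply Cmod_ge_0|]; apply pow_remainder; eauto|].
    unfold deriv_coef. rewrite !Cmod_mult, !Cmod_R, !Rabs_pos_eq by apply pos_INR.
    right; ring.
Qed.

(** Summing the remainders of the monomials against the twice derived coefficients gives a
    bound quadratic in w, uniform on |z| <= rho. Differentiability, continuity and the
    derivative along lines all follow from it. *)
Lemma pseries_to_remainder a (h : C -> C) rho :
  summable a -> (forall z, Cmod z < 1 -> pseries_to a z (h z)) -> 0 <= rho < 1 ->
  exists K, forall z w, Cmod z <= rho -> Cmod (z + w)%C <= rho ->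
    Cmod (h (z + w)%C - h z - w * pseries_sum (deriv_coef a) z)%C <= K * Cmod w ^ 2.
Proof.
  intros Ha Hh Hrho.
  destruct (summable_deriv_coef _ (summable_deriv_coef _ Ha) rho Hrho) as [K HK].
  exists K. intros z w Hz Hzw.
  assert (L1 := proj1 (is_lim_seq_incr_n _ 2 _) (Hh z ltac:(lra))).
  assert (L2 := proj1 (is_lim_seq_incr_n _ 2 _) (Hh (z + w)%C ltac:(lra))).
  assert (L3 := proj1 (is_lim_seq_incr_1 _ _)
     (summable_pseries_to (deriv_coef a) z (summable_deriv_coef a Ha) ltac:(lra))).
  assert (L4 : is_lim_seq (fun n => Cmod (partial_pseries a (z + w) (n + 2) - h (z + w))%C
      + Cmod (partial_pseries a z (n + 2) - h z)%C
      + Cmod w * Cmod (partial_pseries (deriv_coef a) z (S n) - pseries_sum (deriv_coef a) z)%C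
      + K * Cmod w ^ 2) (0 + 0 + Cmod w * 0 + K * Cmod w ^ 2)).
  { apply is_lim_seq_plus'; [|apply is_lim_seq_const].
    apply is_lim_seq_plus'; [apply is_lim_seq_plus'; assumption|].
    apply (is_lim_seq_scal_l _ (Cmod w) 0), L3. }
  replace (0 + 0 + Cmod w * 0 + K * Cmod w ^ 2) with (K * Cmod w ^ 2) in L4 by ring.
  refine (is_lim_seq_le (fun _ => _) _ (Finite _) (Finite _) _ (is_lim_seq_const _) L4).
  intros n. rewrite Nat.add_comm. simpl plus.
  replace (h (z + w) - h z - w * pseries_sum (deriv_coef a) z)%C
   with (- (partial_pseries a (z + w) (S (S n)) - h (z + w)) + (partial_pseries a z (S (S n)) - h z)
     + w * (partial_pseries (deriv_coef a) z (S n) - pseries_sum (deriv_coef a) z)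
     + (partial_pseries a (z + w) (S (S n)) - partial_pseries a z (S (S n)) - w * partial_pseries
         (deriv_coef a) z (S n)))%C by ring.
  eapply Rle_trans; [apply Cmod_triangle|]. apply Rplus_le_compat.
  - eapply Rle_trans; [apply Cmod_triangle|]. rewrite Cmod_mult.
    apply Rplus_le_compat_r. eapply Rle_trans; [apply Cmod_triangle|].
    rewrite Cmod_opp. apply Rle_refl.
  - eapply Rle_trans; [apply partial_pseries_remainder; eauto|].
    apply Rmult_le_compat_r; [apply pow_le, Cmod_ge_0|].
    apply partial_sum_le_series; auto.
    intros k. apply Rmult_le_pos; [apply Cmod_ge_0|apply pow_le; lra].
Qed.

Lemma pseries_to_is_derive a (h : C -> C) z :
  summable a -> (forall z, Cmod z < 1 -> pseries_to a z (h z)) -> Cmod z < 1 ->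
  @is_derive C_AbsRing C_NormedModule h z (pseries_sum (deriv_coef a) z).
Proof.
  intros Ha Hh Hz. assert (0 <= Cmod z) by apply Cmod_ge_0.
  set (rho := (1 + Cmod z) / 2).
  destruct (pseries_to_remainder a h rho Ha Hh ltac:(unfold rho; lra)) as [K HK].
  split; [apply is_linear_scal_l|].
  intros x Hx. assert (Ex : z = x).
  { apply (is_filter_lim_locally_unique (K := C_AbsRing) (V := AbsRing_NormedModule C_AbsRing)),
      Hx. }
  subst x. intros eps.
  set (d := Rmin (rho - Cmod z) (eps / (Rabs K + 1))).
  assert (HK1 : 0 < Rabs K + 1) by (generalize (Rabs_pos K); lra).
  assert (Hd : 0 < d).
  { apply Rmin_glb_lt; [unfold rho; lra|]. apply Rdiv_lt_0_compat; [apply eps|exact HK1]. }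
  exists (mkposreal _ Hd). intros y Hy.
  change (Cmod (y - z)%C < d) in Hy.
  change (Cmod (h y - h z - (y - z) * pseries_sum (deriv_coef a) z)%C <= eps * Cmod (y - z)%C).
  set (w := (y - z)%C) in *. replace y with (z + w)%C by (unfold w; ring).
  assert (Hd1 := Rmin_l (rho - Cmod z) (eps / (Rabs K + 1))).
  assert (Hd2 := Rmin_r (rho - Cmod z) (eps / (Rabs K + 1))). fold d in Hd1, Hd2.
  assert (Hw := Cmod_ge_0 w).
  eapply Rle_trans; [apply HK; [unfold rho; lra|]|].
  { eapply Rle_trans; [apply Cmod_triangle|]. lra. }
  replace (K * Cmod w ^ 2) with (K * Cmod w * Cmod w) by ring.
  apply Rmult_le_compat_r; [exact Hw|].
  assert (K * Cmod w <= (Rabs K + 1) * d).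
  { apply Rle_trans with ((Rabs K + 1) * Cmod w).
    - apply Rmult_le_compat_r; auto. generalize (Rle_abs K); lra.
    - apply Rmult_le_compat_l; lra. }
  assert ((Rabs K + 1) * d <= (Rabs K + 1) * (eps / (Rabs K + 1)))
    by (apply Rmult_le_compat_l; lra).
  replace ((Rabs K + 1) * (eps / (Rabs K + 1))) with (pos eps) in * by (field; lra). lra.
Qed.

Lemma disk_locally (z : C) (P : C -> Prop) :
  Cmod z < 1 -> (forall w, Cmod w < 1 -> P w) -> @locally (AbsRing_UniformSpace C_AbsRing) z P.
Proof.
  intros Hz H.
  assert (Hd : 0 < 1 - Cmod z) by lra.
  exists (mkposreal _ Hd). intros w Hw. apply H.
  replace w with (z + (w - z))%C by ring.
  eapply Rle_lt_trans; [apply Cmod_triangle|]. change (Cmod (w - z)%C < 1 - Cmod z) in Hw. lra.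
Qed.

Lemma C_derive_pseries_to a (h : C -> C) z :
  summable a -> (forall z, Cmod z < 1 -> pseries_to a z (h z)) -> Cmod z < 1 ->
  C_derive h z = pseries_sum (deriv_coef a) z.
Proof. intros Ha Hh Hz. apply is_C_derive_unique, pseries_to_is_derive; auto. Qed.

(** The derivative of h is known to be the derived series only on the disk, which is why the
    second derivative is taken through local equality. *)
Lemma C_derive2_pseries_to a (h : C -> C) z :
  summable a -> (forall z, Cmod z < 1 -> pseries_to a z (h z)) -> Cmod z < 1 ->
  C_derive (C_derive h) z = pseries_sum (deriv_coef (deriv_coef a)) z.
Proof.
  intros Ha Hh Hz. apply is_C_derive_unique.
  apply (is_derive_ext_loc (K := C_AbsRing) (V := C_NormedModule) (pseries_sum (deriv_coef a))).
  - apply disk_locally; auto. intros w Hw. symmetry; apply C_derive_pseries_to; auto.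
  - apply pseries_to_is_derive; auto; [apply summable_deriv_coef, Ha|].
    intros w Hw. apply summable_pseries_to; auto. apply summable_deriv_coef, Ha.
Qed.

Lemma is_derive_quadratic (psi : R -> R) t d K delta :
  0 < delta ->
  (forall s, Rabs (s - t) < delta -> Rabs (psi s - psi t - (s - t) * d) <= K * (s - t) ^ 2) ->
  is_derive psi t d.
Proof.
  intros Hdelta H. split; [apply is_linear_scal_l|].
  intros x Hx. assert (Ex : t = x).
  { apply (is_filter_lim_locally_unique (K := R_AbsRing) (V := R_NormedModule)), Hx. }
  subst x. intros eps.
  assert (HK1 : 0 < Rabs K + 1) by (generalize (Rabs_pos K); lra).
  set (e := Rmin delta (eps / (Rabs K + 1))).
  assert (He : 0 < e).
  { apply Rmin_glb_lt; [lra|]. apply Rdiv_lt_0_compat; [apply eps|exact HK1]. }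
  exists (mkposreal _ He). intros s Hs.
  change (Rabs (s - t) < e) in Hs.
  change (Rabs (psi s - psi t - (s - t) * d) <= eps * Rabs (s - t)).
  assert (Hd1 := Rmin_l delta (eps / (Rabs K + 1))).
  assert (Hd2 := Rmin_r delta (eps / (Rabs K + 1))). fold e in Hd1, Hd2.
  eapply Rle_trans; [apply H; lra|].
  assert (Hw := Rabs_pos (s - t)).
  replace ((s - t) ^ 2) with (Rabs (s - t) * Rabs (s - t))
    by (rewrite <- Rabs_mult, Rabs_pos_eq; [ring|apply Rle_0_sqr]).
  rewrite <- Rmult_assoc. apply Rmult_le_compat_r; [exact Hw|].
  assert (K * Rabs (s - t) <= (Rabs K + 1) * e).
  { apply Rle_trans with ((Rabs K + 1) * Rabs (s - t)).
    - apply Rmult_le_compat_r; auto. generalize (Rle_abs K); lra.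
    - apply Rmult_le_compat_l; lra. }
  assert ((Rabs K + 1) * e <= (Rabs K + 1) * (eps / (Rabs K + 1)))
    by (apply Rmult_le_compat_l; lra).
  replace ((Rabs K + 1) * (eps / (Rabs K + 1))) with (pos eps) in * by (field; lra). lra.
Qed.

(** With c = 1 and c = -i this gives the real and the imaginary part along a line; with c =
    conj e it gives the radial component. *)
Lemma line_derive a (h : C -> C) (c z0 e : C) (t : R) :
  summable a -> (forall z, Cmod z < 1 -> pseries_to a z (h z)) ->
  Cmod (z0 + t * e)%C < 1 ->
  is_derive (fun s : R => Re (c * h (z0 + s * e))%C) t
            (Re (c * (pseries_sum (deriv_coef a) (z0 + t * e) * e))%C).
Proof.
  intros Ha Hh Hz. set (z := (z0 + t * e)%C) in *.
  assert (0 <= Cmod z) by apply Cmod_ge_0.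
  set (rho := (1 + Cmod z) / 2).
  destruct (pseries_to_remainder a h rho Ha Hh ltac:(unfold rho; lra)) as [K HK].
  assert (He := Cmod_ge_0 e).
  apply is_derive_quadratic with (Cmod c * K * Cmod e ^ 2) ((rho - Cmod z) / (Cmod e + 1)).
  { apply Rdiv_lt_0_compat; unfold rho; lra. }
  intros s Hs.
  set (w := ((s - t)%R * e)%C).
  assert (Hw : Cmod w = Rabs (s - t) * Cmod e) by (unfold w; now rewrite Cmod_mult, Cmod_R).
  replace (z0 + s * e)%C with (z + w)%C by (unfold z, w; rewrite RtoC_minus; ring).
  fold z.
  replace (Re (c * h (z + w)%C)%C - Re (c * h z)%C - (s - t) * Re (c * (pseries_sum (deriv_coef a)
      z * e))%C)
    with (Re (c * (h (z + w) - h z - w * pseries_sum (deriv_coef a) z))%C).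
  2:{ replace (c * (h (z + w) - h z - w * pseries_sum (deriv_coef a) z))%C
       with (c * h (z + w) - c * h z - (s - t)%R * (c * (pseries_sum (deriv_coef a) z * e)))%C
       by (unfold w; ring).
      unfold Cminus. rewrite !re_plus, !re_opp, re_scal_l. ring. }
  eapply Rle_trans; [apply re_le_Cmod|]. rewrite Cmod_mult, !Rmult_assoc.
  apply Rmult_le_compat_l; [apply Cmod_ge_0|].
  assert (Hw2 : Cmod w <= rho - Cmod z).
  { rewrite Hw. apply Rle_trans with ((rho - Cmod z) / (Cmod e + 1) * (Cmod e + 1)).
    - apply Rmult_le_compat; try lra; apply Rabs_pos.
    - right; field; lra. }
  eapply Rle_trans; [apply HK|].
  - unfold rho; lra.
  - eapply Rle_trans; [apply Cmod_triangle|]. lra.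
  - rewrite Hw, Rpow_mult_distr, pow2_abs. right; ring.
Qed.

(** * Means over the unit circle *)

Definition cis (t : R) : C := (cos t, sin t).

Lemma cis_pow t n : (cis t ^ n)%C = cis (INR n * t).
Proof.
  induction n as [|n IH].
  - unfold cis. simpl INR. rewrite Rmult_0_l, cos_0, sin_0. reflexivity.
  - rewrite Cpow_S, IH, S_INR. unfold cis, Cmult; simpl.
    replace ((INR n + 1) * t) with (t + INR n * t) by ring.
    rewrite cos_plus, sin_plus. f_equal; ring.
Qed.

Lemma Cmod_cis t : Cmod (cis t) = 1.
Proof.
  unfold cis, Cmod; simpl. transitivity (sqrt 1); [f_equal|apply sqrt_1].
  generalize (sin2_cos2 t). unfold Rsqr. lra.
Qed.

Lemma cis_conj t : (cis t * Cconj (cis t))%C = RtoC 1.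
Proof. rewrite <- Cmod2_conj, Cmod_cis. simpl. f_equal. ring. Qed.

(** The normalised mean over the circle, as a relation: combining means then never requires
    a separate proof of integrability. *)
Definition circle_mean (F : R -> R) (v : R) : Prop := is_RInt F 0 (2 * PI) (2 * PI * v).

Lemma circle_mean_plus F G v w :
  circle_mean F v -> circle_mean G w -> circle_mean (fun t => F t + G t) (v + w).
Proof.
  unfold circle_mean. intros HF HG.
  rewrite Rmult_plus_distr_l. exact (is_RInt_plus (V := R_NormedModule) _ _ _ _ _ _ HF HG).
Qed.

Lemma circle_mean_scal F v k : circle_mean F v -> circle_mean (fun t => k * F t) (k * v).
Proof.
  unfold circle_mean. intros HF.
  replace (2 * PI * (k * v)) with (k * (2 * PI * v)) by ring.
  exact (is_RInt_scal (V := R_NormedModule) _ _ _ k _ HF).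
Qed.

Lemma circle_mean_ext F G v : (forall t, F t = G t) -> circle_mean F v -> circle_mean G v.
Proof. intros H HF. apply is_RInt_ext with (2 := HF). intros t _; apply H. Qed.

Lemma circle_mean_const k : circle_mean (fun _ => k) k.
Proof.
  unfold circle_mean. replace (2 * PI * k) with ((2 * PI - 0) * k) by ring.
  exact (is_RInt_const (V := R_NormedModule) 0 (2 * PI) k).
Qed.

Lemma circle_mean_ge0 F v : (forall t, 0 <= F t) -> circle_mean F v -> 0 <= v.
Proof.
  intros H HF. assert (HPI := PI_RGT_0).
  assert (H0 : 0 <= 2 * PI * v).
  { assert (K := is_RInt_const (V := R_NormedModule) 0 (2 * PI) 0).
    change (scal (2 * PI - 0) 0) with ((2 * PI - 0) * 0) in K. rewrite Rmult_0_r in K.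
    apply (is_RInt_le (fun _ => 0) F 0 (2 * PI)); auto; lra. }
  nra.
Qed.

Lemma circle_mean_pow (c : C) n :
  circle_mean (fun t => Re (c * cis t ^ n)%C) (match n with O => Re c | S _ => 0 end).
Proof.
  destruct n as [|n].
  - apply circle_mean_ext with (fun _ => Re c); [|apply circle_mean_const].
    intros t. change (cis t ^ 0)%C with (RtoC 1). now rewrite Cmult_1_r.
  - unfold circle_mean. set (m := INR (S n)).
    assert (Hm : m <> 0) by (apply not_0_INR; lia).
    apply (is_RInt_ext (fun t => Re c * cos (m * t) - Im c * sin (m * t))).
    { intros t _. rewrite cis_pow. fold m. unfold cis. now rewrite re_mult. }
    set (P := fun t => (Re c * sin (m * t) + Im c * cos (m * t)) / m).
    replace (2 * PI * 0) with (minus (P (2 * PI)) (P 0)).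
    + apply (is_RInt_derive (V := R_CompleteNormedModule)).
      * intros t _. unfold P. auto_derive; [trivial|]. field. exact Hm.
      * intros t _. apply (ex_derive_continuous (V := R_NormedModule)). auto_derive. trivial.
    + unfold P, minus, plus, opp; simpl.
      replace (m * (2 * PI)) with (0 + 2 * INR (S n) * PI) by (unfold m; ring).
      rewrite sin_period, cos_period, Rmult_0_r. field. exact Hm.
Qed.

(** The mean of Re (al u^n) Re (ka conj(u)^n) over |u| = 1. The constant term lacks the
    factor 1/2 of the other frequencies. *)
Definition pairing (al ka : C) (n : nat) : R :=
  match n with O => Re al * Re ka | S _ => Re (al * ka)%C / 2 end.

(** Re x Re y is half of Re (x y) + Re (x conj y); each of these is a single frequency on
    the circle. *)
Lemma circle_mean_monomials (al ka : C) j n :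
  circle_mean (fun t => Re (al * cis t ^ j)%C * Re (ka * Cconj (cis t) ^ n)%C)
              (if Nat.eq_dec j n then pairing al ka n else 0).
Proof.
  assert (Hprod : forall u v : C, Re u * Re v = Re (u * v)%C / 2 + Re (u * Cconj v)%C / 2).
  { intros u v. rewrite !re_mult, re_conj, im_conj. field. }
  assert (Hsame : forall t k, (cis t ^ k * Cconj (cis t) ^ k)%C = RtoC 1).
  { intros t k. rewrite <- Cpow_mult_l, cis_conj. apply Cpow_1_l. }
  assert (H2 : circle_mean (fun t => Re (al * Cconj ka * cis t ^ (j + n))%C / 2)
      (match n with O => match j with O => Re (al * Cconj ka)%C / 2 | S _ => 0 end | S _ => 0 end)).
  { apply circle_mean_ext with (fun t => / 2 * Re (al * Cconj ka * cis t ^ (j + n))%C).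
    { intros t; field. }
    replace (match n with O => match j with O => Re (al * Cconj ka)%C / 2 | S _ => 0 end | S _ => 0
        end)
     with (/ 2 * match (j + n)%nat with O => Re (al * Cconj ka)%C | S _ => 0 end).
    { apply circle_mean_scal, circle_mean_pow. }
    destruct j, n; simpl; field. }
  assert (H1 : circle_mean (fun t => Re (al * ka * (cis t ^ j * Cconj (cis t) ^ n))%C / 2)
      (if Nat.eq_dec j n then Re (al * ka)%C / 2 else 0)).
  { apply circle_mean_ext with (fun t => / 2 * Re (al * ka * (cis t ^ j * Cconj (cis t) ^ n))%C).
    { intros t; field. }
    replace (if Nat.eq_dec j n then Re (al * ka)%C / 2 else 0)
     with (/ 2 * (if Nat.eq_dec j n then Re (al * ka)%C else 0))
     by (destruct (Nat.eq_dec j n); field).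
    apply circle_mean_scal.
    destruct (Nat.eq_dec j n) as [->|hne].
    - apply circle_mean_ext with (fun _ => Re (al * ka)%C); [|apply circle_mean_const].
      intros t. now rewrite Hsame, Cmult_1_r.
    - destruct (Nat.lt_ge_cases n j) as [h|h].
      + destruct (Nat.le_exists_sub (S n) j h) as [k [-> _]].
        apply circle_mean_ext with (fun t => Re (al * ka * cis t ^ S k)%C);
          [|apply (circle_mean_pow _ (S k))].
        intros t. replace (k + S n)%nat with (S k + n)%nat by lia.
        rewrite Cpow_add_r, <- (Cmult_assoc (cis t ^ S k)), Hsame. now rewrite Cmult_1_r.
      + destruct (Nat.le_exists_sub (S j) n ltac:(lia)) as [k [-> _]].
        apply circle_mean_ext with (fun t => Re (Cconj (al * ka) * cis t ^ S k)%C);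
          [|apply (circle_mean_pow _ (S k))].
        intros t. replace (k + S j)%nat with (j + S k)%nat by lia.
        rewrite Cpow_add_r, (Cmult_assoc (cis t ^ j)), Hsame, Cmult_1_l.
        rewrite <- (re_conj (al * ka * _)), !Cmult_conj, Cpow_conj, Cconj_conj. reflexivity. }
  apply circle_mean_ext with (fun t => Re (al * ka * (cis t ^ j * Cconj (cis t) ^ n))%C / 2
     + Re (al * Cconj ka * cis t ^ (j + n))%C / 2).
  { intros t. rewrite Hprod. f_equal; f_equal; f_equal.
    - ring.
    - rewrite Cmult_conj, Cpow_conj, Cconj_conj, Cpow_add_r. ring. }
  replace (if Nat.eq_dec j n then pairing al ka n else 0) with
   ((if Nat.eq_dec j n then Re (al * ka)%C / 2 else 0) +
    match n with O => match j with O => Re (al * Cconj ka)%C / 2 | S _ => 0 end | S _ => 0 end).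
  { apply circle_mean_plus; assumption. }
  unfold pairing. destruct (Nat.eq_dec j n) as [->|hne]; destruct n; try (destruct j; try lia); try
      ring.
  now rewrite <- Hprod.
Qed.

Lemma circle_mean_partial_pseries_monomial (p : nat -> C) (ka : C) J n :
  circle_mean (fun t => Re (partial_pseries p (cis t) J) * Re (ka * Cconj (cis t) ^ n)%C)
              (if Compare_dec.lt_dec n J then pairing (p n) ka n else 0).
Proof.
  induction J as [|J IH].
  - apply circle_mean_ext with (fun _ => 0); [intros t; simpl; ring|apply circle_mean_const].
  - assert (H := circle_mean_plus _ _ _ _ IH (circle_mean_monomials (p J) ka J n)).
    match type of H with circle_mean _ ?v =>
      replace (if Compare_dec.lt_dec n (S J) then pairing (p n) ka n else 0) with v end.
    + apply circle_mean_ext with (2 := H). intros t. cbn [partial_pseries]. rewrite re_plus. ring.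
    + destruct (Compare_dec.lt_dec n J), (Compare_dec.lt_dec n (S J)), (Nat.eq_dec J n);
        try lia; subst; ring.
Qed.

Lemma circle_mean_partial_pseries (p ka : nat -> C) J N : (N <= J)%nat ->
  circle_mean (fun t => Re (partial_pseries p (cis t) J) * Re (partial_pseries ka (Cconj (cis t))
      N))
              (partial_sum (fun n => pairing (p n) (ka n) n) N).
Proof.
  induction N as [|N IH]; intros HN.
  - apply circle_mean_ext with (fun _ => 0); [intros t; simpl; ring|apply circle_mean_const].
  - assert (H := circle_mean_plus _ _ _ _ (IH ltac:(lia)) (circle_mean_partial_pseries_monomial p
      (ka N) J N)).
    destruct (Compare_dec.lt_dec N J); [|lia].
    apply circle_mean_ext with (2 := H). intros t. cbn [partial_pseries]. rewrite !re_plus. ring.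
Qed.

Lemma circle_mean_partial_pseries_re (p : nat -> C) J : (1 <= J)%nat ->
  circle_mean (fun t => Re (partial_pseries p (cis t) J)) (Re (p O)).
Proof.
  intros HJ. assert (H := circle_mean_partial_pseries p (fun _ => RtoC 1) J 1 HJ).
  replace (Re (p O)) with (partial_sum (fun n => pairing (p n) 1 n) 1) by (simpl; ring).
  apply circle_mean_ext with (2 := H). intros t. simpl. ring.
Qed.

Lemma partial_pseries_conj_re (ka : nat -> C) z N :
  Re (partial_pseries ka (Cconj z) N) = Re (partial_pseries (fun n => Cconj (ka n)) z N).
Proof.
  induction N as [|N IH]; [reflexivity|]. cbn [partial_pseries].
  rewrite !re_plus, IH. f_equal.
  rewrite <- re_conj, Cmult_conj, Cpow_conj, Cconj_conj. reflexivity.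
Qed.

Lemma circle_mean_partial_pseries_conj_re (ka : nat -> C) N : (1 <= N)%nat ->
  circle_mean (fun t => Re (partial_pseries ka (Cconj (cis t)) N)) (Re (ka O)).
Proof.
  intros HN. rewrite <- (re_conj (ka O)).
  apply circle_mean_ext with (2 := circle_mean_partial_pseries_re (fun n => Cconj (ka n)) N HN).
  intros t. symmetry. apply partial_pseries_conj_re.
Qed.

Lemma partial_pseries_rescale (p : nat -> C) (rho : R) z n :
  partial_pseries (fun k => p k * RtoC rho ^ k)%C z n = partial_pseries p (rho * z)%C n.
Proof.
  induction n as [|n IH]; [reflexivity|]. cbn [partial_pseries]. rewrite IH, Cpow_mult_l. ring.
Qed.

(** The product of a nonnegative harmonic function on |z| = rho and an almost nonnegative
    trigonometric polynomial has an almost nonnegative mean, and by orthogonality the mean is a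
    finite sum in the coefficients. The slack tau allows truncations of infinite kernels. *)
Lemma positive_kernel (p ka : nat -> C) (P : C -> C) (rho tau : R) N :
  summable p -> (forall z, Cmod z < 1 -> pseries_to p z (P z)) ->
  (forall z, Cmod z < 1 -> 0 <= Re (P z)) -> p O = RtoC 1 ->
  0 <= rho < 1 -> 0 <= tau -> (1 <= N)%nat ->
  (forall t, - tau <= Re (partial_pseries ka (Cconj (cis t)) N)) ->
  - tau <= partial_sum (fun n => pairing (p n * RtoC rho ^ n)%C (ka n) n) N.
Proof.
  intros Hs Hp Hpos Hp0 Hrho Htau HN Hka.
  destruct (Hs rho Hrho) as [A HA].
  set (sig := fun J => A - partial_sum (fun k => Cmod (p k) * rho ^ k) J).
  assert (Hmod : forall t, Cmod (rho * cis t)%C = rho).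
  { intros t. rewrite Cmod_mult, Cmod_R, Cmod_cis, Rabs_pos_eq; lra. }
  assert (Hsig : forall J, 0 <= sig J).
  { intros J. eapply Rle_trans; [apply Cmod_ge_0|].
    apply (pseries_to_tail p (rho * cis 0)%C (P (rho * cis 0)%C) rho); auto.
    - now right. - apply Hp. rewrite Hmod; lra. }
  (* Truncating the series at J costs at most its tail sig J, so both factors become
     nonnegative after adding sig J and tau, and their product has nonnegative mean. *)
  assert (HJ : forall J, (N <= J)%nat ->
    0 <= partial_sum (fun n => pairing (p n * RtoC rho ^ n)%C (ka n) n) N + tau
         + sig J * (Re (ka O) + tau)).
  { intros J HNJ. set (q := fun k => (p k * RtoC rho ^ k)%C).
    assert (Hq0 : Re (q O) = 1) by (unfold q; rewrite Hp0; simpl; ring).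
    assert (M1 := circle_mean_partial_pseries q ka J N HNJ).
    assert (M2 := circle_mean_scal _ _ tau (circle_mean_partial_pseries_re q J ltac:(lia))).
    assert (M3 := circle_mean_scal _ _ (sig J) (circle_mean_partial_pseries_conj_re ka N HN)).
    assert (M4 := circle_mean_const (sig J * tau)).
    assert (M := circle_mean_plus _ _ _ _ (circle_mean_plus _ _ _ _ M1 M2)
                   (circle_mean_plus _ _ _ _ M3 M4)).
    apply circle_mean_ge0 in M.
    - rewrite Hq0 in M. unfold q in M.
      match goal with |- 0 <= ?x => match type of M with 0 <= ?y => replace x with y; [exact M|]
          end end.
      ring.
    - intros t.
      assert (H1 : - sig J <= Re (partial_pseries q (cis t) J)).
      { unfold q. rewrite partial_pseries_rescale.
        assert (T := pseries_to_tail p (rho * cis t)%C (P (rho * cis t)%C) rho A J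
           ltac:(rewrite Hmod; lra) HA ltac:(apply Hp; rewrite Hmod; lra)).
        assert (T2 := Hpos (rho * cis t)%C ltac:(rewrite Hmod; lra)).
        assert (T3 := re_le_Cmod (partial_pseries p (rho * cis t) J - P (rho * cis t))%C).
        rewrite re_minus in T3.
        unfold sig.
        generalize (Rle_abs (- (Re (partial_pseries p (rho * cis t) J) - Re (P (rho * cis t)%C)))).
        rewrite Rabs_Ropp. lra. }
      assert (H2 := Hka t).
      assert (0 <= (Re (partial_pseries q (cis t) J) + sig J) * (Re (partial_pseries ka (Cconj (cis
          t)) N) + tau))
        by (apply Rmult_le_pos; lra). lra. }
  set (V := partial_sum (fun n => pairing (p n * RtoC rho ^ n)%C (ka n) n) N) in *.
  assert (L : is_lim_seq (fun J => V + tau + sig (J + N)%nat * (Re (ka O) + tau))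
                (V + tau + (A - A) * (Re (ka O) + tau))).
  { apply is_lim_seq_plus'; [apply is_lim_seq_const|].
    apply is_lim_seq_mult'; [|apply is_lim_seq_const].
    apply is_lim_seq_minus'; [apply is_lim_seq_const|].
    apply (is_lim_seq_incr_n (partial_sum (fun k => Cmod (p k) * rho ^ k)) N), partial_sum_lim, HA.
        }
  assert (0 <= V + tau + (A - A) * (Re (ka O) + tau)); [|lra].
  refine (is_lim_seq_le (fun _ => 0) _ (Finite _) (Finite _) _ (is_lim_seq_const _) L).
  intros J. apply HJ. lia.
Qed.

(** * Functions with positive real part *)

Lemma lim_seq_to_1 : is_lim_seq (fun k => 1 - / (INR k + 1)) 1.
Proof.
  replace 1 with (1 - 0) at 1 by ring.
  replace (Finite 1) with (Finite (1 - 0)) by (f_equal; ring).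
  apply is_lim_seq_minus'; [apply is_lim_seq_const|].
  apply is_lim_seq_ext with (fun k => / INR (S k)); [intros k; now rewrite S_INR|].
  apply (is_lim_seq_incr_1 (fun k => / INR k)).
  change (Finite 0) with (Rbar_inv p_infty).
  apply is_lim_seq_inv; [apply is_lim_seq_INR|discriminate].
Qed.

Lemma seq_to_1_range k : 0 <= 1 - / (INR k + 1) < 1.
Proof.
  assert (Hk := pos_INR k).
  assert (0 < / (INR k + 1)) by (apply Rinv_0_lt_compat; lra).
  assert (/ (INR k + 1) <= / 1) by (apply Rinv_le_contravar; lra).
  rewrite Rinv_1 in *. lra.
Qed.

(** Carries a bound obtained on every circle of radius rho < 1 to the radius 1. *)
Lemma left_limit_le f a :
  (forall rho, 0 <= rho < 1 -> a <= f rho) -> continuity_pt f 1 -> a <= f 1.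
Proof.
  intros H Hf. assert (L := is_lim_seq_continuous _ _ _ Hf lim_seq_to_1).
  refine (is_lim_seq_le (fun _ => a) _ (Finite _) (Finite _) _ (is_lim_seq_const _) L).
  intros k. apply H, seq_to_1_range.
Qed.

Lemma partial_pseries_two_terms (ka c z : C) n N : (1 <= n < N)%nat ->
  partial_pseries (fun k => if Nat.eq_dec k 0 then c else if Nat.eq_dec k n then ka else RtoC 0) z N
   = (c + ka * z ^ n)%C.
Proof.
  intros HN. assert (H : forall m, partial_pseries (fun k => if Nat.eq_dec k 0 then c else if
      Nat.eq_dec k n then ka else RtoC 0) z (S m)
     = (c + if Compare_dec.le_dec n m then ka * z ^ n else RtoC 0)%C).
  { induction m as [|m IH].
    - simpl. destruct (Compare_dec.le_dec n 0); [lia|].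
      change (0 + c * 1 = c + 0)%C. ring.
    - replace (partial_pseries _ z (S (S m))) with (partial_pseries (fun k => if Nat.eq_dec k 0
        then c else if Nat.eq_dec k n then ka else RtoC 0) z (S m) + (if Nat.eq_dec (S m) 0 then c
            else if Nat.eq_dec (S m) n then ka else RtoC 0) * z ^ S m)%C by reflexivity.
      rewrite IH. destruct (Nat.eq_dec (S m) 0); [lia|].
      destruct (Compare_dec.le_dec n m), (Compare_dec.le_dec n (S m)), (Nat.eq_dec (S m) n); try
          lia; try ring.
      subst n. ring. }
  destruct N as [|N]; [lia|]. rewrite H.
  destruct (Compare_dec.le_dec n N); [reflexivity|lia].
Qed.

Lemma partial_sum_two_terms (u : nat -> R) n N : (1 <= n < N)%nat ->
  (forall k, k <> 0%nat -> k <> n -> u k = 0) -> partial_sum u N = u 0%nat + u n.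
Proof.
  intros HN Hu. assert (H : forall m, partial_sum u (S m)
     = u 0%nat + if Compare_dec.le_dec n m then u n else 0).
  { induction m as [|m IH].
    - simpl. destruct (Compare_dec.le_dec n 0); [lia|ring].
    - replace (partial_sum u (S (S m))) with (partial_sum u (S m) + u (S m)) by reflexivity.
      rewrite IH. destruct (Compare_dec.le_dec n m), (Compare_dec.le_dec n (S m)); try lia.
      + rewrite (Hu (S m)) by lia. ring.
      + replace (S m) with n by lia. ring.
      + rewrite (Hu (S m)) by lia. ring. }
  destruct N as [|N]; [lia|]. rewrite H.
  destruct (Compare_dec.le_dec n N); [reflexivity|lia].
Qed.

(** With constant term 1 this is the truncated Poisson kernel. For |v u| = s < 1 its real
    part is at least (1 - s) / (1 + s) up to a geometric error, and s0 is meant to be that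
    minimum. *)
Lemma geometric_kernel (v u : C) N s0 :
  (v * u)%C <> RtoC 1 ->
  partial_pseries (fun k => if Nat.eq_dec k 0 then (1 - s0)%C else (2 * v ^ k)%C) u (S N)
   = ((1 + v * u) / (1 - v * u) - s0 - 2 * (v * u) ^ S N / (1 - v * u))%C.
Proof.
  intros Hw. assert (Hw' : (1 - v * u)%C <> RtoC 0).
  { intros E. apply Hw. replace (v * u)%C with (1 - (1 - v * u))%C by ring. rewrite E. ring. }
  induction N as [|N IH].
  - cbn [partial_pseries]. destruct (Nat.eq_dec 0 0); [|lia]. simpl. field. exact Hw'.
  - replace (partial_pseries _ u (S (S N))) with (partial_pseries (fun k => if Nat.eq_dec k 0 then
      (1 - s0)%C else (2 * v ^ k)%C) u (S N) + (if Nat.eq_dec (S N) 0 then (1 - s0)%C else (2 * v ^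
          S N)%C) * u ^ S N)%C by reflexivity.
    rewrite IH. destruct (Nat.eq_dec (S N) 0); [lia|].
    rewrite <- Cmult_assoc, <- Cpow_mult_l, (Cpow_S (v * u) (S N)). field. exact Hw'.
Qed.

Lemma re_cayley_ge (w : C) s : Cmod w = s -> s < 1 ->
  (1 - s) / (1 + s) <= Re ((1 + w) / (1 - w))%C.
Proof.
  intros Hw Hs1. assert (H0 := Cmod_ge_0 w). rewrite Hw in H0.
  assert (H2 : s ^ 2 = Re w ^ 2 + Im w ^ 2) by (rewrite <- Hw; apply Cmod2_alt).
  assert (Hre : Rabs (Re w) <= s) by (rewrite <- Hw; apply re_le_Cmod).
  apply Rabs_le_between in Hre.
  set (x := Re w) in *. set (y := Im w) in *.
  replace w with ((x, y) : C) by (symmetry; apply surjective_pairing).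
  assert (Hd : 0 < (1 - x) ^ 2 + y ^ 2) by nra.
  replace (Re ((1 + (x, y)) / (1 - (x, y)))%C) with ((1 - s ^ 2) / ((1 - x) ^ 2 + y ^ 2)).
  - apply Rmult_le_reg_r with ((1 + s) * ((1 - x) ^ 2 + y ^ 2)); [nra|].
    replace ((1 - s) / (1 + s) * ((1 + s) * ((1 - x) ^ 2 + y ^ 2)))
      with ((1 - s) * ((1 - x) ^ 2 + y ^ 2)) by (field; lra).
    replace ((1 - s ^ 2) / ((1 - x) ^ 2 + y ^ 2) * ((1 + s) * ((1 - x) ^ 2 + y ^ 2)))
      with ((1 - s) * (1 + s) ^ 2) by (field; lra).
    apply Rmult_le_compat_l; nra.
  - rewrite H2. unfold Cdiv, Cinv, Cmult, Cplus, Cminus, Copp, Re; simpl. field.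
    nra.
Qed.

Section Caratheodory.
Variables (p : nat -> C) (P : C -> C).
Hypothesis Hs : summable p.
Hypothesis Hp : forall z, Cmod z < 1 -> pseries_to p z (P z).
Hypothesis Hpos : forall z, Cmod z < 1 -> 0 <= Re (P z).
Hypothesis Hp0 : p O = RtoC 1.

(** The kernel 1 + Re (ka u^n) is nonnegative. Taking every unimodular ka gives |p_n| <= 2.
    *)
Lemma caratheodory_coef ka n : (1 <= n)%nat -> Cmod ka <= 1 -> - 2 <= Re (p n * ka)%C.
Proof.
  intros Hn Hka.
  set (kk := fun k => if Nat.eq_dec k 0 then RtoC 1 else if Nat.eq_dec k n then ka else RtoC 0).
  assert (H : forall rho, 0 <= rho < 1 -> - 2 <= rho ^ n * Re (p n * ka)%C).
  { intros rho Hrho.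
    assert (K := positive_kernel p kk P rho 0 (S n) Hs Hp Hpos Hp0 Hrho (Rle_refl 0) ltac:(lia)).
    rewrite (partial_sum_two_terms _ n) in K; [|lia|].
    - assert (E : - 0 <= pairing (p 0%nat * RtoC rho ^ 0)%C (kk 0%nat) 0 + pairing (p n * RtoC rho
        ^ n)%C (kk n) n).
      { apply K. intros t. unfold kk. rewrite partial_pseries_two_terms by lia.
        rewrite re_plus, re_RtoC.
        assert (T := re_le_Cmod (ka * Cconj (cis t) ^ n)%C).
        rewrite Cmod_mult, Cmod_pow, Cmod_conj, Cmod_cis, pow1 in T.
        generalize (Rabs_maj2 (Re (ka * Cconj (cis t) ^ n)%C)). lra. }
      unfold kk in E. destruct (Nat.eq_dec 0 0); [|lia].
      destruct (Nat.eq_dec n 0); [lia|]. destruct (Nat.eq_dec n n); [|lia].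
      destruct n as [|m]; [lia|].
      unfold pairing in E. rewrite Hp0 in E.
      replace (p (S m) * RtoC rho ^ S m * ka)%C with (RtoC (rho ^ S m) * (p (S m) * ka))%C in E
        by (rewrite RtoC_pow; ring).
      rewrite !re_scal_l, re_RtoC in E.
      replace (Re (RtoC rho ^ 0)%C) with 1 in E by reflexivity. lra.
    - intros k h0 h1. unfold kk. destruct (Nat.eq_dec k 0); [lia|].
      destruct (Nat.eq_dec k n); [lia|]. destruct k; [lia|]. unfold pairing.
      rewrite Cmult_0_r, re_RtoC. field. }
  rewrite <- (Rmult_1_l (Re (p n * ka)%C)), <- (pow1 n).
  apply (left_limit_le (fun rho => rho ^ n * Re (p n * ka)%C)); [exact H|].
  apply derivable_continuous_pt. reg.
Qed.

(** The Poisson kernel of the circle |u| = |z| / s, truncated and lowered by its minimum (1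
    - s) / (1 + s), is nonnegative up to a geometric error which disappears in the limit. *)
Lemma harnack_on_smaller_disk z s : Cmod z < s < 1 -> (1 - s) / (1 + s) <= Re (P z).
Proof.
  intros Hz. assert (H0 := Cmod_ge_0 z).
  assert (Hrho : 0 <= Cmod z / s < 1).
  { split; [apply Rmult_le_pos; [lra|apply Rlt_le, Rinv_0_lt_compat; lra]|].
    apply Rmult_lt_reg_r with s; [lra|]. unfold Rdiv. rewrite Rmult_assoc, Rinv_l; lra. }
  set (rho := Cmod z / s) in *.
  assert (Hv : exists v : C, Cmod v = s /\ z = (rho * v)%C).
  { destruct (Req_dec (Cmod z) 0) as [E|E].
    - exists (RtoC s). split; [rewrite Cmod_R, Rabs_pos_eq; lra|].
      apply Cmod_eq_0 in E. unfold rho. rewrite E, Cmod_0. unfold Rdiv.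
      rewrite Rmult_0_l. ring.
    - assert (Er : RtoC rho <> RtoC 0).
      { intros Er. apply RtoC_inj in Er. unfold rho in Er. apply E.
        replace (Cmod z) with (Cmod z / s * s) by (field; lra). rewrite Er; ring. }
      exists (z / rho)%C. split; [|field; exact Er].
      rewrite Cmod_div by exact Er. rewrite Cmod_R, Rabs_pos_eq by lra.
      unfold rho. field. split; lra. }
  destruct Hv as [v [Hv Ez]].
  set (s0 := (1 - s) / (1 + s)).
  set (ka := fun k => if Nat.eq_dec k 0 then (1 - s0)%C else (2 * v ^ k)%C).
  assert (HN : forall N, s0 - 2 / (1 - s) * s ^ S N - Cmod (partial_pseries p z (S N) - P z)%C <=
      Re (P z)).
  { intros N. set (tau := 2 / (1 - s) * s ^ S N).
    assert (Htau : 0 <= tau).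
    { apply Rmult_le_pos; [apply Rlt_le, Rdiv_lt_0_compat; lra|apply pow_le; lra]. }
    assert (K := positive_kernel p ka P rho tau (S N) Hs Hp Hpos Hp0 Hrho Htau ltac:(lia)).
    assert (E : partial_sum (fun n => pairing (p n * RtoC rho ^ n)%C (ka n) n) (S N)
                = Re (partial_pseries p z (S N)) - s0).
    { clear K tau Htau. induction N as [|N IH].
      - cbn [partial_sum partial_pseries]. unfold ka, pairing. destruct (Nat.eq_dec 0 0); [|lia].
        rewrite Hp0, !re_plus, re_minus, !re_scal_l, !re_RtoC.
        change (Re (RtoC rho ^ 0)%C) with 1. change (Re (z ^ 0)%C) with 1. ring.
      - replace (partial_sum (fun n => pairing (p n * RtoC rho ^ n)%C (ka n) n) (S (S N))) with
         (partial_sum (fun n => pairing (p n * RtoC rho ^ n)%C (ka n) n) (S N)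
          + pairing (p (S N) * RtoC rho ^ S N)%C (ka (S N)) (S N)) by reflexivity.
        replace (partial_pseries p z (S (S N))) with (partial_pseries p z (S N) + p (S N) * z ^ S
            N)%C by reflexivity.
        rewrite IH, re_plus. unfold ka, pairing. destruct (Nat.eq_dec (S N) 0); [lia|].
        replace (p (S N) * RtoC rho ^ S N * (2 * v ^ S N))%C with (2 * (p (S N) * z ^ S N))%C
          by (rewrite Ez, Cpow_mult_l; ring).
        rewrite re_scal_l. field. }
    rewrite E in K.
    assert (Hc : forall t, - tau <= Re (partial_pseries ka (Cconj (cis t)) (S N))).
    { intros t. set (w := (v * Cconj (cis t))%C).
      assert (Hw : Cmod w = s) by (unfold w; rewrite Cmod_mult, Cmod_conj, Cmod_cis; lra).
      assert (Hw1 : w <> RtoC 1) by (intros Ew; rewrite Ew, Cmod_1 in Hw; lra).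
      unfold ka. rewrite geometric_kernel by exact Hw1. fold w.
      rewrite !re_minus, re_RtoC.
      assert (C1 := re_cayley_ge w s Hw ltac:(lra)). fold s0 in C1.
      assert (C2 : Rabs (Re (2 * w ^ S N / (1 - w))%C) <= tau).
      { eapply Rle_trans; [apply re_le_Cmod|].
        assert (D : 1 - s <= Cmod (1 - w)%C).
        { assert (T := Cmod_triangle (1 - w)%C w).
          replace (1 - w + w)%C with (RtoC 1) in T by ring. rewrite Cmod_1, Hw in T. lra. }
        rewrite Cmod_div, Cmod_mult, Cmod_pow, Cmod_R, Hw, Rabs_pos_eq by
          (try lra; intros E1; rewrite E1, Cmod_0 in D; lra).
        unfold tau. replace (2 / (1 - s) * s ^ S N) with (2 * s ^ S N / (1 - s)) by (field; lra).
        apply Rmult_le_compat_l; [apply Rmult_le_pos; [lra|apply pow_le; lra]|].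
        apply Rinv_le_contravar; lra. }
      generalize (Rle_abs (Re (2 * w ^ S N / (1 - w))%C)). lra. }
    specialize (K Hc).
    assert (T := re_le_Cmod (partial_pseries p z (S N) - P z)%C).
    rewrite re_minus in T.
    generalize (Rle_abs (Re (partial_pseries p z (S N)) - Re (P z))). lra. }
  assert (L : is_lim_seq (fun N => s0 - 2 / (1 - s) * s ^ S N - Cmod (partial_pseries p z (S N) - P
      z)%C)
                (s0 - 2 / (1 - s) * 0 - 0)).
  { apply is_lim_seq_minus'; [apply is_lim_seq_minus'; [apply is_lim_seq_const|]|].
    - apply (is_lim_seq_scal_l _ (2 / (1 - s)) 0).
      apply (is_lim_seq_incr_1 (fun n => s ^ n)), is_lim_seq_geom. rewrite Rabs_pos_eq; lra.
    - apply (is_lim_seq_incr_1 (fun n => Cmod (partial_pseries p z n - P z)%C)), Hp. lra. }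
  replace (s0 - 2 / (1 - s) * 0 - 0) with s0 in L by ring.
  exact (is_lim_seq_le _ (fun _ => Re (P z)) (Finite _) (Finite _) HN L (is_lim_seq_const _)).
Qed.

Lemma harnack z : Cmod z < 1 -> (1 - Cmod z) / (1 + Cmod z) <= Re (P z).
Proof.
  intros Hz. assert (H0 := Cmod_ge_0 z). assert (HX := Hpos z Hz).
  set (r := Cmod z) in *. set (X := Re (P z)) in *.
  destruct (Rle_lt_dec ((1 - r) / (1 + r)) X) as [h|h]; [exact h|exfalso].
  assert (h1 : X * (1 + r) < 1 - r).
  { apply Rmult_lt_compat_r with (r := 1 + r) in h; [|lra].
    replace ((1 - r) / (1 + r) * (1 + r)) with (1 - r) in h by (field; lra). exact h. }
  (* The map x |-> (1 - x) / (1 + x) is an involution, so X < (1 - r) / (1 + r) means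
     r < (1 - X) / (1 + X), and any s in between contradicts the bound at s. *)
  set (s := (r + (1 - X) / (1 + X)) / 2).
  assert (Ha : (1 - X) / (1 + X) * (1 + X) = 1 - X) by (field; lra).
  set (y := (1 - X) / (1 + X)) in *.
  assert (Hy : r < y) by (apply Rmult_lt_reg_r with (1 + X); nra).
  assert (Hy1 : y <= 1) by (apply Rmult_le_reg_r with (1 + X); nra).
  assert (Hs1 : r < s < y) by (unfold s; lra).
  assert (K := harnack_on_smaller_disk z s ltac:(unfold r in *; lra)). fold X in K.
  apply Rmult_le_compat_r with (r := 1 + s) in K; [|lra].
  replace ((1 - s) / (1 + s) * (1 + s)) with (1 - s) in K by (field; lra). nra.
Qed.
End Caratheodory.

(** * Coefficient, derivative and growth bounds in the class *)

Lemma pseries_to_at_0 a : pseries_to a 0 (a O).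
Proof.
  apply is_lim_seq_incr_1. apply is_lim_seq_ext with (fun _ => 0); [|apply is_lim_seq_const].
  intros n. replace (partial_pseries a 0 (S n)) with (a O).
  - replace (a O - a O)%C with (RtoC 0) by ring. now rewrite Cmod_0.
  - induction n as [|n IH].
    + cbn [partial_pseries]. change (RtoC 0 ^ 0)%C with (RtoC 1). ring.
    + replace (partial_pseries a 0 (S (S n))) with (partial_pseries a 0 (S n) + a (S n) * 0 ^ S
        n)%C by reflexivity.
      rewrite <- IH, Cpow_S. ring.
Qed.

(** The sign of the derivative is only required in the open interval: at the origin the
    Harnack bound carries a factor s and gives no information. *)
Lemma nonneg_derivative_le (f df : R -> R) a b :
  a <= b -> (forall x, a <= x <= b -> is_derive f x (df x)) ->
  (forall x, a < x < b -> 0 <= df x) -> f a <= f b.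
Proof.
  intros Hab Hf Hdf. destruct Hab as [Hab| ->]; [|apply Rle_refl].
  destruct (MVT_cor2 f df a b Hab) as [c [Hc Hc']].
  - intros c Hc. apply is_derive_Reals, Hf, Hc.
  - assert (0 <= df c * (b - a)) by (apply Rmult_le_pos; [apply Hdf, Hc'|lra]). lra.
Qed.

(** Phases are aligned on negative values because the positive-kernel bounds are lower
    bounds. *)
Lemma opposite_phase (c : C) : exists ka : C, Cmod ka = 1 /\ (c * ka)%C = RtoC (- Cmod c).
Proof.
  destruct (Req_dec (Cmod c) 0) as [E|E].
  - exists (RtoC 1). split; [apply Cmod_1|]. rewrite E. apply Cmod_eq_0 in E. rewrite E.
    rewrite Ropp_0. ring.
  - assert (E' : RtoC (Cmod c) <> RtoC 0) by (intros K; apply E, RtoC_inj, K).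
    exists (- Cconj c / Cmod c)%C. split.
    + rewrite Cmod_div by exact E'. rewrite Cmod_opp, Cmod_conj, Cmod_R, Rabs_pos_eq by apply
        Cmod_ge_0.
      field. exact E.
    + replace (c * (- Cconj c / Cmod c))%C with (- (c * Cconj c) / Cmod c)%C by (field; exact E').
      rewrite <- Cmod2_conj, RtoC_opp. rewrite RtoC_pow. simpl. field. exact E'.
Qed.

Lemma polar (z : C) : exists e : C, Cmod e = 1 /\ z = (Cmod z * e)%C.
Proof.
  destruct (opposite_phase z) as [ka [Hk E]].
  exists (- Cconj ka)%C. split; [rewrite Cmod_opp, Cmod_conj; exact Hk|].
  replace (Cmod z * - Cconj ka)%C with (- Cmod z * Cconj ka)%C by ring.
  rewrite <- RtoC_opp, <- E, <- Cmult_assoc, <- Cmod2_conj, Hk. simpl.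
  rewrite !Rmult_1_r. ring.
Qed.

Section ClassBounds.
Variables (M : R) (f h g : C -> C) (a b : nat -> C).
Hypothesis HM : 0 < M.
Hypothesis Hf : in_P0H M f h g.
Hypothesis Ha : power_expansion h a.
Hypothesis Hb : power_expansion g b.

Lemma class_pseries_to_h z : Cmod z < 1 -> pseries_to a z (h z).
Proof. intros Hz. apply is_pseries_pseries_to, Ha, Hz. Qed.

Lemma class_pseries_to_g z : Cmod z < 1 -> pseries_to b z (g z).
Proof. intros Hz. apply is_pseries_pseries_to, Hb, Hz. Qed.

Lemma class_summable_a : summable a.
Proof. exact (expansion_summable h a class_pseries_to_h). Qed.

Lemma class_summable_b : summable b.
Proof. exact (expansion_summable g b class_pseries_to_g). Qed.

Local Hint Resolve class_pseries_to_h class_pseries_to_g class_summable_a class_summable_b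
    summable_deriv_coef : core.

Lemma disk_0 : Cmod 0 < 1.
Proof. rewrite Cmod_0; lra. Qed.

Lemma class_h_0 : h 0 = RtoC 0. Proof. apply Hf. Qed.
Lemma class_g_0 : g 0 = RtoC 0. Proof. apply Hf. Qed.

Lemma class_a0 : a 0%nat = RtoC 0.
Proof.
  rewrite <- class_h_0. apply (pseries_to_unique a 0); [apply pseries_to_at_0|apply
      class_pseries_to_h, disk_0].
Qed.

Lemma class_b0 : b 0%nat = RtoC 0.
Proof.
  rewrite <- class_g_0. apply (pseries_to_unique b 0); [apply pseries_to_at_0|apply
      class_pseries_to_g, disk_0].
Qed.

Lemma pseries_sum_at_0 c : summable c -> pseries_sum c 0 = c O.
Proof.
  intros Hc. apply (pseries_to_unique c 0); [apply summable_pseries_to; [exact Hc|apply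
      disk_0]|apply pseries_to_at_0].
Qed.

Lemma class_a1 : a 1%nat = RtoC 1.
Proof.
  assert (H : C_derive h 0 = RtoC 1) by apply Hf.
  rewrite (C_derive_pseries_to a) in H by auto using disk_0. rewrite pseries_sum_at_0 in H by auto.
  rewrite <- H. unfold deriv_coef. simpl INR. ring.
Qed.

Lemma class_b1 : b 1%nat = RtoC 0.
Proof.
  assert (H : C_derive g 0 = RtoC 0) by apply Hf.
  rewrite (C_derive_pseries_to b) in H by auto using disk_0. rewrite pseries_sum_at_0 in H by auto.
  rewrite <- H. unfold deriv_coef. simpl INR. ring.
Qed.

Let h1 := pseries_sum (deriv_coef a).
Let g1 := pseries_sum (deriv_coef b).
Let h2 := pseries_sum (deriv_coef (deriv_coef a)).
Let g2 := pseries_sum (deriv_coef (deriv_coef b)).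

Lemma class_second_derivative z : Cmod z < 1 -> - M + Cmod (z * g2 z)%C < Re (z * h2 z)%C.
Proof.
  intros Hz. assert (H := proj2 Hf z Hz).
  rewrite (C_derive2_pseries_to a), (C_derive2_pseries_to b) in H by auto. exact H.
Qed.

(** The coefficients of 1 + z (h'' + ep g'') / M, the function with positive real part
    attached to f. *)
Definition car_coef (ep : C) (n : nat) : C :=
  match n with O => RtoC 1 | S k => ((deriv_coef (deriv_coef a) k + ep * deriv_coef (deriv_coef b)
      k) / M)%C end.

Definition car_fun (ep z : C) : C := (1 + z * (h2 z + ep * g2 z) / M)%C.

Lemma car_pseries_to ep z : Cmod z < 1 -> pseries_to (car_coef ep) z (car_fun ep z).
Proof.
  intros Hz. apply is_lim_seq_incr_1.
  assert (HM0 : RtoC M <> RtoC 0) by (intros E; apply RtoC_inj in E; lra).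
  assert (E : forall n, partial_pseries (car_coef ep) z (S n) =
    (1 + z * (partial_pseries (deriv_coef (deriv_coef a)) z n + ep * partial_pseries (deriv_coef
        (deriv_coef b)) z n) / M)%C).
  { induction n as [|n IH].
    - cbn [partial_pseries]. change (z ^ 0)%C with (RtoC 1). unfold car_coef. field. exact HM0.
    - replace (partial_pseries (car_coef ep) z (S (S n))) with (partial_pseries (car_coef ep) z (S
        n) + car_coef ep (S n) * z ^ S n)%C by reflexivity.
      rewrite IH. unfold car_coef. cbn [partial_pseries]. rewrite Cpow_S. field. exact HM0. }
  assert (L1 : pseries_to (deriv_coef (deriv_coef a)) z (h2 z)) by (apply summable_pseries_to;
      auto).
  assert (L2 : pseries_to (deriv_coef (deriv_coef b)) z (g2 z)) by (apply summable_pseries_to;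
      auto).
  apply lim_zero_le with (fun n => Cmod (z / M)%C * Cmod (partial_pseries (deriv_coef (deriv_coef
      a)) z n - h2 z)%C
     + Cmod (z / M * ep)%C * Cmod (partial_pseries (deriv_coef (deriv_coef b)) z n - g2 z)%C).
  - intros n. split; [apply Cmod_ge_0|]. rewrite <- !Cmod_mult.
    eapply Rle_trans; [|apply Cmod_triangle]. right. f_equal.
    rewrite E. unfold car_fun. field. exact HM0.
  - replace 0 with (Cmod (z / M)%C * 0 + Cmod (z / M * ep)%C * 0) by ring.
    apply is_lim_seq_plus'.
    + apply (is_lim_seq_scal_l _ (Cmod (z / M)%C) 0), L1.
    + apply (is_lim_seq_scal_l _ (Cmod (z / M * ep)%C) 0), L2.
Qed.

Lemma car_fun_re ep z :
  Re (car_fun ep z) = 1 + (Re (z * h2 z)%C + Re (ep * (z * g2 z))%C) / M.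
Proof.
  unfold car_fun. replace (z * (h2 z + ep * g2 z) / M)%C
    with ((z * h2 z + ep * (z * g2 z)) * RtoC (/ M))%C.
  - rewrite re_plus, re_scal_r, re_plus, re_RtoC. reflexivity.
  - rewrite RtoC_inv by lra. unfold Cdiv. ring.
Qed.

Lemma car_fun_pos ep z : Cmod ep = 1 -> Cmod z < 1 -> 0 <= Re (car_fun ep z).
Proof.
  intros Hep Hz. rewrite car_fun_re. assert (H := class_second_derivative z Hz).
  assert (T := re_le_Cmod (ep * (z * g2 z))%C). rewrite Cmod_mult, Hep, Rmult_1_l in T.
  generalize (Rabs_maj2 (Re (ep * (z * g2 z))%C)). intros T2.
  apply Rmult_le_reg_r with M; [exact HM|].
  replace ((1 + (Re (z * h2 z)%C + Re (ep * (z * g2 z))%C) / M) * M)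
    with (M + (Re (z * h2 z)%C + Re (ep * (z * g2 z))%C)) by (field; lra). lra.
Qed.

(** The coefficient of order n - 1 of the function attached to ep is n (n-1) (a_n + ep b_n)
    / M, and its modulus is at most 2 for every unimodular ep. *)
Lemma class_coef_le n : (2 <= n)%nat ->
  Cmod (a n) + Cmod (b n) <= 2 * M / (INR n * (INR n - 1)).
Proof.
  intros Hn. destruct n as [|[|k]]; try lia.
  destruct (opposite_phase (a (S (S k)))) as [ka [Hka Eka]].
  destruct (opposite_phase (b (S (S k)))) as [kb [Hkb Ekb]].
  (* With this ep the factor ka turns a_n into -|a_n| and ep b_n into -|b_n| at the same time. *)
  set (ep := (kb * Cconj ka)%C).
  assert (Hep : Cmod ep = 1) by (unfold ep; rewrite Cmod_mult, Cmod_conj, Hka, Hkb; ring).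
  assert (Eep : (ep * ka)%C = kb).
  { unfold ep. rewrite <- Cmult_assoc, (Cmult_comm (Cconj ka)), <- Cmod2_conj, Hka.
    simpl. rewrite !Rmult_1_r. ring. }
  assert (K := caratheodory_coef (car_coef ep) (car_fun ep)
     (expansion_summable _ _ (car_pseries_to ep)) (car_pseries_to ep)
     (fun z => car_fun_pos ep z Hep) eq_refl ka (S k) ltac:(lia) ltac:(lra)).
  assert (E : (car_coef ep (S k) * ka)%C =
     RtoC (INR (S k) * INR (S (S k)) / M * - (Cmod (a (S (S k))) + Cmod (b (S (S k)))))).
  { unfold car_coef, deriv_coef.
    assert (HM0 : RtoC M <> RtoC 0) by (intros E; apply RtoC_inj in E; lra).
    replace ((INR (S k) * (INR (S (S k)) * a (S (S k))) + ep * (INR (S k) * (INR (S (S k)) * b (S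
        (S k))))) / M * ka)%C
     with (INR (S k) * INR (S (S k)) / M * (a (S (S k)) * ka + b (S (S k)) * (ep * ka)))%C
     by (field; exact HM0).
    rewrite Eep, Eka, Ekb, <- RtoC_plus, RtoC_mult, RtoC_div, RtoC_mult by lra.
    f_equal. f_equal. ring. }
  rewrite E, re_RtoC in K.
  assert (P1 : 0 < INR (S k)) by (apply lt_0_INR; lia).
  assert (P2 : 0 < INR (S (S k))) by (apply lt_0_INR; lia).
  replace (INR (S (S k)) - 1) with (INR (S k)) by (rewrite (S_INR (S k)); ring).
  set (X := Cmod (a (S (S k))) + Cmod (b (S (S k)))) in *.
  apply Rmult_le_reg_r with (INR (S k) * INR (S (S k)) / M).
  { apply Rdiv_lt_0_compat; [apply Rmult_lt_0_compat; auto|exact HM]. }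
  replace (2 * M / (INR (S (S k)) * INR (S k)) * (INR (S k) * INR (S (S k)) / M)) with 2
    by (field; lra). lra.
Qed.

(** Integration of the Harnack bound Re (z h'' + ep z g'') >= -2M r / (1 + r) along a
    radius. *)
Lemma class_first_derivative z : Cmod z < 1 ->
  Cmod (g1 z) + (1 - 2 * M * ln (1 + Cmod z)) <= Re (h1 z).
Proof.
  intros Hz. assert (Ht := Cmod_ge_0 z).
  destruct (polar z) as [e [He Ez]]. set (t := Cmod z) in *.
  destruct (opposite_phase (g1 z)) as [ep [Hep Eep]].
  (* chi is Re (h' + ep g') + 2M ln (1 + s) along the radius through z, for the ep that
     makes ep g'(z) = -|g'(z)|; the Harnack bound says that it increases. *)
  set (chi := fun s : R => Re (1 * h1 (0 + s * e))%C + Re (ep * g1 (0 + s * e))%C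
                           + 2 * M * ln (1 + s)).
  set (dchi := fun s : R => Re (1 * (h2 (0 + s * e) * e))%C + Re (ep * (g2 (0 + s * e) * e))%C
                           + 2 * M * / (1 + s)).
  assert (Hse : forall s, 0 <= s -> Cmod (0 + s * e)%C = s).
  { intros s Hs. rewrite Cplus_0_l, Cmod_mult, Cmod_R, He, Rabs_pos_eq; lra. }
  assert (Hmono : chi 0 <= chi t).
  { apply (nonneg_derivative_le chi dchi 0 t Ht).
    - intros s Hs. unfold chi, dchi.
      apply (is_derive_plus (V := R_NormedModule)).
      + apply (is_derive_plus (V := R_NormedModule)).
        * apply line_derive; auto; [|rewrite Hse; lra].
          intros w Hw. apply summable_pseries_to; auto.
        * apply line_derive; auto; [|rewrite Hse; lra].
          intros w Hw. apply summable_pseries_to; auto.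
      + auto_derive; [lra|]. field. lra.
    - intros s Hs. unfold dchi.
      set (w := (0 + s * e)%C).
      assert (Hw : Cmod w = s) by (apply Hse; lra).
      assert (K := harnack (car_coef ep) (car_fun ep)
       (expansion_summable _ _ (car_pseries_to ep)) (car_pseries_to ep)
       (fun z => car_fun_pos ep z Hep) eq_refl w ltac:(lra)).
      rewrite Hw, car_fun_re in K.
      replace (w * h2 w)%C with (s * (1 * (h2 w * e)))%C in K by (unfold w at 2; ring).
      replace (ep * (w * g2 w))%C with (s * (ep * (g2 w * e)))%C in K by (unfold w at 2; ring).
      rewrite !(re_scal_l s) in K.
      set (A := Re (1 * (h2 w * e))%C) in *. set (B := Re (ep * (g2 w * e))%C) in *.
      apply Rmult_le_reg_r with (s / M); [apply Rdiv_lt_0_compat; lra|].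
      replace (0 * (s / M)) with ((1 - s) / (1 + s) - (1 - s) / (1 + s)) by ring.
      replace ((A + B + 2 * M * / (1 + s)) * (s / M))
        with (1 + (s * A + s * B) / M - (1 - s) / (1 + s)) by (field; lra). lra. }
  unfold chi in Hmono.
  replace (0 + RtoC 0 * e)%C with (RtoC 0) in Hmono by ring.
  replace (0 + t * e)%C with z in Hmono by (rewrite Ez; ring).
  unfold h1 at 1, g1 at 1 in Hmono. rewrite !pseries_sum_at_0 in Hmono by auto.
  unfold deriv_coef in Hmono. rewrite class_a1, class_b1 in Hmono.
  rewrite (Cmult_comm ep (g1 z)), Eep in Hmono.
  change (INR 1) with 1 in Hmono.
  rewrite Rplus_0_r, ln_1, !Cmult_0_r, !Cmult_1_l, !re_RtoC in Hmono.
  fold t. lra.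
Qed.

(** The primitive of 1 - 2M ln (1 + r), equal to -F(-r) for the extremal function F. *)
Definition growth (r : R) : R := r - 2 * M * ((1 + r) * ln (1 + r) - r).

Lemma growth_derive r : 0 <= r -> is_derive growth r (1 - 2 * M * ln (1 + r)).
Proof. intros Hr. unfold growth. auto_derive; [lra|]. field. lra. Qed.

(** The radial component of f has derivative at least Re h' - |g'|, the conjugation in g
    only changing a phase. *)
Lemma class_growth z : Cmod z < 1 -> growth (Cmod z) <= Cmod (f z).
Proof.
  intros Hz. assert (Ht := Cmod_ge_0 z).
  destruct (polar z) as [e [He Ez]]. set (t := Cmod z) in *.
  (* psi is Re (conj e f(s e)) - growth s, where the conjugate in f is moved onto e. *)
  set (psi := fun s : R => Re (Cconj e * h (0 + s * e))%C + Re (e * g (0 + s * e))%C - growth s).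
  set (dpsi := fun s : R => Re (Cconj e * (h1 (0 + s * e) * e))%C
     + Re (e * (g1 (0 + s * e) * e))%C - (1 - 2 * M * ln (1 + s))).
  assert (Hse : forall s, 0 <= s -> Cmod (0 + s * e)%C = s).
  { intros s Hs. rewrite Cplus_0_l, Cmod_mult, Cmod_R, He, Rabs_pos_eq; lra. }
  assert (Hee : (e * Cconj e)%C = RtoC 1).
  { rewrite <- Cmod2_conj, He. simpl. f_equal. ring. }
  assert (Hmono : psi 0 <= psi t).
  { apply (nonneg_derivative_le psi dpsi 0 t Ht).
    - intros s Hs. unfold psi, dpsi.
      apply (is_derive_minus (V := R_NormedModule)); [|apply growth_derive; lra].
      apply (is_derive_plus (V := R_NormedModule)); apply line_derive; auto; rewrite Hse; lra.
    - intros s Hs. unfold dpsi. set (w := (0 + s * e)%C).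
      assert (Hw : Cmod w = s) by (apply Hse; lra).
      assert (K := class_first_derivative w ltac:(lra)). rewrite Hw in K.
      replace (Cconj e * (h1 w * e))%C with (h1 w * (e * Cconj e))%C by ring.
      rewrite Hee, Cmult_1_r.
      assert (T := re_le_Cmod (e * (g1 w * e))%C).
      rewrite !Cmod_mult, He, Rmult_1_l, Rmult_1_r in T.
      generalize (Rabs_maj2 (Re (e * (g1 w * e))%C)). lra. }
  unfold psi in Hmono.
  replace (0 + RtoC 0 * e)%C with (RtoC 0) in Hmono by ring.
  replace (0 + t * e)%C with z in Hmono by (rewrite Ez; ring).
  rewrite class_h_0, class_g_0, !Cmult_0_r, re_RtoC in Hmono.
  unfold growth at 1 in Hmono. rewrite !Rplus_0_r, ln_1 in Hmono.
  assert (E : f z = (h z + Cconj (g z))%C) by (apply Hf, Hz).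
  assert (E2 : Re (Cconj e * h z)%C + Re (e * g z)%C = Re (Cconj e * f z)%C).
  { rewrite E, Cmult_plus_distr_l, re_plus. f_equal.
    rewrite <- re_conj, Cmult_conj. reflexivity. }
  assert (T := re_le_Cmod (Cconj e * f z)%C).
  rewrite Cmod_mult, Cmod_conj, He, Rmult_1_l in T.
  generalize (Rle_abs (Re (Cconj e * f z)%C)). lra.
Qed.
End ClassBounds.

(** * Covering of a disk by the image *)

Lemma Cmod_le_abs (x y : R) : Cmod (x, y) <= Rabs x + Rabs y.
Proof.
  replace ((x, y) : C) with (RtoC x + Ci * RtoC y)%C
    by (apply injective_projections; simpl; ring).
  eapply Rle_trans; [apply Cmod_triangle|]. rewrite Cmod_mult, Cmod_Ci, !Cmod_R. lra.
Qed.

(** If the infimum were not attained, every point would have a neighbourhood on which phi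
    exceeds it by a fixed amount, and compactness would make that amount uniform. *)
Lemma disk_minimum (phi : C -> R) rho :
  0 <= rho ->
  (forall z, Cmod z <= rho -> 0 <= phi z) ->
  (forall z eps, Cmod z <= rho -> 0 < eps -> exists delta, 0 < delta /\
     forall w, Cmod w <= rho -> Cmod (w - z)%C < delta -> Rabs (phi w - phi z) < eps) ->
  exists z0, Cmod z0 <= rho /\ forall w, Cmod w <= rho -> phi z0 <= phi w.
Proof.
  intros Hrho Hpos Hcont.
  destruct (completeness (fun y => exists z, Cmod z <= rho /\ y = - phi z)) as [m [Hub Hlub]].
  { exists 0. intros y [z [Hz ->]]. specialize (Hpos z Hz). lra. }
  { exists (- phi (RtoC 0)), (RtoC 0). rewrite Cmod_0. auto. }
  apply NNPP. intros Hno.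
  assert (Hgt : forall z, Cmod z <= rho -> - m < phi z).
  { intros z Hz. destruct (Rle_lt_dec (phi z) (- m)) as [h|h]; [exfalso|exact h].
    apply Hno. exists z. split; [exact Hz|]. intros w Hw.
    assert (- phi w <= m) by (apply Hub; exists w; auto). lra. }
  assert (Hd : forall u v, exists d : posreal, forall x y, Rabs (x - u) < d -> Rabs (y - v) < d ->
      Cmod (x, y) <= rho -> - m + d <= phi (x, y)).
  { intros u v. destruct (Rle_lt_dec (Cmod (u, v)) rho) as [h|h].
    (* Inside the disk, half of the gap phi - (-m) survives on a neighbourhood; outside, a
       small neighbourhood misses the disk. *)
    - assert (Hg := Hgt _ h). set (eps := (phi (u, v) - - m) / 2).
      assert (He : 0 < eps) by (unfold eps; lra).
      destruct (Hcont _ eps h He) as [dl [Hdl Hc]].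
      assert (Hmin : 0 < Rmin (dl / 2) eps) by (apply Rmin_glb_lt; lra).
      exists (mkposreal _ Hmin). simpl. intros x y Hx Hy Hxy.
      assert (B1 := Rmin_l (dl / 2) eps). assert (B2 := Rmin_r (dl / 2) eps).
      specialize (Hc (x, y) Hxy).
      assert (Hclose : Cmod ((x, y) - (u, v))%C < dl).
      { change ((x, y) - (u, v))%C with ((x - u, y - v) : C).
        eapply Rle_lt_trans; [apply Cmod_le_abs|]. lra. }
      specialize (Hc Hclose). apply Rabs_def2 in Hc. unfold eps in *. lra.
    - assert (Hh : 0 < (Cmod (u, v) - rho) / 2) by lra.
      exists (mkposreal _ Hh). simpl. intros x y Hx Hy Hxy. exfalso.
      assert (T := Cmod_triangle (x, y) ((u - x)%R, (v - y)%R)).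
      replace ((x, y) + ((u - x)%R, (v - y)%R))%C with ((u, v) : C) in T
        by (apply injective_projections; simpl; ring).
      assert (T2 := Cmod_le_abs (u - x) (v - y)).
      rewrite (Rabs_minus_sym u x), (Rabs_minus_sym v y) in T2. lra. }
  set (dl := fun u v => proj1_sig (constructive_indefinite_description _ (Hd u v))).
  assert (Hdl : forall u v x y, Rabs (x - u) < dl u v -> Rabs (y - v) < dl u v ->
      Cmod (x, y) <= rho -> - m + dl u v <= phi (x, y)).
  { intros u v. unfold dl. destruct (constructive_indefinite_description _ (Hd u v)). auto. }
  destruct (compactness_value_2d (- rho) rho (- rho) rho dl) as [d Hcomp].
  assert (Hall : forall z, Cmod z <= rho -> - m + d <= phi z).
  { intros [x y] Hz. assert (T := Rmax_Cmod (x, y)). simpl in T.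
    assert (T1 := Rmax_l (Rabs x) (Rabs y)). assert (T2 := Rmax_r (Rabs x) (Rabs y)).
    assert (Hx : - rho <= x <= rho) by (apply Rabs_le_between; lra).
    assert (Hy : - rho <= y <= rho) by (apply Rabs_le_between; lra).
    destruct (NNPP _ (Hcomp x y Hx Hy)) as [u [v [_ [_ [H1 [H2 H3]]]]]].
    specialize (Hdl u v x y H1 H2 Hz). lra. }
  assert (m <= m - d); [|destruct d; simpl in *; lra].
  apply Hlub. intros y [z [Hz ->]]. specialize (Hall z Hz). lra.
Qed.

Lemma pseries_to_lipschitz_at a (h : C -> C) rho :
  summable a -> (forall z, Cmod z < 1 -> pseries_to a z (h z)) -> 0 <= rho < 1 ->
  forall z, Cmod z <= rho -> exists L, 0 <= L /\
    forall w, Cmod w <= rho -> Cmod (h w - h z)%C <= L * Cmod (w - z)%C.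
Proof.
  intros Ha Hh Hrho z Hz.
  destruct (pseries_to_remainder a h rho Ha Hh Hrho) as [K HK].
  exists (Cmod (pseries_sum (deriv_coef a) z) + Rabs K * 2).
  assert (H1 := Cmod_ge_0 (pseries_sum (deriv_coef a) z)). assert (H2 := Rabs_pos K).
  split; [lra|]. intros w Hw.
  specialize (HK z (w - z)%C Hz). replace (z + (w - z))%C with w in HK by ring.
  specialize (HK Hw).
  assert (T := Cmod_triangle (h w - h z - (w - z) * pseries_sum (deriv_coef a) z)%C ((w - z) *
      pseries_sum (deriv_coef a) z)%C).
  replace (h w - h z - (w - z) * pseries_sum (deriv_coef a) z + (w - z) * pseries_sum (deriv_coef
      a) z)%C
    with (h w - h z)%C in T by ring.
  rewrite Cmod_mult in T.
  assert (D : Cmod (w - z)%C <= 2).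
  { unfold Cminus. eapply Rle_trans; [apply Cmod_triangle|]. rewrite Cmod_opp. lra. }
  assert (D0 := Cmod_ge_0 (w - z)%C). assert (T3 := Rle_abs K).
  set (d := Cmod (w - z)%C) in *.
  assert (K * d ^ 2 <= Rabs K * 2 * d).
  { replace (K * d ^ 2) with (K * d * d) by ring. apply Rmult_le_compat_r; [exact D0|].
    apply Rle_trans with (Rabs K * d); [apply Rmult_le_compat_r; lra|apply Rmult_le_compat_l; lra].
        }
  lra.
Qed.

Section Covering.
Variables (a b : nat -> C) (f h g : C -> C) (rho : R).
Hypothesis Ha : summable a.
Hypothesis Hb : summable b.
Hypothesis Hh : forall z, Cmod z < 1 -> pseries_to a z (h z).
Hypothesis Hg : forall z, Cmod z < 1 -> pseries_to b z (g z).
Hypothesis Hf : forall z, Cmod z < 1 -> f z = (h z + Cconj (g z))%C.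
Hypothesis Hrho : 0 < rho < 1.
Hypothesis Hpos : forall z, Cmod z <= rho -> Cmod (pseries_sum (deriv_coef b) z) < Re (pseries_sum
    (deriv_coef a) z).

Lemma harmonic_distance_minimum (v : C) :
  exists z0, Cmod z0 <= rho /\ forall w, Cmod w <= rho -> Cmod (f z0 - v)%C <= Cmod (f w - v)%C.
Proof.
  apply (disk_minimum (fun z => Cmod (f z - v)%C)); [lra|intros; apply Cmod_ge_0|].
  intros z eps Hz Heps.
  destruct (pseries_to_lipschitz_at a h rho Ha Hh ltac:(lra) z Hz) as [L1 [HL1 B1]].
  destruct (pseries_to_lipschitz_at b g rho Hb Hg ltac:(lra) z Hz) as [L2 [HL2 B2]].
  exists (eps / (L1 + L2 + 1)). split; [apply Rdiv_lt_0_compat; lra|].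
  intros w Hw Hwz.
  assert (Hlip : Cmod (f w - f z)%C <= (L1 + L2) * Cmod (w - z)%C).
  { rewrite !Hf by lra.
    replace (h w + Cconj (g w) - (h z + Cconj (g z)))%C
      with ((h w - h z) + Cconj (g w - g z))%C by (rewrite Cminus_conj; ring).
    eapply Rle_trans; [apply Cmod_triangle|]. rewrite Cmod_conj.
    specialize (B1 w Hw). specialize (B2 w Hw). lra. }
  assert (Hd : Cmod (f w - f z)%C < eps).
  { eapply Rle_lt_trans; [exact Hlip|].
    assert (D0 := Cmod_ge_0 (w - z)%C).
    assert ((L1 + L2 + 1) * Cmod (w - z)%C < (L1 + L2 + 1) * (eps / (L1 + L2 + 1)))
      by (apply Rmult_lt_compat_l; lra).
    replace ((L1 + L2 + 1) * (eps / (L1 + L2 + 1))) with eps in H by (field; lra). lra. }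
  assert (T1 := Cmod_triangle (f w - f z)%C (f z - v)%C).
  assert (T2 := Cmod_triangle (- (f w - f z))%C (f w - v)%C). rewrite Cmod_opp in T2.
  replace (f w - f z + (f z - v))%C with (f w - v)%C in T1 by ring.
  replace (- (f w - f z) + (f w - v))%C with (f z - v)%C in T2 by ring.
  apply Rabs_def1; lra.
Qed.

(** At an interior minimum of |f - v| the derivative of |f - v|^2 along v - f vanishes, but
    it is at most -2 |f - v|^2 (Re h' - |g'|). This replaces the open mapping property. *)
Lemma interior_minimum_hits (v z0 : C) :
  Cmod z0 < rho ->
  (forall w, Cmod w <= rho -> Cmod (f z0 - v)%C <= Cmod (f w - v)%C) -> f z0 = v.
Proof.
  intros Hz0 Hmin. apply NNPP. intros Hne.
  set (tau := (f z0 - v)%C). set (e := (- tau)%C).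
  assert (Htau : 0 < Cmod tau).
  { apply Cmod_gt_0. intros E. apply Hne. replace (f z0) with (tau + v)%C by (unfold tau; ring).
    rewrite E. ring. }
  assert (He : Cmod e = Cmod tau) by apply Cmod_opp.
  set (F1 := fun s : R => Re (1 * h (z0 + s * e))%C + Re (1 * g (z0 + s * e))%C).
  set (F2 := fun s : R => Re (- Ci * h (z0 + s * e))%C + Re (Ci * g (z0 + s * e))%C).
  set (D := fun s : R => (F1 s - Re v) ^ 2 + (F2 s - Im v) ^ 2).
  assert (Hin : forall s, Rabs s < (rho - Cmod z0) / Cmod tau -> Cmod (z0 + s * e)%C < rho).
  { intros s Hs. eapply Rle_lt_trans; [apply Cmod_triangle|].
    rewrite Cmod_mult, Cmod_R, He.
    apply Rmult_lt_compat_r with (r := Cmod tau) in Hs; [|exact Htau].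
    replace ((rho - Cmod z0) / Cmod tau * Cmod tau) with (rho - Cmod z0) in Hs by (field; lra).
    lra. }
  assert (HD : forall s : R, Cmod (z0 + s * e)%C < 1 -> D s = Cmod (f (z0 + s * e) - v)%C ^ 2).
  { intros s Hs. rewrite Cmod2_alt, Hf by exact Hs. unfold D, F1, F2.
    f_equal; f_equal; unfold Re, Im, Ci, Cmult, Cconj, Cminus, Cplus, Copp; simpl; ring. }
  assert (E0 : (z0 + RtoC 0 * e)%C = z0) by ring.
  set (A := pseries_sum (deriv_coef a) z0). set (B := pseries_sum (deriv_coef b) z0).
  assert (H1 : is_derive F1 0 (Re (1 * (A * e))%C + Re (1 * (B * e))%C)).
  { unfold A, B. rewrite <- E0. unfold F1.
    apply (is_derive_plus (V := R_NormedModule)); apply line_derive; auto; rewrite E0; lra. }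
  assert (H2 : is_derive F2 0 (Re (- Ci * (A * e))%C + Re (Ci * (B * e))%C)).
  { unfold A, B. rewrite <- E0. unfold F2.
    apply (is_derive_plus (V := R_NormedModule)); apply line_derive; auto; rewrite E0; lra. }
  set (d1 := Re (1 * (A * e))%C + Re (1 * (B * e))%C) in *.
  set (d2 := Re (- Ci * (A * e))%C + Re (Ci * (B * e))%C) in *.
  assert (EF1 : F1 0 - Re v = Re tau).
  { unfold F1, tau. rewrite E0, re_minus, Hf by lra. rewrite re_plus, re_conj, !Cmult_1_l.
      reflexivity. }
  assert (EF2 : F2 0 - Im v = Im tau).
  { unfold F2, tau. rewrite E0, Hf by lra.
    unfold Re, Im, Ci, Cmult, Cconj, Cminus, Cplus, Copp; simpl; ring. }
  assert (HDd : is_derive D 0 (2 * (Re tau * d1 + Im tau * d2))).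
  { unfold D. assert (X1 : ex_derive F1 0) by (exists d1; exact H1).
    assert (X2 : ex_derive F2 0) by (exists d2; exact H2).
    clearbody F1 F2. auto_derive; [auto|].
    change (Derive (fun x : R => F1 x) 0) with (Derive F1 0).
    change (Derive (fun x : R => F2 x) 0) with (Derive F2 0).
    rewrite (is_derive_unique _ _ _ H1), (is_derive_unique _ _ _ H2).
    rewrite <- EF1, <- EF2. ring. }
  apply is_derive_Reals in HDd.
  set (dl := (rho - Cmod z0) / Cmod tau).
  assert (Hdl : 0 < dl) by (apply Rdiv_lt_0_compat; lra).
  assert (Hzero : 2 * (Re tau * d1 + Im tau * d2) = 0).
  { set (pr := exist _ (2 * (Re tau * d1 + Im tau * d2)) HDd : derivable_pt D 0).
    change (derive_pt D 0 pr = 0). apply (deriv_minimum D (- dl) dl 0); try lra.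
    intros s Hs1 Hs2.
    assert (Hs : Cmod (z0 + s * e)%C < rho) by (apply Hin; apply Rabs_def1; assumption).
    rewrite !HD by (try rewrite E0; lra). rewrite E0.
    apply pow_incr. split; [apply Cmod_ge_0|]. apply Hmin. lra. }
  assert (Hval : Re tau * d1 + Im tau * d2 = - (Cmod tau ^ 2 * Re A + Re (tau * tau * B)%C)).
  { rewrite Cmod2_alt. unfold d1, d2, e.
    unfold Re, Im, Ci, Cmult, Cconj, Cminus, Cplus, Copp; simpl; ring. }
  assert (T := re_le_Cmod (tau * tau * B)%C). rewrite !Cmod_mult in T.
  assert (T2 := Rabs_maj2 (Re (tau * tau * B)%C)).
  assert (P := Hpos z0 ltac:(lra)). fold A B in P.
  assert (0 < Cmod tau * Cmod tau * (Re A - Cmod B)).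
  { apply Rmult_lt_0_compat; [apply Rmult_lt_0_compat; auto|lra]. }
  nra.
Qed.

(** A continuity argument in finitely many steps along the segment from 0 to w. *)
Lemma harmonic_covering (m0 : R) (w : C) :
  f 0 = RtoC 0 -> (forall z, Cmod z = rho -> m0 <= Cmod (f z)) -> Cmod w < m0 ->
  exists z, Cmod z <= rho /\ f z = w.
Proof.
  intros Hf0 Hm Hw. assert (Hw0 := Cmod_ge_0 w).
  (* The number of steps makes one step |w| / n1 shorter than the margin m0 - |w|; hence a
     minimiser for the next target cannot sit on the circle |z| = rho. *)
  destruct (nfloor_ex (Cmod w / (m0 - Cmod w))) as [n [_ Hn]].
  { apply Rmult_le_pos; [lra|apply Rlt_le, Rinv_0_lt_compat; lra]. }
  set (n1 := INR n + 1) in *. assert (Hn1 : 1 <= n1) by (unfold n1; generalize (pos_INR n); lra).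
  assert (Hstep : Cmod w / n1 < m0 - Cmod w).
  { apply Rmult_lt_reg_r with n1; [lra|]. unfold Rdiv. rewrite Rmult_assoc, Rinv_l, Rmult_1_r by
      lra.
    apply Rmult_lt_compat_r with (r := m0 - Cmod w) in Hn; [|lra].
    replace (Cmod w / (m0 - Cmod w) * (m0 - Cmod w)) with (Cmod w) in Hn by (field; lra). lra. }
  assert (Hk : forall k, INR k <= n1 -> exists z, Cmod z <= rho /\ f z = (RtoC (INR k / n1) * w)%C).
  { induction k as [|k IH]; intros Hk.
    - exists (RtoC 0). rewrite Cmod_0, Hf0. split; [lra|].
      simpl INR. unfold Rdiv. rewrite Rmult_0_l. ring.
    - rewrite S_INR in Hk. destruct (IH ltac:(lra)) as [z [Hz Ez]].
      set (v := (RtoC (INR (S k) / n1) * w)%C).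
      assert (Hv : Cmod v <= Cmod w).
      { unfold v. rewrite Cmod_mult, Cmod_R, S_INR, Rabs_pos_eq.
        - rewrite <- (Rmult_1_l (Cmod w)) at 2. apply Rmult_le_compat_r; [exact Hw0|].
          apply Rmult_le_reg_r with n1; [lra|]. unfold Rdiv. rewrite Rmult_assoc, Rinv_l; lra.
        - apply Rmult_le_pos; [generalize (pos_INR k); lra|apply Rlt_le, Rinv_0_lt_compat; lra]. }
      destruct (harmonic_distance_minimum v) as [z0 [Hz0 Hmin]].
      exists z0. split; [exact Hz0|].
      destruct (Rle_lt_or_eq_dec _ _ Hz0) as [Hlt|Heq].
      + apply interior_minimum_hits; assumption.
      + exfalso. specialize (Hmin z Hz). specialize (Hm z0 Heq).
        assert (Hd : Cmod (f z - v)%C = Cmod w / n1).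
        { rewrite Ez. unfold v. rewrite S_INR.
          replace (RtoC (INR k / n1) * w - RtoC ((INR k + 1) / n1) * w)%C
            with (RtoC (- / n1) * w)%C.
          - rewrite Cmod_mult, Cmod_R, Rabs_Ropp, Rabs_pos_eq
              by (apply Rlt_le, Rinv_0_lt_compat; lra).
            unfold Rdiv; ring.
          - replace (RtoC ((INR k + 1) / n1)) with (RtoC (INR k / n1) + RtoC (/ n1))%C
              by (rewrite <- RtoC_plus; f_equal; field; lra).
            rewrite RtoC_opp. ring. }
        assert (T := Cmod_triangle (f z0 - v)%C v).
        replace (f z0 - v + v)%C with (f z0) in T by ring. lra. }
  destruct (Hk (S n)) as [z [Hz Ez]]; [rewrite S_INR; fold n1; lra|].
  exists z. split; [exact Hz|]. rewrite Ez, S_INR. fold n1.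
  replace (n1 / n1) with 1 by (field; lra). ring.
Qed.
End Covering.

Definition dist_bound (M : R) : R := 1 + 2 * M * (1 - 2 * ln 2).

Lemma growth_1 M : growth M 1 = dist_bound M.
Proof. unfold growth, dist_bound. replace (1 + 1) with 2 by ring. ring. Qed.

(** For large M the derivative 1 - 2M ln (1 + r) changes sign before r = 1, and growth M
    then exceeds its final value L at the turning point. So every level below L is already
    reached where the derivative is positive. *)
Lemma growth_near_1 M y : 0 < M -> y < dist_bound M ->
  exists rho, 0 < rho < 1 /\ y < growth M rho /\ 2 * M * ln (1 + rho) < 1.
Proof.
  intros HM Hy.
  assert (Hln : 0 < / (2 * M)) by (apply Rinv_0_lt_compat; lra).
  assert (Hexp : 1 < exp (/ (2 * M))) by (rewrite <- exp_0 at 1; apply exp_increasing, Hln).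
  (* growth M increases on [0, c] and, when c < 1, decreases on [c, 1]. *)
  set (c := Rmin 1 (exp (/ (2 * M)) - 1)).
  assert (Hc : 0 < c <= 1) by (unfold c; split; [apply Rmin_glb_lt; lra|apply Rmin_l]).
  assert (Hgc : dist_bound M <= growth M c).
  { rewrite <- growth_1. unfold c, Rmin.
    destruct (Rle_dec 1 (exp (/ (2 * M)) - 1)) as [h|h]; [apply Rle_refl|].
    apply Ropp_le_cancel.
    apply (nonneg_derivative_le (fun r => - growth M r) (fun r => - (1 - 2 * M * ln (1 + r)))).
    - lra.
    - intros x Hx. apply (is_derive_opp (V := R_NormedModule)), growth_derive. lra.
    - intros x Hx. assert (/ (2 * M) < ln (1 + x)).
      { rewrite <- (ln_exp (/ (2 * M))). apply ln_increasing; [apply exp_pos|lra]. }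
      assert (2 * M * / (2 * M) < 2 * M * ln (1 + x)) by (apply Rmult_lt_compat_l; lra).
      rewrite Rinv_r in * by lra. lra. }
  assert (Hcont : continuity_pt (growth M) c).
  { apply continuity_pt_filterlim.
    apply (ex_derive_continuous (V := R_NormedModule)). eexists. apply growth_derive. lra. }
  destruct (Hcont ((dist_bound M - y) / 2)) as [al [Hal Hcl]]; [lra|].
  set (rho := c - Rmin (c / 2) (al / 2)).
  assert (R1 := Rmin_l (c / 2) (al / 2)). assert (R2 := Rmin_r (c / 2) (al / 2)).
  assert (R3 : 0 < Rmin (c / 2) (al / 2)) by (apply Rmin_glb_lt; lra).
  exists rho. split; [unfold rho; lra|]. split.
  - specialize (Hcl rho). simpl in Hcl. unfold R_dist, D_x, no_cond in Hcl.
    assert (Rabs (growth M rho - growth M c) < (dist_bound M - y) / 2).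
    { apply Hcl. split; [split; [trivial|unfold rho; lra]|].
      unfold rho. rewrite Rabs_left; lra. }
    apply Rabs_def2 in H. lra.
  - assert (ln (1 + rho) < / (2 * M)).
    { rewrite <- (ln_exp (/ (2 * M))). apply ln_increasing; [unfold rho; lra|].
      assert (c <= exp (/ (2 * M)) - 1) by apply Rmin_r. unfold rho; lra. }
    assert (2 * M * ln (1 + rho) < 2 * M * / (2 * M)) by (apply Rmult_lt_compat_l; lra).
    rewrite Rinv_r in * by lra. lra.
Qed.

Lemma class_covers M f h g a b (w : C) :
  0 < M -> in_P0H M f h g -> power_expansion h a -> power_expansion g b ->
  Cmod w < dist_bound M -> disk_image f w.
Proof.
  intros HM Hf Ha Hb Hw.
  destruct (growth_near_1 M (Cmod w) HM Hw) as [rho [Hrho [Hg1 Hg2]]].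
  assert (Hfz : forall z, Cmod z < 1 -> f z = (h z + Cconj (g z))%C) by apply Hf.
  destruct (harmonic_covering a b f h g rho (class_summable_a h a Ha) (class_summable_b g b Hb)
     (class_pseries_to_h h a Ha) (class_pseries_to_g g b Hb) Hfz Hrho) with (m0 := growth M rho) (w
         := w)
     as [z [Hz Ez]]; auto.
  - intros z Hz. assert (K := class_first_derivative M f h g a b HM Hf Ha Hb z ltac:(lra)).
    assert (Hz0 := Cmod_ge_0 z).
    assert (ln (1 + Cmod z) <= ln (1 + rho)) by (apply ln_le; lra).
    assert (2 * M * ln (1 + Cmod z) <= 2 * M * ln (1 + rho)) by (apply Rmult_le_compat_l; lra).
    lra.
  - rewrite Hfz by (rewrite Cmod_0; lra).
    rewrite (class_h_0 M f h g Hf), (class_g_0 M f h g Hf).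
    apply injective_projections; simpl; ring.
  - intros z Hz. rewrite <- Hz. apply class_growth with h g a b; auto. lra.
  - exists z. split; [unfold unit_disk; lra|auto].
Qed.

(** A point of modulus less than L has a neighbourhood inside the image. *)
Lemma class_boundary_far M f h g a b (u : C) :
  0 < M -> in_P0H M f h g -> power_expansion h a -> power_expansion g b ->
  boundary (disk_image f) u -> dist_bound M <= Cmod u.
Proof.
  intros HM Hf Ha Hb Hu.
  destruct (Rle_lt_dec (dist_bound M) (Cmod u)) as [h0|h0]; [exact h0|exfalso].
  destruct (Hu (dist_bound M - Cmod u) ltac:(lra)) as [_ [v [Hv Hvu]]].
  apply Hv, (class_covers M f h g a b); auto.
  replace v with ((v - u) + u)%C by ring.
  eapply Rle_lt_trans; [apply Cmod_triangle|]. lra.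
Qed.

(** * Integration over disks *)

Lemma RInt_uniform_limit (f : nat -> R -> R) (g : R -> R) a b (v e : nat -> R) :
  a <= b -> (forall n, is_RInt (f n) a b (v n)) ->
  (forall n x, a <= x <= b -> Rabs (f n x - g x) <= e n) -> is_lim_seq e 0 ->
  exists V : R, is_lim_seq v V /\ is_RInt g a b V /\ forall n, Rabs (v n - V) <= (b - a) * e n.
Proof.
  intros Hab Hf He Hlim.
  (* Uniform convergence is only assumed on [a, b]: extend the functions by constants outside. *)
  set (cl := fun x => Rmax a (Rmin b x)).
  assert (Hcl : forall x, a <= cl x <= b).
  { intros x. unfold cl. split; [apply Rmax_l|]. apply Rmax_lub; [exact Hab|apply Rmin_l]. }
  assert (Hcl2 : forall x, a <= x <= b -> cl x = x).
  { intros x Hx. unfold cl. rewrite Rmin_right, Rmax_right; lra. }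
  assert (Hmm : forall x, Rmin a b < x < Rmax a b -> a <= x <= b).
  { intros x. rewrite Rmin_left, Rmax_right by exact Hab. lra. }
  destruct (filterlim_RInt (V := R_CompleteNormedModule) (fun n x => f n (cl x)) a b
    eventually _ (fun x => g (cl x)) v) as [V [HV1 HV2]].
  - intros n. apply is_RInt_ext with (2 := Hf n). intros x Hx. now rewrite Hcl2 by auto.
  - apply (filterlim_locally (U := fct_UniformSpace R R_CompleteNormedModule)). intros eps.
    apply is_lim_seq_spec in Hlim. destruct (Hlim eps) as [n0 Hn0].
    exists n0. intros n Hn x. specialize (Hn0 n Hn). rewrite Rminus_0_r in Hn0.
    change (Rabs (f n (cl x) - g (cl x)) < eps).
    eapply Rle_lt_trans; [apply He, Hcl|]. eapply Rle_lt_trans; [apply Rle_abs|exact Hn0].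
  - assert (HV3 : is_RInt g a b V).
    { apply is_RInt_ext with (2 := HV2). intros x Hx. now rewrite Hcl2 by auto. }
    exists V. split; [exact HV1|]. split; [exact HV3|]. intros n.
    apply (norm_RInt_le_const (V := R_NormedModule) (fun x => f n x - g x) a b (v n - V) (e n) Hab).
    + intros x Hx. apply He, Hx.
    + exact (is_RInt_minus (V := R_NormedModule) _ _ _ _ _ _ (Hf n) HV3).
Qed.

Definition half_chord (r x : R) : R := sqrt (r ^ 2 - x ^ 2).

(** The iterated integral together with the existence of both integrals, so that it is
    linear and stable under uniform limits. *)
Definition is_disk_int (F : C -> R) (r v : R) : Prop :=
  exists J : R -> R,
    (forall x, - r <= x <= r ->
       is_RInt (fun y => F (x, y)) (- half_chord r x) (half_chord r x) (J x))
    /\ is_RInt J (- r) r v.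

Lemma half_chord_ge0 r x : 0 <= half_chord r x.
Proof. apply sqrt_pos. Qed.

Lemma half_chord_le r x : 0 <= r -> half_chord r x <= r.
Proof.
  intros Hr. unfold half_chord. rewrite <- (sqrt_pow2 r Hr) at 2. apply sqrt_le_1_alt. nra.
Qed.

Lemma half_chord_sqr r x : - r <= x <= r -> half_chord r x ^ 2 = r ^ 2 - x ^ 2.
Proof. intros Hx. unfold half_chord. rewrite pow2_sqrt; nra. Qed.

Lemma in_disk_of_chord r x y : 0 <= r -> - r <= x <= r ->
  - half_chord r x <= y <= half_chord r x -> Cmod (x, y) <= r.
Proof.
  intros Hr Hx Hy. assert (H := half_chord_sqr r x Hx). assert (H0 := half_chord_ge0 r x).
  unfold Cmod; simpl fst; simpl snd. rewrite <- (sqrt_pow2 r Hr). apply sqrt_le_1_alt. nra.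
Qed.

Lemma disk_int_ext F G r v : 0 <= r ->
  (forall z, Cmod z <= r -> F z = G z) -> is_disk_int F r v -> is_disk_int G r v.
Proof.
  intros Hr HFG [J [H1 H2]]. exists J. split; [|exact H2].
  intros x Hx. apply is_RInt_ext with (2 := H1 x Hx). intros y Hy.
  assert (H0 := half_chord_ge0 r x). rewrite Rmin_left, Rmax_right in Hy by lra.
  apply HFG, in_disk_of_chord; auto; lra.
Qed.

Lemma disk_int_plus F G r v w :
  is_disk_int F r v -> is_disk_int G r w -> is_disk_int (fun z => F z + G z) r (v + w).
Proof.
  intros [J [H1 H2]] [K [H3 H4]]. exists (fun x => J x + K x). split.
  - intros x Hx. exact (is_RInt_plus (V := R_NormedModule) _ _ _ _ _ _ (H1 x Hx) (H3 x Hx)).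
  - exact (is_RInt_plus (V := R_NormedModule) _ _ _ _ _ _ H2 H4).
Qed.

Lemma disk_int_scal F r v k : is_disk_int F r v -> is_disk_int (fun z => k * F z) r (k * v).
Proof.
  intros [J [H1 H2]]. exists (fun x => k * J x). split.
  - intros x Hx. exact (is_RInt_scal (V := R_NormedModule) _ _ _ k _ (H1 x Hx)).
  - exact (is_RInt_scal (V := R_NormedModule) _ _ _ k _ H2).
Qed.

Lemma disk_int_zero r : is_disk_int (fun _ => 0) r 0.
Proof.
  assert (H : forall a b, is_RInt (fun _ => 0) a b 0).
  { intros a b. assert (K := is_RInt_const (V := R_NormedModule) a b 0).
    change (scal (b - a) 0) with ((b - a) * 0) in K. rewrite Rmult_0_r in K. exact K. }
  exists (fun _ => 0). split; auto.
Qed.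

Lemma disk_int_correct F r v : 0 <= r -> is_disk_int F r v -> disk_integral F r = v.
Proof.
  intros Hr [J [H1 H2]]. unfold disk_integral. apply is_RInt_unique.
  apply is_RInt_ext with (2 := H2). intros x Hx.
  rewrite Rmin_left, Rmax_right in Hx by lra. symmetry. apply is_RInt_unique, H1. lra.
Qed.

(** Uniform convergence on the disk is uniform on each chord, and then uniform for the
    integrals over the chords, which have length at most 2r. *)
Lemma disk_int_limit (F : nat -> C -> R) (G : C -> R) r (v e : nat -> R) :
  0 <= r -> (forall n, is_disk_int (F n) r (v n)) ->
  (forall n z, Cmod z <= r -> Rabs (F n z - G z) <= e n) -> is_lim_seq e 0 ->
  exists V : R, is_lim_seq v V /\ is_disk_int G r V.
Proof.
  intros Hr HF He Hlim.
  set (Jn := fun n => proj1_sig (constructive_indefinite_description _ (HF n))).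
  assert (HJ1 : forall n x, - r <= x <= r ->
     is_RInt (fun y => F n (x, y)) (- half_chord r x) (half_chord r x) (Jn n x)).
  { intros n. unfold Jn. destruct (constructive_indefinite_description _ (HF n)) as [J [A B]].
      exact A. }
  assert (HJ2 : forall n, is_RInt (Jn n) (- r) r (v n)).
  { intros n. unfold Jn. destruct (constructive_indefinite_description _ (HF n)) as [J [A B]].
      exact B. }
  assert (Hin : forall x, - r <= x <= r -> exists V : R,
     is_RInt (fun y => G (x, y)) (- half_chord r x) (half_chord r x) V /\
     forall n, Rabs (Jn n x - V) <= 2 * r * e n).
  { intros x Hx. assert (H0 := half_chord_ge0 r x). assert (H1 := half_chord_le r x Hr).
    destruct (RInt_uniform_limit (fun n y => F n (x, y)) (fun y => G (x, y))
      (- half_chord r x) (half_chord r x) (fun n => Jn n x) e) as [V [_ [HV1 HV2]]]; auto.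
    - lra.
    - intros n y Hy. apply He, in_disk_of_chord; auto.
    - exists V. split; [exact HV1|]. intros n. eapply Rle_trans; [apply HV2|].
      assert (0 <= e n).
      { eapply Rle_trans; [apply Rabs_pos|]. apply (He n (RtoC 0)). rewrite Cmod_0. exact Hr. }
      apply Rmult_le_compat_r; [assumption|lra]. }
  set (J := fun x => match Rle_dec (- r) x, Rle_dec x r with
    | left h1, left h2 => proj1_sig (constructive_indefinite_description _ (Hin x (conj h1 h2)))
    | _, _ => 0 end).
  assert (HJ : forall x, - r <= x <= r ->
     is_RInt (fun y => G (x, y)) (- half_chord r x) (half_chord r x) (J x) /\
     forall n, Rabs (Jn n x - J x) <= 2 * r * e n).
  { intros x Hx. unfold J. destruct (Rle_dec (- r) x) as [h1|h1]; [|lra].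
    destruct (Rle_dec x r) as [h2|h2]; [|lra].
    destruct (constructive_indefinite_description _ (Hin x (conj h1 h2))). auto. }
  destruct (RInt_uniform_limit Jn J (- r) r v (fun n => 2 * r * e n)) as [V [HV1 [HV2 _]]]; auto.
  - lra.
  - intros n x Hx. apply HJ, Hx.
  - replace (Finite 0) with (Finite (2 * r * 0)) by (f_equal; ring).
    apply (is_lim_seq_scal_l _ (2 * r) 0), Hlim.
  - exists V. split; [exact HV1|]. exists J. split; [|exact HV2]. intros x Hx. apply HJ, Hx.
Qed.

Definition c_derive (u : R -> C) (y : R) (d : C) : Prop :=
  is_derive (fun t => Re (u t)) y (Re d) /\ is_derive (fun t => Im (u t)) y (Im d).

Lemma c_derive_mult u v y d e :
  c_derive u y d -> c_derive v y e -> c_derive (fun t => (u t * v t)%C) y (d * v y + u y * e)%C.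
Proof.
  intros [U1 U2] [V1 V2]. split.
  - apply is_derive_ext with (fun t => Re (u t) * Re (v t) - Im (u t) * Im (v t)).
    { intros t. now rewrite re_mult. }
    rewrite re_plus, !re_mult.
    replace (Re d * Re (v y) - Im d * Im (v y) + (Re (u y) * Re e - Im (u y) * Im e))
     with ((Re d * Re (v y) + Re (u y) * Re e) - (Im d * Im (v y) + Im (u y) * Im e)) by ring.
    apply (is_derive_minus (V := R_NormedModule));
      apply (is_derive_mult (K := R_AbsRing)); auto using Rmult_comm; exact Rmult_comm.
  - apply is_derive_ext with (fun t => Re (u t) * Im (v t) + Im (u t) * Re (v t)).
    { intros t. now rewrite im_mult. }
    rewrite im_plus, !im_mult.
    replace (Re d * Im (v y) + Im d * Re (v y) + (Re (u y) * Im e + Im (u y) * Re e))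
     with ((Re d * Im (v y) + Re (u y) * Im e) + (Im d * Re (v y) + Im (u y) * Re e)) by ring.
    apply (is_derive_plus (V := R_NormedModule));
      apply (is_derive_mult (K := R_AbsRing)); auto using Rmult_comm; exact Rmult_comm.
Qed.

Lemma c_derive_const (c : C) y : c_derive (fun _ => c) y 0.
Proof. split; apply (is_derive_const (V := R_NormedModule)). Qed.

Lemma c_derive_pow u y d n :
  c_derive u y d -> c_derive (fun t => (u t ^ n)%C) y (INR n * u y ^ pred n * d)%C.
Proof.
  intros Hu. induction n as [|n IH].
  - replace (INR 0 * u y ^ pred 0 * d)%C with (RtoC 0) by (simpl INR; ring).
    exact (c_derive_const (RtoC 1) y).
  - assert (H := c_derive_mult _ _ _ _ _ Hu IH).
    replace (INR (S n) * u y ^ pred (S n) * d)%C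
      with (d * u y ^ n + u y * (INR n * u y ^ pred n * d))%C.
    + exact H.
    + rewrite S_INR, RtoC_plus. simpl pred.
      destruct n as [|n]; [simpl INR; ring|]. simpl pred. rewrite (Cpow_S _ n). ring.
Qed.

Lemma c_derive_vertical x y : c_derive (fun t => (x, t) : C) y Ci.
Proof. split; simpl; [apply (is_derive_const (V := R_NormedModule))|apply (is_derive_id (K :=
    R_AbsRing))]. Qed.

Lemma c_derive_vertical_conj x y : c_derive (fun t => Cconj (x, t)) y (- Ci).
Proof.
  split; simpl; [rewrite Ropp_0; apply (is_derive_const (V := R_NormedModule))|].
  apply (is_derive_opp (V := R_NormedModule)), (is_derive_id (K := R_AbsRing)).
Qed.

Lemma c_derive_monomial x y m n :
  c_derive (fun t => ((x, t) ^ m * Cconj (x, t) ^ n)%C) y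
    (Ci * (INR m * (x, y) ^ pred m * Cconj (x, y) ^ n
           - INR n * (x, y) ^ m * Cconj (x, y) ^ pred n))%C.
Proof.
  assert (H := c_derive_mult _ _ _ _ _ (c_derive_pow _ _ _ m (c_derive_vertical x y))
     (c_derive_pow _ _ _ n (c_derive_vertical_conj x y))).
  match type of H with c_derive _ _ ?d => match goal with |- c_derive _ _ ?d' => replace d' with d
      end end.
  - exact H.
  - ring.
Qed.

Lemma c_derive_re_scal (c : C) u y d :
  c_derive u y d -> is_derive (fun t => Re (c * u t)%C) y (Re (c * d)%C).
Proof.
  intros Hu. assert (H := proj1 (c_derive_mult _ _ _ _ _ (c_derive_const c y) Hu)).
  replace (c * d)%C with (0 * u y + c * d)%C by ring. exact H.
Qed.

Lemma monomial_vertical_continuous (c : C) x y m n :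
  continuous (fun t => Re (c * ((x, t) ^ m * Cconj (x, t) ^ n))%C) y.
Proof.
  apply (ex_derive_continuous (V := R_NormedModule)).
  eexists. apply (c_derive_re_scal c), c_derive_monomial.
Qed.

Definition c_continuous (u : R -> C) (x : R) : Prop :=
  continuous (fun t => Re (u t)) x /\ continuous (fun t => Im (u t)) x.

Lemma c_continuous_pow u x n : c_continuous u x -> c_continuous (fun t => (u t ^ n)%C) x.
Proof.
  intros [U1 U2]. induction n as [|n [I1 I2]].
  - split; apply continuous_const.
  - split.
    + apply continuous_ext with (fun t => Re (u t) * Re (u t ^ n)%C - Im (u t) * Im (u t ^ n)%C).
      { intros t. now rewrite Cpow_S, re_mult. }
      apply (continuous_minus (V := R_NormedModule)); apply (continuous_mult (K := R_AbsRing));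
          auto.
    + apply continuous_ext with (fun t => Re (u t) * Im (u t ^ n)%C + Im (u t) * Re (u t ^ n)%C).
      { intros t. now rewrite Cpow_S, im_mult. }
      apply (continuous_plus (V := R_NormedModule)); apply (continuous_mult (K := R_AbsRing)); auto.
Qed.

Lemma half_chord_continuous r x : continuous (half_chord r) x.
Proof.
  unfold half_chord. apply continuous_comp.
  - apply (ex_derive_continuous (V := R_NormedModule)). auto_derive. trivial.
  - apply continuous_sqrt.
Qed.

(** The substitution x = r cos t turns the integrand into -r^(n+2) sin t sin((n+1) t). *)
Lemma semicircle_integral r n : 0 <= r ->
  is_RInt (fun x => Im ((x, half_chord r x) ^ S n)%C) (- r) r
          (match n with O => PI * r ^ 2 / 2 | S _ => 0 end).
Proof.
  intros Hr. set (f := fun x => Im ((x, half_chord r x) ^ S n)%C).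
  assert (Hcont : forall x, continuous f x).
  { intros x. apply (c_continuous_pow (fun t => (t, half_chord r t))). split; simpl.
    - apply continuous_id. - apply half_chord_continuous. }
  assert (HPI := PI_RGT_0).
  assert (H1 := is_RInt_comp (V := R_CompleteNormedModule) f (fun t => r * cos t) (fun t => - r *
      sin t) 0 PI
    (fun x _ => Hcont _)).
  simpl in H1. rewrite cos_0, cos_PI in H1.
  assert (H2 := H1 ltac:(intros x _; split; [auto_derive; [trivial|ring]|
     apply (ex_derive_continuous (V := R_NormedModule)); auto_derive; trivial])).
  clear H1.
  set (P := fun t => match n with
     | O => - r ^ 2 * (t / 2 - sin t * cos t / 2)
     | S k => - r ^ (S (S n)) / 2 * (sin (INR n * t) / INR n - sin (INR (S (S n)) * t) / INR (S (S
         n)))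
     end).
  set (dP := fun t => - r ^ (S (S n)) * (sin t * sin (INR (S n) * t))).
  (* sin t sin((n+1) t) = (cos(n t) - cos((n+2) t)) / 2. *)
  assert (H3 : is_RInt dP 0 PI (minus (P PI) (P 0))).
  { apply (is_RInt_derive (V := R_CompleteNormedModule)).
    - intros t _. unfold P, dP. destruct n as [|k].
      + auto_derive; [trivial|]. simpl INR. rewrite !Rmult_1_l.
        assert (E := sin2_cos2 t). unfold Rsqr in E.
        transitivity (- r ^ 2 * (/ 2 - (cos t * cos t - sin t * sin t) / 2)); [field|].
        replace (cos t * cos t) with (1 - sin t * sin t) by lra. field.
      + rewrite !(S_INR (S _)). set (A := INR (S k)). set (K := r ^ S (S (S k))).
        assert (HA : 0 < A) by (apply lt_0_INR; lia). clearbody A K.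
        auto_derive; [trivial|].
        replace (A * t) with ((A + 1) * t - t) by ring.
        replace ((A + 1 + 1) * t) with ((A + 1) * t + t) by ring.
        rewrite cos_minus, cos_plus. field. lra.
    - intros t _. apply (ex_derive_continuous (V := R_NormedModule)). unfold dP. auto_derive.
        trivial. }
  assert (H4 : is_RInt dP 0 PI (RInt f (r * 1) (r * -1))).
  { apply is_RInt_ext with (2 := H2). intros t Ht. rewrite Rmin_left, Rmax_right in Ht by lra.
    change (scal (- r * sin t) (f (r * cos t))) with (- r * sin t * f (r * cos t)).
    assert (Hs : 0 < sin t) by (apply sin_gt_0; lra).
    assert (Hh : half_chord r (r * cos t) = r * sin t).
    { unfold half_chord. replace (r ^ 2 - (r * cos t) ^ 2) with ((r * sin t) ^ 2).
      - apply sqrt_pow2. nra.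
      - generalize (sin2_cos2 t). unfold Rsqr. intros E.
        replace (r ^ 2 - (r * cos t) ^ 2) with (r ^ 2 * (1 - cos t * cos t)) by ring.
        replace (1 - cos t * cos t) with (sin t * sin t) by lra. ring. }
    unfold f, dP. rewrite Hh.
    replace ((r * cos t, r * sin t) : C) with (RtoC r * cis t)%C
      by (apply injective_projections; simpl; ring).
    rewrite Cpow_mult_l, cis_pow, <- RtoC_pow, im_scal_l.
    change (Im (cis (INR (S n) * t))) with (sin (INR (S n) * t)).
    change (r ^ S (S n)) with (r * r ^ S n).
    match goal with |- ?x = ?y => change (@eq R x y) end. ring. }
  assert (E := is_RInt_unique _ _ _ _ H3). rewrite (is_RInt_unique _ _ _ _ H4) in E.
  assert (Hex : ex_RInt f (- r) r).
  { apply (ex_RInt_continuous (V := R_CompleteNormedModule)). auto. }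
  assert (H5 := RInt_correct f (- r) r Hex).
  replace (r * 1) with r in E by ring. replace (r * -1) with (- r) in E by ring.
  assert (E2 : RInt f (- r) r = match n with O => PI * r ^ 2 / 2 | S _ => 0 end).
  { rewrite <- (opp_RInt_swap f r (- r)) by (apply ex_RInt_swap, Hex). rewrite E.
    change (- (P PI - P 0) = match n with O => PI * r ^ 2 / 2 | S _ => 0 end).
    assert (Z : forall m, sin (INR m * PI) = 0).
    { intros m. rewrite sin_eq_0_1; [reflexivity|]. exists (Z.of_nat m). now rewrite INR_IZR_INZ. }
    unfold P. destruct n as [|k].
    - rewrite sin_0, cos_0, sin_PI. field.
    - rewrite !Z, !Rmult_0_r, sin_0. unfold Rdiv. ring. }
  rewrite E2 in H5. exact H5.
Qed.

(** * The area integral of a power series *)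

(** The integrand is the derivative in y of Re (c z^(k+n+1) conj(z)^k), so the inner
    integral is the difference of the values at the two ends of the chord, which are conjugate
    to each other. *)
Lemma vertical_exact_disk_int (c : C) r k n : 0 <= r ->
  is_disk_int (fun z => Re (c * (Ci * (INR (S (k + n)) * z ^ (k + n) * Cconj z ^ k
                - INR k * z ^ S (k + n) * Cconj z ^ pred k)))%C) r
     (match n with O => - (PI * r ^ (2 * k + 2) * Im c) | S _ => 0 end).
Proof.
  intros Hr.
  set (W := fun x y => Re (c * ((x, y) ^ S (k + n) * Cconj (x, y) ^ k))%C).
  exists (fun x => W x (half_chord r x) - W x (- half_chord r x)). split.
  - intros x Hx. apply (is_RInt_derive (V := R_CompleteNormedModule) (W x)).
    + intros y _. apply c_derive_re_scal, (c_derive_monomial x y (S (k + n)) k).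
    + intros y _.
      apply continuous_ext with (fun t => INR (S (k + n)) * Re (c * Ci * ((x, t) ^ (k + n) * Cconj
          (x, t) ^ k))%C
         - INR k * Re (c * Ci * ((x, t) ^ S (k + n) * Cconj (x, t) ^ pred k))%C).
      { intros t. rewrite <- !re_scal_l, <- re_minus. f_equal. ring. }
      apply (continuous_minus (V := R_NormedModule));
        apply (continuous_scal_r (V := R_NormedModule)), monomial_vertical_continuous.
  (* On the circle z conj(z) = r^2, so only the power z^(n+1) of the primitive matters. *)
  - assert (HS := is_RInt_scal (V := R_NormedModule) _ _ _ (- 2 * r ^ (2 * k) * Im c) _
       (semicircle_integral r n Hr)).
    match type of HS with is_RInt _ _ _ ?v =>
      replace v with (match n with O => - (PI * r ^ (2 * k + 2) * Im c) | S _ => 0 end) in HS end.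
    2:{ destruct n.
        - change (- (PI * r ^ (2 * k + 2) * Im c) = - 2 * r ^ (2 * k) * Im c * (PI * r ^ 2 / 2)).
          rewrite pow_add. field.
        - change (0 = - 2 * r ^ (2 * k) * Im c * 0). ring. }
    apply is_RInt_ext with (2 := HS). intros x Hx. rewrite Rmin_left, Rmax_right in Hx by lra.
    change (- 2 * r ^ (2 * k) * Im c * Im ((x, half_chord r x) ^ S n)%C
       = W x (half_chord r x) - W x (- half_chord r x)).
    set (z := (x, half_chord r x) : C).
    assert (Ez : forall j, (z ^ j * Cconj z ^ j)%C = RtoC (r ^ (2 * j))).
    { intros j. rewrite <- Cpow_mult_l, <- Cmod2_conj, Cmod2_alt, pow_mult, RtoC_pow. f_equal.
        f_equal.
      unfold z, Re, Im; simpl fst; simpl snd. rewrite half_chord_sqr by lra. ring. }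
    unfold W. change (x, - half_chord r x) with (Cconj z). fold z. rewrite Cconj_conj.
    replace (z ^ S (k + n) * Cconj z ^ k)%C with (RtoC (r ^ (2 * k)) * z ^ S n)%C.
    2:{ rewrite <- Ez. replace (S (k + n)) with (k + S n)%nat by lia. rewrite Cpow_add_r. ring. }
    replace (Cconj z ^ S (k + n) * z ^ k)%C with (RtoC (r ^ (2 * k)) * Cconj z ^ S n)%C.
    2:{ rewrite <- Ez. replace (S (k + n)) with (k + S n)%nat by lia. rewrite Cpow_add_r. ring. }
    rewrite <- Cpow_conj. set (u := (z ^ S n)%C).
    rewrite !(Cmult_assoc c), !(Cmult_comm c (RtoC _)), <- !Cmult_assoc.
    rewrite !re_scal_l, !re_mult, re_conj, im_conj. ring.
Qed.

(** Subtracting a y-derivative replaces z^(k+n) conj(z)^k by a multiple of z^(k+n+1)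
    conj(z)^(k-1), whose exponents differ by n + 2: by induction on k its integral is zero. *)
Lemma monomial_disk_int (c : C) r k n : 0 <= r ->
  is_disk_int (fun z => Re (c * (z ^ (k + n) * Cconj z ^ k))%C) r
     (match n with O => PI * r ^ (2 * k + 2) / (INR k + 1) * Re c | S _ => 0 end).
Proof.
  intros Hr. revert n c.
  assert (Hstep : forall k, (forall j n c, k = S j -> is_disk_int
        (fun z => Re (c * (z ^ (j + S n) * Cconj z ^ j))%C) r 0) ->
     forall n c, is_disk_int (fun z => Re (c * (z ^ (k + n) * Cconj z ^ k))%C) r
     (match n with O => PI * r ^ (2 * k + 2) / (INR k + 1) * Re c | S _ => 0 end)).
  2:{ induction k as [|k IH]; apply Hstep; [discriminate|].
      intros j n c [= <-]. apply (IH (S n)). }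
  clear k. intros k IH n c.
  assert (HN : 0 < INR (S (k + n))) by (apply lt_0_INR; lia).
  (* 1 / (i (k + n + 1)) normalises the primitive z^(k+n+1) conj(z)^k in y. *)
  set (c' := (- Ci * c * RtoC (/ INR (S (k + n))))%C).
  assert (H1 := vertical_exact_disk_int c' r k n Hr).
  assert (Hc : (c' * Ci * RtoC (INR (S (k + n))))%C = c).
  { unfold c'. rewrite RtoC_inv by lra.
    assert (RtoC (INR (S (k + n))) <> RtoC 0) by (intros E; apply RtoC_inj in E; lra).
    replace (- Ci * c * / INR (S (k + n)) * Ci * INR (S (k + n)))%C
      with (- (Ci * Ci) * c)%C by (field; assumption).
    replace (Ci * Ci)%C with (RtoC (-1)) by (apply injective_projections; simpl; ring).
    rewrite <- RtoC_opp. replace (- -1) with 1 by ring. ring. }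
  assert (H2 : is_disk_int (fun z => Re (c' * Ci * INR k * (z ^ S (k + n) * Cconj z ^ pred k))%C) r
      0).
  { destruct k as [|k].
    - apply disk_int_ext with (3 := disk_int_zero r); [exact Hr|].
      intros z _. simpl INR. rewrite Cmult_0_r, Cmult_0_l. reflexivity.
    - simpl pred. replace (S (S k + n))%nat with (k + S (S n))%nat by lia.
      apply (IH k (S n)). reflexivity. }
  assert (H := disk_int_plus _ _ _ _ _ H1 H2). rewrite Rplus_0_r in H.
  match type of H with is_disk_int _ _ ?v =>
    replace (match n with O => PI * r ^ (2 * k + 2) / (INR k + 1) * Re c | S _ => 0 end) with v end.
  - apply disk_int_ext with (3 := H); [exact Hr|]. intros z _. rewrite <- re_plus. f_equal.
    transitivity (c' * Ci * RtoC (INR (S (k + n))) * (z ^ (k + n) * Cconj z ^ k))%C; [ring|].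
    now rewrite Hc.
  - destruct n; [|reflexivity].
    assert (E : Im c' = - Re c / INR (S (k + 0))).
    { unfold c'. rewrite im_scal_r. unfold Im, Re, Ci, Cmult, Copp; simpl fst; simpl snd. field.
        lra. }
    rewrite E. rewrite Nat.add_0_r in *. rewrite S_INR in *. field. lra.
Qed.

Lemma cross_disk_int (c : C) (cs : nat -> C) r n m : 0 <= r -> (m <= n)%nat ->
  is_disk_int (fun z => Re (c * z ^ n * Cconj (partial_pseries cs z m))%C) r 0.
Proof.
  intros Hr. induction m as [|m IH]; intros Hm.
  - apply disk_int_ext with (3 := disk_int_zero r); [exact Hr|].
    intros z _. cbn [partial_pseries]. rewrite <- (re_RtoC 0) at 1. f_equal.
    replace (Cconj 0) with (RtoC 0) by (apply injective_projections; simpl; ring). ring.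
  - assert (H0 : is_disk_int (fun z => Re (c * Cconj (cs m) * (z ^ (m + S (n - m - 1)) * Cconj z ^
      m))%C) r 0)
      by exact (monomial_disk_int (c * Cconj (cs m))%C r m (S (n - m - 1)) Hr).
    assert (H := disk_int_plus _ _ _ _ _ (IH ltac:(lia)) H0). rewrite Rplus_0_r in H.
    apply disk_int_ext with (3 := H); [exact Hr|]. intros z _.
    rewrite <- re_plus. f_equal. cbn [partial_pseries].
    replace (m + S (n - m - 1))%nat with n by lia.
    rewrite Cplus_conj, Cmult_conj, Cpow_conj. ring.
Qed.

(** The integral of |c_k z^k|^2 over |z| <= r. *)
Definition area_term (c : nat -> C) (r : R) (k : nat) : R :=
  Cmod (c k) ^ 2 * (PI * r ^ (2 * k + 2) / (INR k + 1)).

Lemma partial_pseries_area (c : nat -> C) r n : 0 <= r ->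
  is_disk_int (fun z => Cmod (partial_pseries c z n) ^ 2) r (partial_sum (area_term c r) n).
Proof.
  intros Hr. induction n as [|n IH].
  - apply disk_int_ext with (3 := disk_int_zero r); [exact Hr|].
    intros z _. simpl. rewrite Cmod_0. ring.
  - assert (H1 := monomial_disk_int (RtoC (Cmod (c n) ^ 2)) r n 0 Hr).
    assert (H2 := disk_int_scal _ _ _ 2 (cross_disk_int (c n) c r n n Hr (le_n n))).
    assert (H := disk_int_plus _ _ _ _ _ IH (disk_int_plus _ _ _ _ _ H1 H2)).
    match type of H with is_disk_int _ _ ?v =>
      replace (partial_sum (area_term c r) (S n)) with v end.
    + apply disk_int_ext with (3 := H); [exact Hr|]. intros z _. cbn [partial_pseries].
      set (s := partial_pseries c z n). rewrite Nat.add_0_r.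
      set (q := (z ^ n)%C). rewrite <- Cpow_conj. fold q.
      rewrite re_scal_l, !Cmod2_alt.
      rewrite !re_mult, !re_plus, !im_plus, !re_conj, !im_conj, !re_mult, !im_mult, ?re_conj,
          ?im_conj. ring.
    + cbn [partial_sum]. unfold area_term. rewrite re_RtoC. ring.
Qed.

(** The orthogonality relations for partial sums pass to the limit because the squared
    moduli converge uniformly on |z| <= r. *)
Lemma pseries_sum_area (c : nat -> C) r : summable c -> 0 <= r < 1 ->
  exists V : R, is_series (area_term c r) V /\
    is_disk_int (fun z => Cmod (pseries_sum c z) ^ 2) r V.
Proof.
  intros Hc Hr. destruct (Hc r Hr) as [A HA].
  assert (Hnn : forall k, 0 <= Cmod (c k) * r ^ k).
  { intros k. apply Rmult_le_pos; [apply Cmod_ge_0|apply pow_le; lra]. }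
  destruct (disk_int_limit (fun n z => Cmod (partial_pseries c z n) ^ 2) (fun z => Cmod
      (pseries_sum c z) ^ 2) r
     (partial_sum (area_term c r)) (fun n => (A - partial_sum (fun k => Cmod (c k) * r ^ k) n) * (2
         * A)))
    as [V [HV1 HV2]].
  - lra.
  - intros n. apply partial_pseries_area. lra.
  - intros n z Hz.
    assert (Hl : pseries_to c z (pseries_sum c z)) by (apply summable_pseries_to; [exact Hc|lra]).
    assert (B1 := pseries_to_tail c z _ r A n Hz HA Hl).
    assert (B2 := pseries_to_Cmod_le c z _ r A Hz HA Hl).
    assert (B3 : Cmod (partial_pseries c z n) <= A).
    { eapply Rle_trans; [apply partial_pseries_Cmod_le, Hz|]. apply partial_sum_le_series; auto. }
    set (u := partial_pseries c z n) in *. set (v := pseries_sum c z) in *.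
    assert (D0 := Cmod_ge_0 u). assert (D1 := Cmod_ge_0 v).
    assert (T1 := Cmod_triangle (u - v)%C v). assert (T2 := Cmod_triangle (- (u - v))%C u).
    rewrite Cmod_opp in T2.
    replace (u - v + v)%C with u in T1 by ring. replace (- (u - v) + u)%C with v in T2 by ring.
    replace (Cmod u ^ 2 - Cmod v ^ 2) with ((Cmod u - Cmod v) * (Cmod u + Cmod v)) by ring.
    rewrite Rabs_mult. apply Rmult_le_compat; try apply Rabs_pos.
    + apply Rle_trans with (2 := B1). apply Rabs_le. lra.
    + rewrite Rabs_pos_eq; lra.
  - replace (Finite 0) with (Finite ((A - A) * (2 * A))) by (f_equal; ring).
    apply is_lim_seq_mult'; [|apply is_lim_seq_const].
    apply is_lim_seq_minus'; [apply is_lim_seq_const|apply partial_sum_lim, HA].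
  - exists V. split; [apply partial_sum_lim_inv, HV1|exact HV2].
Qed.

Lemma S_area_series (h g : C -> C) (a b : nat -> C) r :
  power_expansion h a -> power_expansion g b -> 0 <= r < 1 ->
  exists V W : R, is_series (area_term (deriv_coef a) r) V /\ is_series (area_term (deriv_coef b)
      r) W
    /\ S_area h g r = V - W.
Proof.
  intros Ha Hb Hr.
  assert (Hh := class_pseries_to_h h a Ha). assert (Hg := class_pseries_to_g g b Hb).
  assert (Hsa := class_summable_a h a Ha). assert (Hsb := class_summable_b g b Hb).
  destruct (pseries_sum_area (deriv_coef a) r (summable_deriv_coef _ Hsa) Hr) as [V [HV1 HV2]].
  destruct (pseries_sum_area (deriv_coef b) r (summable_deriv_coef _ Hsb) Hr) as [W [HW1 HW2]].
  exists V, W. split; [exact HV1|]. split; [exact HW1|].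
  unfold S_area. apply disk_int_correct; [lra|].
  replace (V - W) with (V + -1 * W) by ring.
  apply disk_int_ext with (3 := disk_int_plus _ _ _ _ _ HV2 (disk_int_scal _ _ _ (-1) HW2)); [lra|].
  intros z Hz. rewrite (C_derive_pseries_to a), (C_derive_pseries_to b) by (auto; lra). ring.
Qed.

(** * Closed forms of the majorant series *)

(** Series and integrals state equalities in the carrier of an algebraic structure; the ring
    tactics need them in R. *)
Ltac real_eq := match goal with |- ?x = ?y => change (@eq R x y) end.

Lemma radius_of_bounded (a : nat -> R) x :
  (forall n, Rabs (a n) <= 1) -> Rabs x < 1 -> Rbar_lt (Rabs x) (CV_radius a).
Proof.
  intros Ha Hx. apply Rbar_lt_le_trans with (Finite 1); [exact Hx|].
  apply (CV_radius_bounded a). exists 1. intros n. rewrite pow1, Rmult_1_r. apply Ha.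
Qed.

Lemma is_series_tail (u : nat -> R) (l : R) n :
  is_series u l -> is_series (fun k => u (n + k)%nat) (l - partial_sum u n).
Proof.
  intros H. apply partial_sum_lim in H. apply partial_sum_lim_inv.
  assert (E : forall k, partial_sum (fun k => u (n + k)%nat) k = partial_sum u (k + n) -
      partial_sum u n).
  { induction k as [|k IH]; simpl; [ring|]. rewrite IH, (Nat.add_comm k n). ring. }
  apply is_lim_seq_ext with (fun k => partial_sum u (k + n) - partial_sum u n); [intros; now
      rewrite E|].
  apply is_lim_seq_minus'; [|apply is_lim_seq_const].
  apply (is_lim_seq_incr_n (partial_sum u) n), H.
Qed.

Lemma sum_n_m_partial_sum (u : nat -> R) i n :
  sum_n_m u i n = partial_sum (fun k => u (i + k)%nat) (S n - i).
Proof.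
  destruct (Nat.lt_ge_cases n i) as [h|h].
  - replace (S n - i)%nat with O by lia. now rewrite sum_n_m_zero.
  - replace n with (i + (n - i))%nat at 1 by lia.
    replace (S n - i)%nat with (S (n - i)) by lia.
    generalize (n - i)%nat. clear h. induction n0 as [|k IH].
    + rewrite Nat.add_0_r, sum_n_n. simpl. rewrite Nat.add_0_r. ring.
    + rewrite Nat.add_succ_r, sum_n_Sm by lia. rewrite IH.
      change (plus ?x ?y) with (x + y). cbn [partial_sum]. rewrite Nat.add_succ_r. reflexivity.
Qed.

Lemma is_series_lin2 (u v : nat -> R) (a b l k : R) :
  is_series u l -> is_series v k ->
  is_series (fun n => a * u n + b * v n) (a * l + b * k).
Proof.
  intros Hu Hv.
  exact (is_series_plus (V := R_NormedModule) _ _ _ _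
    (is_series_scal (K := R_AbsRing) (V := R_NormedModule) a _ _ Hu)
    (is_series_scal (K := R_AbsRing) (V := R_NormedModule) b _ _ Hv)).
Qed.

(** Termwise integration of the geometric series. *)
Lemma ln_series x : Rabs x < 1 ->
  is_series (fun k => x ^ S k / INR (S k)) (- ln (1 - x)).
Proof.
  intros Hx. assert (Hx2 := Rabs_def2 _ _ Hx).
  assert (Hr : forall y, Rabs y < 1 -> Rbar_lt (Rabs y) (CV_radius (fun _ => 1))).
  { intros y Hy. apply radius_of_bounded; [|exact Hy]. intros _. rewrite Rabs_R1; lra. }
  assert (H := is_pseries_RInt (fun _ => 1) x (Hr x Hx)).
  assert (E : RInt (PSeries (fun _ => 1)) 0 x = - ln (1 - x)).
  { apply is_RInt_unique.
    assert (Hmm : forall y, Rmin 0 x <= y <= Rmax 0 x -> Rabs y < 1).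
    { intros y Hy. unfold Rmin, Rmax in Hy. destruct (Rle_dec 0 x); apply Rabs_def1; lra. }
    apply (is_RInt_ext (fun y => / (1 - y))).
    - intros y Hy. symmetry. rewrite <- Series_geom by (apply Hmm; lra).
      apply Series_ext. intros n. ring.
    - replace (- ln (1 - x)) with (minus (- ln (1 - x)) (- ln (1 - 0))).
      + apply (is_RInt_derive (V := R_CompleteNormedModule) (fun y => - ln (1 - y))).
        * intros y Hy. specialize (Hmm y Hy). apply Rabs_def2 in Hmm.
          auto_derive; [lra|]. field. lra.
        * intros y Hy. specialize (Hmm y Hy). apply Rabs_def2 in Hmm.
          apply (ex_derive_continuous (V := R_NormedModule)). auto_derive. lra.
      + change (- ln (1 - x) - - ln (1 - 0) = - ln (1 - x)). rewrite Rminus_0_r, ln_1. ring. }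
  rewrite E in H. apply is_pseries_R in H.
  replace (- ln (1 - x)) with (- ln (1 - x) - partial_sum (fun n => PS_Int (fun _ => 1) n * x ^ n)
      1)
    by (simpl; ring).
  apply is_series_ext with (2 := is_series_tail _ _ 1 H).
  intros k. change (1 / INR (S k) * x ^ S k = x ^ S k / INR (S k)).
  unfold Rdiv. ring.
Qed.

Lemma inv_sqr_bound n : 0 < / INR (S n) ^ 2 <= 1.
Proof.
  assert (H : 1 <= INR (S n)) by (rewrite S_INR; generalize (pos_INR n); lra).
  split; [apply Rinv_0_lt_compat, pow_lt; lra|].
  rewrite <- Rinv_1. apply Rinv_le_contravar; nra.
Qed.

Lemma Li2_PSeries x : Li2 x = x * PSeries (fun k => / INR (S k) ^ 2) x.
Proof.
  unfold Li2, PSeries. rewrite <- Series_scal_l. apply Series_ext. intros k.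
  unfold Rdiv. simpl pow. ring.
Qed.

Lemma Li2_radius x : Rabs x < 1 ->
  Rbar_lt (Rabs x) (CV_radius (fun k => / INR (S k) ^ 2)).
Proof.
  intros Hx. apply radius_of_bounded; [|exact Hx]. intros n.
  assert (H := inv_sqr_bound n). rewrite Rabs_pos_eq; lra.
Qed.

Lemma Li2_series x : Rabs x < 1 -> is_series (fun k => x ^ S k / INR (S k) ^ 2) (Li2 x).
Proof.
  intros Hx. apply Series_correct.
  assert (H := CV_radius_inside _ _ (Li2_radius x Hx)). apply ex_pseries_R in H.
  apply ex_series_ext with (2 := ex_series_scal (K := R_AbsRing) (V := R_NormedModule) x _ H).
  intros n. change (x * (/ INR (S n) ^ 2 * x ^ n) = x ^ S n / INR (S n) ^ 2).
  unfold Rdiv. simpl pow. ring.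
Qed.

Lemma Li2_continuous x : Rabs x < 1 -> continuity_pt Li2 x.
Proof.
  intros Hx. apply continuity_pt_ext with (fun x => x * PSeries (fun k => / INR (S k) ^ 2) x).
  { intros y. symmetry. apply Li2_PSeries. }
  apply continuity_pt_mult; [apply continuity_pt_id|].
  apply PSeries_continuity, Li2_radius, Hx.
Qed.

(** 1 / (n (n-1)) = 1 / (n-1) - 1 / n, with n = k + 2. *)
Lemma series_inv_prod x : Rabs x < 1 ->
  is_series (fun k => x ^ (2 + k) / (INR (2 + k) * INR (S k))) (x + (1 - x) * ln (1 - x)).
Proof.
  intros Hx. assert (H := ln_series x Hx).
  assert (H1 := is_series_tail _ _ 1 H).
  assert (H2 := is_series_lin2 _ _ x (-1) _ _ H H1).
  replace (x + (1 - x) * ln (1 - x)) with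
   (x * (- ln (1 - x)) + -1 * (- ln (1 - x) - partial_sum (fun k => x ^ S k / INR (S k)) 1)) by
       (simpl; field).
  apply is_series_ext with (2 := H2). intros k.
  assert (P1 : INR (S k) <> 0) by (apply not_0_INR; lia).
  assert (P2 : INR (S (S k)) <> 0) by (apply not_0_INR; lia).
  change (2 + k)%nat with (S (S k)). change (1 + k)%nat with (S k).
  replace (x ^ S (S k)) with (x * x ^ S k) by reflexivity.
  rewrite (S_INR (S k)) in *. real_eq. field. auto.
Qed.

(** 1 / (n (n-1))^2 = 1 / (n-1)^2 + 1 / n^2 - 2 / (n (n-1)), with n = k + 2. *)
Lemma series_inv_prod_sqr x : Rabs x < 1 ->
  is_series (fun k => x ^ (2 + k) / (INR (2 + k) ^ 2 * INR (S k) ^ 2))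
    ((x + 1) * Li2 x + 2 * (x - 1) * ln (1 - x) - 3 * x).
Proof.
  intros Hx. assert (H := Li2_series x Hx).
  assert (H1 := is_series_tail _ _ 1 H).
  assert (H2 := is_series_lin2 _ _ 1 (-2) _ _ (is_series_lin2 _ _ x 1 _ _ H H1) (series_inv_prod x
      Hx)).
  match type of H2 with is_series _ ?v => replace ((x + 1) * Li2 x + 2 * (x - 1) * ln (1 - x) - 3 *
      x) with v by (simpl; field) end.
  apply is_series_ext with (2 := H2). intros k.
  assert (P1 : INR (S k) <> 0) by (apply not_0_INR; lia).
  assert (P2 : INR (S (S k)) <> 0) by (apply not_0_INR; lia).
  change (2 + k)%nat with (S (S k)). change (1 + k)%nat with (S k).
  replace (x ^ S (S k)) with (x * x ^ S k) by reflexivity.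
  rewrite (S_INR (S k)) in *. real_eq. field. auto.
Qed.

(** 1 / (n (n-1)^2) = 1 / (n-1)^2 - 1 / (n (n-1)), with n = k + 2. *)
Lemma series_area_majorant x : Rabs x < 1 ->
  is_series (fun k => x ^ (2 + k) / (INR (2 + k) * INR (S k) ^ 2))
    (x * Li2 x - (x + (1 - x) * ln (1 - x))).
Proof.
  intros Hx. assert (H := Li2_series x Hx).
  assert (H2 := is_series_lin2 _ _ x (-1) _ _ H (series_inv_prod x Hx)).
  match type of H2 with is_series _ ?v => replace (x * Li2 x - (x + (1 - x) * ln (1 - x))) with v
      by (simpl; field) end.
  apply is_series_ext with (2 := H2). intros k.
  assert (P1 : INR (S k) <> 0) by (apply not_0_INR; lia).
  assert (P2 : INR (S (S k)) <> 0) by (apply not_0_INR; lia).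
  change (2 + k)%nat with (S (S k)).
  replace (x ^ S (S k)) with (x * x ^ S k) by reflexivity.
  rewrite (S_INR (S k)) in *. real_eq. field. auto.
Qed.

(** The Taylor coefficients of the extremal function, which bound |a_n| + |b_n| for the
    whole class. *)
Definition coef_bound (M : R) (n : nat) : R :=
  match n with O => 0 | 1%nat => 1 | _ => 2 * M / (INR n * (INR n - 1)) end.

Lemma coef_bound_SS M k : coef_bound M (2 + k) = 2 * M / (INR (2 + k) * INR (S k)).
Proof.
  change (2 * M / (INR (2 + k) * (INR (2 + k) - 1)) = 2 * M / (INR (2 + k) * INR (S k))).
  f_equal. f_equal. change (2 + k)%nat with (S (S k)). rewrite (S_INR (S k)). f_equal. ring.
Qed.

Lemma coef_bound_pos M n : 0 < M -> (1 <= n)%nat -> 0 < coef_bound M n.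
Proof.
  intros HM Hn. destruct n as [|[|k]]; [lia|simpl; lra|].
  change (S (S k)) with (2 + k)%nat. rewrite coef_bound_SS.
  apply Rdiv_lt_0_compat; [lra|apply Rmult_lt_0_compat; apply lt_0_INR; lia].
Qed.

Lemma coef_bound_ge0 M n : 0 < M -> 0 <= coef_bound M n.
Proof.
  intros HM. destruct n; [apply Rle_refl|]. apply Rlt_le, coef_bound_pos; [exact HM|lia].
Qed.

Lemma INR_consecutive_neq_0 k : INR (S k) <> 0 /\ INR (2 + k) <> 0.
Proof. split; apply not_0_INR; lia. Qed.

Lemma G_M_series M x : Rabs x < 1 -> is_series (fun n => coef_bound M n * x ^ n) (G_M M x).
Proof.
  intros Hx. apply partial_sum_lim_inv. apply (is_lim_seq_incr_n _ 2).
  assert (H := is_series_scal (K := R_AbsRing) (V := R_NormedModule) (2 * M) _ _ (series_inv_prod x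
      Hx)).
  apply partial_sum_lim in H.
  apply is_lim_seq_ext with (fun n => x + partial_sum (fun k => 2 * M * (x ^ (2 + k) / (INR (2 + k)
      * INR (S k)))) n).
  - induction n as [|n IH].
    + simpl. ring.
    + change (partial_sum (fun n => coef_bound M n * x ^ n) (S n + 2))
       with (partial_sum (fun n => coef_bound M n * x ^ n) (n + 2) + coef_bound M (n + 2) * x ^ (n
           + 2)).
      rewrite <- IH. cbn [partial_sum]. rewrite (Nat.add_comm n 2), coef_bound_SS.
      destruct (INR_consecutive_neq_0 n). field. auto.
  - unfold G_M. apply is_lim_seq_plus'; [apply is_lim_seq_const|]. exact H.
Qed.

Lemma F_M_series M r : 0 <= r < 1 ->
  is_series (fun n => INR n * coef_bound M n ^ 2 * r ^ (2 * n)) (F_M M r).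
Proof.
  intros Hr. apply partial_sum_lim_inv. apply (is_lim_seq_incr_n _ 2).
  assert (Hx : Rabs (r ^ 2) < 1) by (rewrite Rabs_pos_eq; nra).
  assert (H := is_series_scal (K := R_AbsRing) (V := R_NormedModule) (4 * M ^ 2) _ _
      (series_area_majorant (r ^ 2) Hx)).
  apply partial_sum_lim in H.
  apply is_lim_seq_ext with (fun n => r ^ 2 + partial_sum (fun k => 4 * M ^ 2 * ((r ^ 2) ^ (2 + k)
      / (INR (2 + k) * INR (S k) ^ 2))) n).
  - induction n as [|n IH].
    + simpl. ring.
    + change (partial_sum (fun n => INR n * coef_bound M n ^ 2 * r ^ (2 * n)) (S n + 2))
       with (partial_sum (fun n => INR n * coef_bound M n ^ 2 * r ^ (2 * n)) (n + 2)
             + INR (n + 2) * coef_bound M (n + 2) ^ 2 * r ^ (2 * (n + 2))).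
      rewrite <- IH. cbn [partial_sum]. rewrite (Nat.add_comm n 2), coef_bound_SS, pow_mult.
      destruct (INR_consecutive_neq_0 n). field. auto.
  - unfold F_M. apply is_lim_seq_plus'; [apply is_lim_seq_const|]. exact H.
Qed.

Lemma tail_series M r N : 0 <= r < 1 -> (2 <= N)%nat ->
  is_series (fun k => coef_bound M (N + k) * r ^ (N + k))
    (2 * M * (r + (1 - r) * ln (1 - r)
             - sum_n_m (fun n : nat => r ^ n / (INR n * (INR n - 1))) 2 (N - 1))).
Proof.
  intros Hr HN. assert (Hx : Rabs r < 1) by (rewrite Rabs_pos_eq; lra).
  assert (H := is_series_scal (K := R_AbsRing) (V := R_NormedModule) (2 * M) _ _
     (is_series_tail _ _ (N - 2) (series_inv_prod r Hx))).
  rewrite sum_n_m_partial_sum. replace (S (N - 1) - 2)%nat with (N - 2)%nat by lia.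
  match type of H with is_series _ (scal _ (_ - ?v)) =>
    match goal with |- context [partial_sum ?u (N - 2)] => replace (partial_sum u (N - 2)) with v
        end end.
  - apply is_series_ext with (2 := H). intros k.
    change (2 * M * (r ^ (2 + (N - 2 + k)) / (INR (2 + (N - 2 + k)) * INR (S (N - 2 + k))))
      = coef_bound M (N + k) * r ^ (N + k)).
    replace (N + k)%nat with (2 + (N - 2 + k))%nat by lia. rewrite coef_bound_SS.
    destruct (INR_consecutive_neq_0 (N - 2 + k)). field. auto.
  - apply partial_sum_ext. intros k. change (2 + k)%nat with (S (S k)). rewrite (S_INR (S k)).
    f_equal. f_equal. ring.
Qed.

Lemma square_tail_series M r t : 0 <= r < 1 -> (1 <= t)%nat ->
  is_series (fun k => coef_bound M (t + 1 + k) ^ 2 * r ^ (2 * (t + 1 + k))) (4 * M ^ 2 * G_t t r).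
Proof.
  intros Hr Ht. assert (Hx : Rabs (r ^ 2) < 1) by (rewrite Rabs_pos_eq; nra).
  assert (H := is_series_scal (K := R_AbsRing) (V := R_NormedModule) (4 * M ^ 2) _ _
     (is_series_tail _ _ (t - 1) (series_inv_prod_sqr (r ^ 2) Hx))).
  unfold G_t. rewrite sum_n_m_partial_sum. replace (S t - 2)%nat with (t - 1)%nat by lia.
  match type of H with is_series _ (scal _ (_ - ?v)) =>
    match goal with |- context [partial_sum ?u (t - 1)] => replace (partial_sum u (t - 1)) with v
        end end.
  - apply is_series_ext with (2 := H). intros k.
    change (4 * M ^ 2 * ((r ^ 2) ^ (2 + (t - 1 + k)) / (INR (2 + (t - 1 + k)) ^ 2 * INR (S (t - 1 +
        k)) ^ 2))
      = coef_bound M (t + 1 + k) ^ 2 * r ^ (2 * (t + 1 + k))).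
    replace (t + 1 + k)%nat with (2 + (t - 1 + k))%nat by lia. rewrite coef_bound_SS, pow_mult.
    destruct (INR_consecutive_neq_0 (t - 1 + k)). field. auto.
  - apply partial_sum_ext. intros k. change (2 + k)%nat with (S (S k)). rewrite pow_mult, (S_INR (S
      k)).
    f_equal. f_equal. f_equal. ring.
Qed.

Lemma square_head_sum M t : (1 <= t)%nat ->
  sum_n_m (fun n => coef_bound M n ^ 2) 1 t
   = 1 + 4 * M ^ 2 * sum_n_m (fun n : nat => 1 / (INR n ^ 2 * (INR n - 1) ^ 2)) 2 t.
Proof.
  intros Ht. rewrite sum_Sn_m by exact Ht.
  change (plus ?x ?y) with (x + y). rewrite !sum_n_m_partial_sum.
  replace (coef_bound M 1 ^ 2) with 1 by (simpl; ring). f_equal.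
  generalize (S t - 2)%nat. induction n as [|n IH]; [simpl; ring|].
  cbn [partial_sum]. rewrite IH, coef_bound_SS.
  replace (INR (2 + n) - 1) with (INR (S n)).
  - destruct (INR_consecutive_neq_0 n). field. auto.
  - change (2 + n)%nat with (S (S n)). rewrite (S_INR (S n)). ring.
Qed.

(** * Monotonicity of the majorant and its root *)

Definition bohr_tail (N : nat) (c : nat -> R) (r : R) : R :=
  Series (fun k => c (N + k)%nat * r ^ (N + k)).

(** The left-hand side without its tail series. The modulus of f, the coefficients, the
    radius and the area are separate arguments, so that monotonicity in all of them yields at
    once the inequality for the class and the monotonicity of Phi. The tail is kept apart
    because it alone is strictly increasing when all the parameters vanish. *)
Definition bohr_rest (beta mu lambda : R) (q : nat) (lam : nat -> R) (m N : nat)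
    (w : R) (c : nat -> R) (r s : R) : R :=
  let t := t_of N in
  beta * w ^ m
  + mu * sign (INR t) * sum_n_m (fun n => c n ^ 2) 1 t * (r ^ N / (1 - r))
  + lambda * (1 + r / (1 - r))
      * Series (fun k => c (t + 1 + k)%nat ^ 2 * r ^ (2 * (t + 1 + k)))
  + P_poly q lam s.

Lemma bohr_lhs_split beta mu lambda q lam m N f h g a b z :
  bohr_lhs beta mu lambda q lam m N f h g a b z =
  bohr_tail N (fun n => Cmod (a n) + Cmod (b n)) (Cmod z)
  + bohr_rest beta mu lambda q lam m N (Cmod (f z)) (fun n => Cmod (a n) + Cmod (b n))
      (Cmod z) (S_area h g (Cmod z) / PI).
Proof. unfold bohr_lhs, bohr_tail, bohr_rest. ring. Qed.

Lemma t_of_ge2 N : (5 <= N)%nat -> (2 <= t_of N)%nat.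
Proof. intros HN. unfold t_of. apply Nat.div_le_lower_bound; lia. Qed.

(** Phi + L is the left-hand side with every ingredient replaced by its majorant. *)
Lemma Phi_split M beta mu lambda q lam m N r : (5 <= N)%nat -> 0 <= r < 1 ->
  Phi M beta mu lambda q lam m N r =
  bohr_tail N (coef_bound M) r
  + bohr_rest beta mu lambda q lam m N (G_M M r) (coef_bound M) r (F_M M r) - dist_bound M.
Proof.
  intros HN Hr. assert (Ht := t_of_ge2 N HN).
  unfold bohr_tail, bohr_rest, Phi, dist_bound, Phi_Mt.
  rewrite (is_series_unique _ _ (tail_series M r N Hr ltac:(lia))).
  rewrite (is_series_unique _ _ (square_tail_series M r (t_of N) Hr ltac:(lia))).
  rewrite square_head_sum by lia. ring.
Qed.

Lemma pow_le_mono c c' r r' n : 0 <= c <= c' -> 0 <= r <= r' -> 0 <= c * r ^ n <= c' * r' ^ n.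
Proof.
  intros Hc Hr. split; [apply Rmult_le_pos; [apply Hc|apply pow_le, Hr]|].
  apply Rmult_le_compat; [apply Hc|apply pow_le, Hr|apply Hc|apply pow_incr, Hr].
Qed.

Lemma series_le_series (u v : nat -> R) (l k : R) :
  (forall n, u n <= v n) -> is_series u l -> is_series v k -> l <= k.
Proof.
  intros H Hu Hv.
  refine (is_lim_seq_le _ _ (Finite _) (Finite _) _ (partial_sum_lim _ _ Hu) (partial_sum_lim _ _
      Hv)).
  intros n. apply partial_sum_le. auto.
Qed.

Lemma inv_one_minus_mono r r' : 0 <= r <= r' -> r' < 1 -> 0 < / (1 - r) <= / (1 - r').
Proof.
  intros Hr Hr'. split; [apply Rinv_0_lt_compat; lra|apply Rinv_le_contravar; lra].
Qed.

Section Majorant.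
Variables (M beta mu lambda : R) (q : nat) (lam : nat -> R) (m N : nat).
Hypothesis HM : 0 < M.
Hypothesis Hbeta : 0 <= beta.
Hypothesis Hmu : 0 <= mu.
Hypothesis Hlambda : 0 <= lambda.
Hypothesis Hlam : forall i : nat, (1 <= i <= q)%nat -> 0 <= lam i.
Hypothesis HN : (5 <= N)%nat.

Lemma bohr_tail_mono c r r' : (forall n, 0 <= c n <= coef_bound M n) -> 0 <= r <= r' -> r' < 1 ->
  bohr_tail N c r <= bohr_tail N (coef_bound M) r'.
Proof.
  intros Hc Hr Hr'. apply Series_le.
  - intros n. apply pow_le_mono; auto.
  - eexists. apply tail_series; [lra|lia].
Qed.

Lemma bohr_tail_strict r r' : 0 <= r < r' -> r' < 1 ->
  bohr_tail N (coef_bound M) r < bohr_tail N (coef_bound M) r'.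
Proof.
  intros Hr Hr'. unfold bohr_tail.
  assert (Hex : forall s, 0 <= s < 1 -> ex_series (fun k => coef_bound M (N + k) * s ^ (N + k))).
  { intros s Hs. eexists. apply tail_series; [lra|lia]. }
  rewrite (Series_incr_1 (fun k => coef_bound M (N + k) * r ^ (N + k))) by (apply Hex; lra).
  rewrite (Series_incr_1 (fun k => coef_bound M (N + k) * r' ^ (N + k))) by (apply Hex; lra).
  apply Rplus_lt_le_compat.
  - apply Rmult_lt_compat_l; [apply coef_bound_pos; [exact HM|lia]|].
    replace (N + 0)%nat with (S (N - 1)) by lia.
    destruct (Req_dec r 0) as [->|h].
    + rewrite pow_i by lia. apply pow_lt; lra.
    + change (r * r ^ (N - 1) < r' * r' ^ (N - 1)).
      apply Rlt_le_trans with (r' * r ^ (N - 1)).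
      * apply Rmult_lt_compat_r; [apply pow_lt; lra|lra].
      * apply Rmult_le_compat_l; [lra|apply pow_incr; lra].
  - apply Series_le.
    + intros n. apply pow_le_mono; [|lra]. split; [apply coef_bound_ge0, HM|apply Rle_refl].
    + apply (ex_series_incr_1 (fun k => coef_bound M (N + k) * r' ^ (N + k))), Hex. lra.
Qed.

(** S_r may be negative, so the comparison is made with its absolute value. *)
Lemma P_poly_mono s s' : Rabs s <= s' -> P_poly q lam s <= P_poly q lam s'.
Proof.
  intros Hs. unfold P_poly. rewrite !sum_n_m_partial_sum. apply partial_sum_le.
  intros k Hk. apply Rmult_le_compat_l; [apply Hlam; lia|].
  eapply Rle_trans; [apply Rle_abs|]. rewrite <- RPow_abs. apply pow_incr.
  split; [apply Rabs_pos|exact Hs].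
Qed.

Lemma bohr_rest_mono w w' c r r' s s' :
  0 <= w <= w' -> (forall n, 0 <= c n <= coef_bound M n) -> 0 <= r <= r' -> r' < 1 ->
  Rabs s <= s' ->
  bohr_rest beta mu lambda q lam m N w c r s
   <= bohr_rest beta mu lambda q lam m N w' (coef_bound M) r' s'.
Proof.
  intros Hw Hc Hr Hr' Hs. assert (Ht := t_of_ge2 N HN). unfold bohr_rest.
  assert (Hinv := inv_one_minus_mono r r' Hr Hr').
  assert (Hsq : forall n, 0 <= c n ^ 2 <= coef_bound M n ^ 2).
  { intros n. destruct (Hc n). split; [apply pow_le; assumption|apply pow_incr; split; assumption].
      }
  rewrite sign_eq_1 by (apply lt_0_INR; lia).
  apply Rplus_le_compat; [apply Rplus_le_compat; [apply Rplus_le_compat|]|].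
  - apply Rmult_le_compat_l; [exact Hbeta|apply pow_incr, Hw].
  - rewrite !Rmult_1_r. apply Rmult_le_compat.
    + apply Rmult_le_pos; [exact Hmu|]. rewrite sum_n_m_partial_sum.
      apply Rle_trans with (partial_sum (fun _ => 0) (S (t_of N) - 1)).
      * induction (S (t_of N) - 1)%nat; simpl; lra.
      * apply partial_sum_le. intros k _. apply Hsq.
    + apply Rmult_le_pos; [apply pow_le; lra|lra].
    + apply Rmult_le_compat_l; [exact Hmu|]. rewrite !sum_n_m_partial_sum. apply partial_sum_le.
      intros k _. apply Hsq.
    + apply Rmult_le_compat; [apply pow_le; lra|lra|apply pow_incr; lra|apply Hinv].
  - apply Rmult_le_compat.
    + apply Rmult_le_pos; [exact Hlambda|].
      assert (0 <= r / (1 - r)) by (apply Rmult_le_pos; lra). lra.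
    + apply Rle_trans with (Series (fun _ => 0)).
      * right. symmetry. apply is_series_unique, partial_sum_lim_inv.
        apply is_lim_seq_ext with (fun _ => 0); [|apply is_lim_seq_const].
        induction n; simpl; [reflexivity|]. rewrite <- IHn; ring.
      * apply Series_le.
        -- intros n. split; [apply Rle_refl|].
           apply Rmult_le_pos; [apply Hsq|apply pow_le; lra].
        -- apply (ex_series_le (K := R_AbsRing) (V := R_CompleteNormedModule)) with
             (fun k => coef_bound M (t_of N + 1 + k) ^ 2 * r' ^ (2 * (t_of N + 1 + k))).
           ++ intros n. change (Rabs (c (t_of N + 1 + n)%nat ^ 2 * r ^ (2 * (t_of N + 1 + n)))
                <= coef_bound M (t_of N + 1 + n) ^ 2 * r' ^ (2 * (t_of N + 1 + n))).
              destruct (pow_le_mono _ _ r r' (2 * (t_of N + 1 + n)) (Hsq (t_of N + 1 + n)%nat) Hr).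
              rewrite Rabs_pos_eq; assumption.
           ++ eexists. apply square_tail_series; [lra|lia].
    + apply Rmult_le_compat_l; [exact Hlambda|].
      assert (r / (1 - r) <= r' / (1 - r')) by (apply Rmult_le_compat; lra). lra.
    + apply Series_le.
      * intros n. apply pow_le_mono; auto.
      * eexists. apply square_tail_series; [lra|lia].
  - apply P_poly_mono, Hs.
Qed.

Lemma G_M_mono r r' : 0 <= r <= r' -> r' < 1 -> 0 <= G_M M r <= G_M M r'.
Proof.
  intros Hr Hr'.
  assert (H1 := G_M_series M r ltac:(rewrite Rabs_pos_eq; lra)).
  assert (H2 := G_M_series M r' ltac:(rewrite Rabs_pos_eq; lra)).
  assert (Hcb : forall n, 0 <= coef_bound M n <= coef_bound M n)
    by (intros n; split; [apply coef_bound_ge0, HM|apply Rle_refl]).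
  split.
  - apply (partial_sum_le_series _ _ 0) in H1; [exact H1|]. intros k. apply Rmult_le_pos; [apply
      (Hcb k)|apply pow_le; lra].
  - apply series_le_series with (2 := H1) (3 := H2). intros n. apply pow_le_mono; auto.
Qed.

Lemma F_M_mono r r' : 0 <= r <= r' -> r' < 1 -> 0 <= F_M M r <= F_M M r'.
Proof.
  intros Hr Hr'.
  assert (H1 := F_M_series M r ltac:(lra)).
  assert (H2 := F_M_series M r' ltac:(lra)).
  assert (Hcb : forall n, 0 <= INR n * coef_bound M n ^ 2 <= INR n * coef_bound M n ^ 2).
  { intros n. split; [|apply Rle_refl]. apply Rmult_le_pos; [apply pos_INR|apply pow_le,
      coef_bound_ge0, HM]. }
  split.
  - apply (partial_sum_le_series _ _ 0) in H1; [exact H1|]. intros k. apply Rmult_le_pos; [apply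
      (Hcb k)|apply pow_le; lra].
  - apply series_le_series with (2 := H1) (3 := H2). intros n. apply pow_le_mono; auto.
Qed.

Lemma Phi_increasing r r' : 0 <= r < r' -> r' < 1 ->
  Phi M beta mu lambda q lam m N r < Phi M beta mu lambda q lam m N r'.
Proof.
  intros Hr Hr'. rewrite !Phi_split by (try exact HN; lra).
  assert (H1 := bohr_tail_strict r r' Hr Hr').
  assert (H2 := F_M_mono r r' ltac:(lra) Hr').
  assert (H3 := bohr_rest_mono (G_M M r) (G_M M r') (coef_bound M) r r' (F_M M r) (F_M M r')
    (G_M_mono r r' ltac:(lra) Hr')
    (fun n => conj (coef_bound_ge0 M n HM) (Rle_refl _)) ltac:(lra) Hr'
    ltac:(rewrite Rabs_pos_eq; lra)).
  lra.
Qed.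

Hypothesis Hm : (1 <= m)%nat.

Lemma partial_sum_zero (u : nat -> R) n : (forall k, u k = 0) -> partial_sum u n = 0.
Proof. intros H. induction n as [|n IH]; simpl; [reflexivity|]. rewrite IH, H; ring. Qed.

Lemma Series_zero (u : nat -> R) : (forall k, u k = 0) -> Series u = 0.
Proof.
  intros H. apply is_series_unique, partial_sum_lim_inv.
  apply is_lim_seq_ext with (fun _ => 0); [|apply is_lim_seq_const].
  intros n. symmetry. apply partial_sum_zero, H.
Qed.

Lemma Phi_0 : Phi M beta mu lambda q lam m N 0 = - dist_bound M.
Proof.
  rewrite Phi_split by (try exact HN; lra). unfold bohr_tail, bohr_rest.
  rewrite !Series_zero.
  - assert (EG : G_M M 0 = 0) by (unfold G_M; rewrite Rminus_0_r, ln_1; ring).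
    assert (EF : F_M M 0 = 0).
    { unfold F_M. replace (0 ^ 2) with 0 by ring. rewrite Rminus_0_r, ln_1. ring. }
    rewrite EG, EF, !pow_i by lia. unfold P_poly.
    rewrite (sum_n_m_partial_sum (fun i => lam i * 0 ^ i)), partial_sum_zero.
    + unfold Rdiv. ring.
    + intros k. rewrite pow_i by lia. ring.
  - intros k. rewrite pow_i by lia. ring.
  - intros k. rewrite pow_i by lia. ring.
Qed.

Lemma continuity_sum (u : nat -> R -> R) i n x :
  (forall k, continuity_pt (u k) x) -> continuity_pt (fun y => sum_n_m (fun k => u k y) i n) x.
Proof.
  intros H. apply continuity_pt_ext with (fun y => partial_sum (fun k => u (i + k)%nat y) (S n -
      i)).
  { intros y. symmetry. apply sum_n_m_partial_sum. }
  induction (S n - i)%nat as [|j IH].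
  - apply continuity_pt_const. intros y y'. reflexivity.
  - apply (continuity_pt_plus (fun y => partial_sum (fun k => u (i + k)%nat y) j)); auto.
Qed.

Lemma ex_derive_continuity_pt (u : R -> R) x : ex_derive u x -> continuity_pt u x.
Proof.
  intros H. apply continuity_pt_filterlim, (ex_derive_continuous (V := R_NormedModule)), H.
Qed.

Lemma continuity_pt_pow_comp (u : R -> R) k x :
  continuity_pt u x -> continuity_pt (fun y => u y ^ k) x.
Proof.
  intros H. apply (continuity_pt_comp u (fun y => y ^ k)); [exact H|].
  apply ex_derive_continuity_pt. auto_derive. trivial.
Qed.

Lemma Phi_continuous x : 0 <= x < 1 -> continuity_pt (Phi M beta mu lambda q lam m N) x.
Proof.
  intros Hx. assert (Hx2 : 0 <= x ^ 2 < 1) by nra.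
  assert (HL : continuity_pt (fun r => Li2 (r ^ 2)) x).
  { apply (continuity_pt_comp (fun r => r ^ 2) Li2).
    - apply ex_derive_continuity_pt. auto_derive. trivial.
    - apply Li2_continuous. rewrite Rabs_pos_eq; lra. }
  assert (Hln : continuity_pt (fun r => ln (1 - r ^ 2)) x).
  { apply ex_derive_continuity_pt. auto_derive. simpl in Hx2. lra. }
  assert (Hpoly : forall u : R -> R, ex_derive u x -> continuity_pt u x)
    by (intros; now apply ex_derive_continuity_pt).
  unfold Phi. cbv zeta.
  apply continuity_pt_minus; [|apply Hpoly, ex_derive_const].
  apply continuity_pt_minus; [|apply Hpoly, ex_derive_const].
  apply continuity_pt_plus; [apply continuity_pt_plus; [apply continuity_pt_plus; [apply
      continuity_pt_plus|]|]|].
  - apply continuity_pt_mult; [apply Hpoly; auto_derive; trivial|].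
    apply continuity_pt_pow_comp. apply Hpoly. unfold G_M. auto_derive. lra.
  - apply continuity_pt_mult; [apply Hpoly; auto_derive; trivial|].
    apply continuity_pt_minus; [apply Hpoly; auto_derive; lra|].
    apply continuity_sum. intros k. unfold Rdiv.
    apply continuity_pt_mult; apply Hpoly; auto_derive; trivial.
  - unfold Phi_Mt. apply Hpoly. auto_derive. lra.
  - unfold G_t. apply continuity_pt_mult; [apply Hpoly; auto_derive; lra|].
    apply continuity_pt_minus.
    + apply continuity_pt_minus; [|apply Hpoly; auto_derive; trivial].
      apply continuity_pt_plus; apply continuity_pt_mult; auto; apply Hpoly; auto_derive; trivial.
    + apply continuity_sum. intros k. unfold Rdiv.
      apply continuity_pt_mult; apply Hpoly; auto_derive; trivial.
  - unfold P_poly. apply continuity_sum. intros k.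
    apply continuity_pt_mult; [apply Hpoly; auto_derive; trivial|].
    apply continuity_pt_pow_comp. unfold F_M.
    apply continuity_pt_plus; [apply Hpoly; auto_derive; trivial|].
    apply continuity_pt_mult; [apply Hpoly; auto_derive; trivial|].
    apply continuity_pt_minus.
    + apply continuity_pt_mult; [apply Hpoly; auto_derive; trivial|exact HL].
    + apply continuity_pt_plus; [apply Hpoly; auto_derive; trivial|].
      apply continuity_pt_mult; [apply Hpoly; auto_derive; trivial|exact Hln].
Qed.

(** Phi(0) = -L < 0, and Phi is continuous and strictly increasing on [0, 1). *)
Lemma Phi_unique_root : 0 < dist_bound M ->
  (exists r : R, 0 < r < 1 /\ 0 < Phi M beta mu lambda q lam m N r) ->
  exists! Rad : R, 0 < Rad < 1 /\ Phi M beta mu lambda q lam m N Rad = 0.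
Proof.
  intros HL [r [Hr HP]].
  assert (Hlim : forall x, 0 <= x < 1 -> is_lim (Phi M beta mu lambda q lam m N) x
     (Phi M beta mu lambda q lam m N x)).
  { intros x Hx. apply is_lim_continuity, Phi_continuous, Hx. }
  destruct (IVT_Rbar_incr (Phi M beta mu lambda q lam m N) 0 r _ _ 0
     (Hlim 0 ltac:(lra)) (Hlim r ltac:(lra))) as [x [Hx1 [Hx2 Hx3]]].
  - intros x Hx1 Hx2. simpl in Hx1, Hx2. apply Phi_continuous. lra.
  - simpl; lra.
  - simpl. rewrite Phi_0. lra.
  - simpl in Hx1, Hx2. exists x. split; [split; [lra|exact Hx3]|].
    intros y [Hy Hy0]. destruct (Rtotal_order x y) as [h|[h|h]]; [|exact h|].
    + assert (K := Phi_increasing x y ltac:(lra) ltac:(lra)). lra.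
    + assert (K := Phi_increasing y x ltac:(lra) ltac:(lra)). lra.
Qed.
End Majorant.

(** * The inequality and its extremal function *)

Section ClassMajorants.
Variables (M : R) (f h g : C -> C) (a b : nat -> C).
Hypothesis HM : 0 < M.
Hypothesis Hf : in_P0H M f h g.
Hypothesis Ha : power_expansion h a.
Hypothesis Hb : power_expansion g b.

Lemma class_coef_bound n : 0 <= Cmod (a n) + Cmod (b n) <= coef_bound M n.
Proof.
  split; [generalize (Cmod_ge_0 (a n)) (Cmod_ge_0 (b n)); lra|].
  destruct n as [|[|k]].
  - rewrite (class_a0 M f h g a Hf Ha), (class_b0 M f h g b Hf Hb), Cmod_0. simpl. lra.
  - rewrite (class_a1 M f h g a Hf Ha), (class_b1 M f h g b Hf Hb), Cmod_0, Cmod_1. simpl. lra.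
  - apply (class_coef_le M f h g a b); auto. lia.
Qed.

Lemma class_G_bound z : Cmod z < 1 -> Cmod (f z) <= G_M M (Cmod z).
Proof.
  intros Hz. assert (Hz0 := Cmod_ge_0 z). set (r := Cmod z) in *.
  destruct (class_summable_a h a Ha r ltac:(lra)) as [A HA].
  destruct (class_summable_b g b Hb r ltac:(lra)) as [B HB].
  assert (H1 := pseries_to_Cmod_le a z _ r A (Rle_refl _) HA (class_pseries_to_h h a Ha z Hz)).
  assert (H2 := pseries_to_Cmod_le b z _ r B (Rle_refl _) HB (class_pseries_to_g g b Hb z Hz)).
  assert (HAB := is_series_lin2 _ _ 1 1 _ _ HA HB).
  assert (HG := G_M_series M r ltac:(rewrite Rabs_pos_eq; lra)).
  assert (1 * A + 1 * B <= G_M M r).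
  { apply series_le_series with (2 := HAB) (3 := HG). intros n.
    replace (1 * (Cmod (a n) * r ^ n) + 1 * (Cmod (b n) * r ^ n))
      with ((Cmod (a n) + Cmod (b n)) * r ^ n) by ring.
    apply Rmult_le_compat_r; [apply pow_le; lra|apply class_coef_bound]. }
  assert (E : f z = (h z + Cconj (g z))%C) by (apply Hf, Hz).
  rewrite E. eapply Rle_trans; [apply Cmod_triangle|]. rewrite Cmod_conj. lra.
Qed.

(** Both sums in S_r / pi are nonnegative, so its absolute value is at most their sum, and
    |a_n|^2 + |b_n|^2 <= (|a_n| + |b_n|)^2. *)
Lemma class_area_bound r : 0 <= r < 1 -> Rabs (S_area h g r / PI) <= F_M M r.
Proof.
  intros Hr. destruct (S_area_series h g a b r Ha Hb Hr) as [V [W [HV [HW E]]]].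
  assert (HPI := PI_RGT_0).
  assert (HF := is_series_tail _ _ 1 (F_M_series M r Hr)).
  simpl partial_sum in HF. rewrite Rplus_0_l, !Rmult_0_l, Rminus_0_r in HF.
  assert (Hnn : forall c k, 0 <= area_term c r k).
  { intros c k. unfold area_term. apply Rmult_le_pos; [apply pow_le, Cmod_ge_0|].
    apply Rmult_le_pos; [apply Rmult_le_pos; [lra|apply pow_le; lra]|].
    apply Rlt_le, Rinv_0_lt_compat. generalize (pos_INR k); lra. }
  assert (V0 : 0 <= V) by exact (partial_sum_le_series _ _ 0 (Hnn _) HV).
  assert (W0 : 0 <= W) by exact (partial_sum_le_series _ _ 0 (Hnn _) HW).
  assert (HVW := is_series_lin2 _ _ (/ PI) (/ PI) _ _ HV HW).
  assert (Hle : / PI * V + / PI * W <= F_M M r).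
  { apply series_le_series with (2 := HVW) (3 := HF). intros k.
    unfold area_term, deriv_coef. rewrite !Cmod_mult, !Cmod_R, !(Rabs_pos_eq (INR (S k))) by apply
        pos_INR.
    change (1 + k)%nat with (S k). replace (2 * k + 2)%nat with (2 * S k)%nat by lia.
    rewrite <- S_INR. assert (P : 0 < INR (S k)) by (apply lt_0_INR; lia).
    replace (/ PI * ((INR (S k) * Cmod (a (S k))) ^ 2 * (PI * r ^ (2 * S k) / INR (S k))) +
      / PI * ((INR (S k) * Cmod (b (S k))) ^ 2 * (PI * r ^ (2 * S k) / INR (S k))))
      with (INR (S k) * (Cmod (a (S k)) ^ 2 + Cmod (b (S k)) ^ 2) * r ^ (2 * S k)) by (field; lra).
    apply Rmult_le_compat_r; [apply pow_le; lra|]. apply Rmult_le_compat_l; [lra|].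
    assert (K := class_coef_bound (S k)).
    assert (A0 := Cmod_ge_0 (a (S k))). assert (B0 := Cmod_ge_0 (b (S k))).
    apply Rle_trans with ((Cmod (a (S k)) + Cmod (b (S k))) ^ 2); [nra|apply pow_incr, K]. }
  rewrite E. unfold Rdiv. rewrite Rmult_minus_distr_r.
  assert (IP : 0 < / PI) by (apply Rinv_0_lt_compat; lra).
  assert (0 <= / PI * V) by (apply Rmult_le_pos; lra).
  assert (0 <= / PI * W) by (apply Rmult_le_pos; lra).
  apply Rabs_le. lra.
Qed.
End ClassMajorants.

Section Extremal.
Variable M : R.
Hypothesis HM : 0 < M.

Definition ext_coef (n : nat) : C := RtoC (coef_bound M n).
(** F(z) = z + 2M sum_(n >= 2) z^n / (n (n-1)) = z + 2M (z + (1 - z) ln (1 - z)). *)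
Definition ext_fun : C -> C := pseries_sum ext_coef.
Let zero_fun : C -> C := fun _ => RtoC 0.
Let zero_coef : nat -> C := fun _ => RtoC 0.

Lemma ext_Cmod n : Cmod (ext_coef n) = coef_bound M n.
Proof. unfold ext_coef. rewrite Cmod_R, Rabs_pos_eq; [reflexivity|apply coef_bound_ge0, HM]. Qed.

Lemma ext_summable : summable ext_coef.
Proof.
  intros r Hr. eexists. apply is_series_ext with (2 := G_M_series M r ltac:(rewrite Rabs_pos_eq;
      lra)).
  intros n. now rewrite ext_Cmod.
Qed.

Lemma ext_pseries_to z : Cmod z < 1 -> pseries_to ext_coef z (ext_fun z).
Proof. intros Hz. apply summable_pseries_to; [apply ext_summable|exact Hz]. Qed.

Lemma ext_real x : Rabs x < 1 -> ext_fun (RtoC x) = RtoC (G_M M x).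
Proof.
  intros Hx. apply (pseries_to_unique ext_coef (RtoC x)); [apply ext_pseries_to; rewrite Cmod_R;
      exact Hx|].
  assert (H := partial_sum_lim _ _ (G_M_series M x Hx)).
  assert (E : forall n, partial_pseries ext_coef x n = RtoC (partial_sum (fun n => coef_bound M n *
      x ^ n) n)).
  { induction n as [|n IH]; [reflexivity|]. cbn [partial_pseries partial_sum].
    rewrite IH, RtoC_plus, RtoC_mult, RtoC_pow. reflexivity. }
  unfold pseries_to. apply is_lim_seq_ext with (fun n => Rabs (partial_sum (fun n => coef_bound M n
      * x ^ n) n - G_M M x)).
  { intros n. rewrite E, <- RtoC_minus, Cmod_R. reflexivity. }
  apply (is_lim_seq_abs_0 (fun n => partial_sum (fun n => coef_bound M n * x ^ n) n - G_M M x)).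
  replace (Finite 0) with (Finite (G_M M x - G_M M x)) by (f_equal; ring).
  apply is_lim_seq_minus'; [exact H|apply is_lim_seq_const].
Qed.

Lemma ext_conj z : Cmod z < 1 -> ext_fun (Cconj z) = Cconj (ext_fun z).
Proof.
  intros Hz. apply (pseries_to_unique ext_coef (Cconj z)); [apply ext_pseries_to; rewrite
      Cmod_conj; exact Hz|].
  unfold pseries_to. apply is_lim_seq_ext with (2 := ext_pseries_to z Hz). intros n.
  rewrite <- Cmod_conj, Cminus_conj. f_equal. f_equal.
  induction n as [|n IH]; cbn [partial_pseries].
  - apply injective_projections; simpl; ring.
  - rewrite Cplus_conj, Cmult_conj, Cpow_conj, IH. f_equal. f_equal.
    unfold ext_coef. apply injective_projections; simpl; ring.
Qed.

Lemma ext_second_derivative z : Cmod z < 1 -> pseries_sum (deriv_coef (deriv_coef ext_coef)) z = (2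
    * M / (1 - z))%C.
Proof.
  intros Hz. assert (Hs := summable_deriv_coef _ (summable_deriv_coef _ ext_summable)).
  apply (pseries_to_unique (deriv_coef (deriv_coef ext_coef)) z); [apply summable_pseries_to;
      auto|].
  assert (Hz1 : (1 - z)%C <> RtoC 0).
  { intros E. assert (z = RtoC 1) by (replace z with (1 - (1 - z))%C by ring; rewrite E; ring).
    subst z. rewrite Cmod_1 in Hz. lra. }
  assert (Ec : forall k, deriv_coef (deriv_coef ext_coef) k = RtoC (2 * M)).
  { intros k. unfold deriv_coef, ext_coef. change (S (S k)) with (2 + k)%nat. rewrite coef_bound_SS.
    rewrite <- !RtoC_mult. f_equal. destruct (INR_consecutive_neq_0 k). field. auto. }
  assert (E : forall n, partial_pseries (deriv_coef (deriv_coef ext_coef)) z n = (2 * M * (1 - z ^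
      n) / (1 - z))%C).
  { induction n as [|n IH].
    - change (z ^ 0)%C with (RtoC 1). cbn [partial_pseries]. field. exact Hz1.
    - cbn [partial_pseries]. rewrite IH, Ec, RtoC_mult, Cpow_S. field. exact Hz1. }
  apply is_lim_seq_ext with (fun n => Cmod (2 * M / (1 - z))%C * Cmod z ^ n).
  { intros n. rewrite E, <- Cmod_pow, <- Cmod_mult, <- Cmod_opp. f_equal. field. exact Hz1. }
  replace (Finite 0) with (Rbar_mult (Cmod (2 * M / (1 - z))%C) 0) by (simpl; f_equal; ring).
  apply is_lim_seq_scal_l, is_lim_seq_geom. rewrite Rabs_pos_eq; [exact Hz|apply Cmod_ge_0].
Qed.

Lemma zero_derive z : C_derive zero_fun z = RtoC 0.
Proof.
  apply is_C_derive_unique. apply (is_derive_const (K := C_AbsRing) (V := C_NormedModule)).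
Qed.

(** z F''(z) = M ((1 + z) / (1 - z) - 1), and (1 + z) / (1 - z) has positive real part. *)
Lemma ext_in_class : in_P0H M ext_fun ext_fun zero_fun.
Proof.
  split.
  - split; [|split; [|split; [|split; [|split; [|split]]]]].
    + intros z Hz. eexists. apply (pseries_to_is_derive ext_coef); auto using ext_summable,
        ext_pseries_to.
    + intros z Hz. eexists. apply (is_derive_const (K := C_AbsRing) (V := C_NormedModule)).
    + intros z Hz. unfold zero_fun. replace (Cconj 0) with (RtoC 0); [ring|].
      apply injective_projections; simpl; ring.
    + unfold ext_fun. rewrite pseries_sum_at_0 by apply ext_summable. reflexivity.
    + rewrite (C_derive_pseries_to ext_coef) by (auto using ext_summable, ext_pseries_to, disk_0).
      rewrite pseries_sum_at_0 by (apply summable_deriv_coef, ext_summable).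
      unfold deriv_coef, ext_coef. simpl. ring.
    + reflexivity.
    + apply zero_derive.
  - intros z Hz. rewrite (C_derive2_pseries_to ext_coef) by (auto using ext_summable,
      ext_pseries_to).
    rewrite ext_second_derivative by exact Hz.
    replace (C_derive zero_fun) with zero_fun
      by (apply functional_extensionality; intros w; symmetry; apply zero_derive).
    rewrite zero_derive, Cmult_0_r, Cmod_0, Rplus_0_r.
    unfold unit_disk in Hz.
    assert (Hz1 : (1 - z)%C <> RtoC 0).
    { intros E. assert (z = RtoC 1) by (replace z with (1 - (1 - z))%C by ring; rewrite E; ring).
      subst z. rewrite Cmod_1 in Hz. lra. }
    replace (z * (2 * M / (1 - z)))%C with (M * ((1 + z) / (1 - z) - 1))%C by (field; exact Hz1).
    rewrite re_scal_l, re_minus, re_RtoC.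
    assert (K := re_cayley_ge z _ eq_refl Hz).
    assert (0 < (1 - Cmod z) / (1 + Cmod z)).
    { apply Rdiv_lt_0_compat; generalize (Cmod_ge_0 z); lra. }
    nra.
Qed.

Lemma ext_expansion : power_expansion ext_fun ext_coef.
Proof. intros z Hz. apply is_pseries_pseries_to, ext_pseries_to, Hz. Qed.

Lemma zero_expansion : power_expansion zero_fun zero_coef.
Proof.
  intros z Hz. apply is_pseries_pseries_to. unfold pseries_to.
  apply is_lim_seq_ext with (fun _ => 0); [|apply is_lim_seq_const].
  intros n. replace (partial_pseries zero_coef z n) with (RtoC 0).
  - unfold zero_fun. replace (0 - 0)%C with (RtoC 0) by ring. now rewrite Cmod_0.
  - induction n as [|n IH]; [reflexivity|]. cbn [partial_pseries]. rewrite <- IH. unfold zero_coef.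
      ring.
Qed.

Hypothesis HM2 : 2 * M * ln 2 <= 1.

Lemma two_M_ln_lt_1 r : 0 <= r < 1 -> 2 * M * ln (1 + r) < 1.
Proof.
  intros Hr. assert (ln (1 + r) < ln 2) by (apply ln_increasing; lra).
  assert (2 * M * ln (1 + r) < 2 * M * ln 2) by (apply Rmult_lt_compat_l; lra). lra.
Qed.

Lemma ext_derivative_re_pos z : Cmod z < 1 -> 0 < Re (pseries_sum (deriv_coef ext_coef) z).
Proof.
  intros Hz.
  assert (K := class_first_derivative M ext_fun ext_fun zero_fun ext_coef zero_coef HM ext_in_class
     ext_expansion zero_expansion z Hz).
  assert (K2 := two_M_ln_lt_1 (Cmod z) ltac:(split; [apply Cmod_ge_0|exact Hz])).
  generalize (Cmod_ge_0 (pseries_sum (deriv_coef zero_coef) z)). lra.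
Qed.

(** Re F' > 0 on a convex domain: the component of F along w - z increases from z to w. *)
Lemma ext_injective z w : Cmod z < 1 -> Cmod w < 1 -> ext_fun z = ext_fun w -> z = w.
Proof.
  intros Hz Hw E. apply NNPP. intros Hne. set (d := (w - z)%C).
  assert (Hd : 0 < Cmod d).
  { apply Cmod_gt_0. intros E0. apply Hne. replace w with (d + z)%C by (unfold d; ring).
    rewrite E0. ring. }
  assert (Hin : forall s, 0 <= s <= 1 -> Cmod (z + s * d)%C < 1).
  { intros s Hs. replace (z + s * d)%C with ((1 - s)%R * z + s * w)%C
      by (unfold d; rewrite RtoC_minus; ring).
    eapply Rle_lt_trans; [apply Cmod_triangle|]. rewrite !Cmod_mult, !Cmod_R, !Rabs_pos_eq by lra.
    destruct (Req_dec s 0) as [->|hs]; [lra|].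
    assert (s * Cmod w < s * 1) by (apply Rmult_lt_compat_l; lra).
    assert ((1 - s) * Cmod z <= (1 - s) * 1) by (apply Rmult_le_compat_l; lra). lra. }
  destruct (MVT_cor2 (fun s : R => Re (Cconj d * ext_fun (z + s * d))%C)
     (fun s : R => Re (Cconj d * (pseries_sum (deriv_coef ext_coef) (z + s * d) * d))%C) 0 1
         Rlt_0_1)
    as [c [Hc Hc']].
  - intros c Hc. apply is_derive_Reals, line_derive; auto using ext_summable, ext_pseries_to.
  - replace (z + RtoC 1 * d)%C with w in Hc by (unfold d; ring).
    replace (z + RtoC 0 * d)%C with z in Hc by ring.
    rewrite E, Rminus_diag in Hc.
    set (D := pseries_sum (deriv_coef ext_coef) (z + c * d)) in *.
    replace (Cconj d * (D * d))%C with (d * Cconj d * D)%C in Hc by ring.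
    rewrite <- Cmod2_conj, re_scal_l in Hc.
    assert (P := ext_derivative_re_pos (z + c * d)%C ltac:(apply Hin; lra)). fold D in P.
    assert (0 < Cmod d ^ 2 * Re D) by (apply Rmult_lt_0_compat; [apply pow_lt, Hd|exact P]).
    lra.
Qed.

Lemma growth_strict r : 0 <= r < 1 -> growth M r < dist_bound M.
Proof.
  intros Hr. rewrite <- growth_1.
  destruct (MVT_cor2 (growth M) (fun r => 1 - 2 * M * ln (1 + r)) r 1 ltac:(lra)) as [c [Hc Hc']].
  - intros c Hc. apply is_derive_Reals, growth_derive. lra.
  - assert (K := two_M_ln_lt_1 c ltac:(lra)).
    assert (0 < (1 - 2 * M * ln (1 + c)) * (1 - r)) by (apply Rmult_lt_0_compat; lra). lra.
Qed.

Lemma G_M_opp r : G_M M (- r) = - growth M r.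
Proof. unfold G_M, growth. replace (1 - - r) with (1 + r) by ring. ring. Qed.

(** Here the restriction on M enters: when 2M ln 2 > 1, F' vanishes inside (-1, 0) and -L is
    an interior point of the image. *)
Lemma ext_boundary : 0 < dist_bound M -> boundary (disk_image ext_fun) (RtoC (- dist_bound M)).
Proof.
  intros HL eps Heps. split.
  (* F(-rho) = -growth M rho tends to -L from inside the image. *)
  - destruct (growth_near_1 M (dist_bound M - eps) HM ltac:(lra)) as [rho [Hrho [Hg _]]].
    assert (Hx : Rabs (- rho) < 1) by (rewrite Rabs_Ropp, Rabs_pos_eq; lra).
    exists (ext_fun (RtoC (- rho))). split.
    + exists (RtoC (- rho)). split; [unfold unit_disk; rewrite Cmod_R; exact Hx|reflexivity].
    + rewrite ext_real by exact Hx. rewrite G_M_opp, <- RtoC_minus, Cmod_R.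
      assert (K := growth_strict rho ltac:(lra)). apply Rabs_def1; lra.
  - exists (RtoC (- dist_bound M)). split.
    (* A preimage of -L is real by injectivity and symmetry, but on (-1, 1) F stays above -L. *)
    + intros [z [Hz Ez]]. unfold unit_disk in Hz.
      assert (Hconj : z = Cconj z).
      { apply ext_injective; [exact Hz|rewrite Cmod_conj; exact Hz|].
        rewrite ext_conj by exact Hz. rewrite <- Ez.
        apply injective_projections; simpl; ring. }
      assert (Hreal : z = RtoC (Re z)).
      { apply injective_projections; [reflexivity|].
        assert (E := f_equal snd Hconj). simpl in E. simpl. lra. }
      rewrite Hreal in Ez, Hz. rewrite Cmod_R in Hz.
      rewrite ext_real in Ez by exact Hz. apply RtoC_inj in Ez.
      set (x := Re z) in *. apply Rabs_def2 in Hz.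
      destruct (Rle_lt_dec 0 x) as [h|h].
      * assert (K := G_M_mono M HM x x ltac:(lra) ltac:(lra)). lra.
      * replace x with (- - x) in Ez by ring. rewrite G_M_opp in Ez.
        assert (K := growth_strict (- x) ltac:(lra)). lra.
    + rewrite <- RtoC_minus, Rminus_diag, Cmod_0. exact Heps.
Qed.

Lemma ext_dist : 0 < dist_bound M ->
  Rbar_le (dist_to (ext_fun (RtoC 0)) (boundary (disk_image ext_fun))) (dist_bound M).
Proof.
  intros HL. unfold dist_to.
  match goal with |- Rbar_le (Glb_Rbar ?E) _ => destruct (Glb_Rbar_correct E) as [Hlb _] end.
  apply Hlb. exists (RtoC (- dist_bound M)). split; [apply ext_boundary, HL|].
  rewrite (class_h_0 M ext_fun ext_fun zero_fun ext_in_class).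
  rewrite <- RtoC_minus, Cmod_R, Rabs_left; lra.
Qed.

Lemma ext_area r : 0 <= r < 1 -> S_area ext_fun zero_fun r / PI = F_M M r.
Proof.
  intros Hr. destruct (S_area_series _ _ _ _ r ext_expansion zero_expansion Hr) as [V [W [HV [HW
      E]]]].
  assert (HPI := PI_RGT_0).
  assert (HF := is_series_tail _ _ 1 (F_M_series M r Hr)).
  simpl partial_sum in HF. rewrite Rplus_0_l, !Rmult_0_l, Rminus_0_r in HF.
  assert (HVW := is_series_lin2 _ _ (/ PI) (- / PI) _ _ HV HW).
  rewrite E. replace ((V - W) / PI) with (/ PI * V + - / PI * W) by (field; lra).
  rewrite <- (is_series_unique _ _ HVW). apply is_series_unique.
  apply is_series_ext with (2 := HF). intros k.
  unfold area_term, deriv_coef, zero_coef. rewrite !Cmod_mult, !Cmod_R, Rabs_R0.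
  rewrite (Rabs_pos_eq (INR (S k))) by apply pos_INR. rewrite ext_Cmod.
  change (1 + k)%nat with (S k). replace (2 * k + 2)%nat with (2 * S k)%nat by lia.
  rewrite <- S_INR. assert (P : 0 < INR (S k)) by (apply lt_0_INR; lia).
  real_eq. field. lra.
Qed.

(** At a positive real point all the coefficients of F contribute with the same sign, so
    every bound is attained. *)
Lemma ext_bohr_lhs beta mu lambda q lam m N r : (5 <= N)%nat -> 0 < r < 1 ->
  bohr_lhs beta mu lambda q lam m N ext_fun ext_fun zero_fun ext_coef zero_coef (RtoC r)
  = Phi M beta mu lambda q lam m N r + dist_bound M.
Proof.
  intros HN Hr. rewrite bohr_lhs_split, Phi_split by (try exact HN; lra).
  rewrite ext_real by (rewrite Rabs_pos_eq; lra).
  assert (HG := G_M_mono M HM r r ltac:(lra) ltac:(lra)).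
  rewrite !Cmod_R, !Rabs_pos_eq by lra. rewrite ext_area by lra.
  replace (fun n => Cmod (ext_coef n) + Cmod (zero_coef n)) with (coef_bound M).
  - ring.
  - apply functional_extensionality. intros n. rewrite ext_Cmod. unfold zero_coef.
    rewrite Cmod_0. ring.
Qed.

Lemma ext_best_possible beta mu lambda q lam m N Rad :
  0 <= beta -> 0 <= mu -> 0 <= lambda -> (forall i : nat, (1 <= i <= q)%nat -> 0 <= lam i) ->
  (5 <= N)%nat -> 0 < dist_bound M -> 0 < Rad < 1 ->
  Phi M beta mu lambda q lam m N Rad = 0 ->
  best_possible M beta mu lambda q lam m N Rad.
Proof.
  intros Hbeta Hmu Hlambda Hlam HN HL HRad HPhi R' HR'.
  set (r := (Rad + Rmin R' 1) / 2).
  assert (Hr : Rad < r < 1 /\ r <= R').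
  { unfold r. assert (T1 := Rmin_l R' 1). assert (T2 := Rmin_r R' 1).
    assert (Rad < Rmin R' 1) by (apply Rmin_glb_lt; lra). lra. }
  exists ext_fun, ext_fun, zero_fun, ext_coef, zero_coef, (RtoC r).
  split; [exact ext_in_class|]. split; [exact ext_expansion|]. split; [exact zero_expansion|].
  unfold unit_disk. rewrite Cmod_R, Rabs_pos_eq by lra. split; [lra|]. split; [lra|].
  intros K. unfold bohr_ineq in K. rewrite ext_bohr_lhs in K by (try exact HN; lra).
  assert (K2 := Rbar_le_trans _ _ _ K (ext_dist HL)). simpl in K2.
  assert (K3 := Phi_increasing M beta mu lambda q lam m N HM Hbeta Hmu Hlambda Hlam HN Rad r
    ltac:(lra) ltac:(lra)). lra.
Qed.
End Extremal.

(** Each ingredient at |z| <= Rad is at most its majorant at Rad, where the majorants add up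
    to Phi(Rad) + L = L. *)
Lemma class_bohr_ineq M beta mu lambda q lam m N Rad f h g a b z :
  0 < M -> 0 <= beta -> 0 <= mu -> 0 <= lambda ->
  (forall i : nat, (1 <= i <= q)%nat -> 0 <= lam i) -> (5 <= N)%nat ->
  0 < Rad < 1 -> Phi M beta mu lambda q lam m N Rad = 0 ->
  in_P0H M f h g -> power_expansion h a -> power_expansion g b -> Cmod z <= Rad ->
  bohr_ineq beta mu lambda q lam m N f h g a b z.
Proof.
  intros HM Hbeta Hmu Hlambda Hlam HN HRad HPhi Hf Ha Hb Hz.
  assert (Hz0 := Cmod_ge_0 z).
  assert (Hlhs : bohr_lhs beta mu lambda q lam m N f h g a b z <= dist_bound M).
  { rewrite bohr_lhs_split. rewrite Phi_split in HPhi by (try exact HN; lra).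
    assert (Hc := class_coef_bound M f h g a b HM Hf Ha Hb).
    assert (H1 := bohr_tail_mono M N HN _ (Cmod z) Rad Hc ltac:(lra) ltac:(lra)).
    assert (HG := class_G_bound M f h g a b HM Hf Ha Hb z ltac:(lra)).
    assert (HG2 := G_M_mono M HM (Cmod z) Rad ltac:(lra) ltac:(lra)).
    assert (HF := class_area_bound M f h g a b HM Hf Ha Hb (Cmod z) ltac:(lra)).
    assert (HF2 := F_M_mono M HM (Cmod z) Rad ltac:(lra) ltac:(lra)).
    assert (Hw0 := Cmod_ge_0 (f z)).
    assert (H2 := bohr_rest_mono M beta mu lambda q lam m N Hbeta Hmu Hlambda Hlam HN
      (Cmod (f z)) (G_M M Rad) _ (Cmod z) Rad (S_area h g (Cmod z) / PI) (F_M M Rad)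
      ltac:(lra) Hc ltac:(lra) ltac:(lra) ltac:(lra)).
    lra. }
  unfold bohr_ineq, dist_to. apply Rbar_le_trans with (dist_bound M); [exact Hlhs|].
  match goal with |- Rbar_le _ (Glb_Rbar ?E) => destruct (Glb_Rbar_correct E) as [_ Hglb] end.
  apply Hglb. intros d [u [Hu ->]]. simpl.
  assert (E0 : f 0 = RtoC 0).
  { assert (E : f 0 = (h 0 + Cconj (g 0))%C) by (apply Hf, disk_0).
    rewrite E, (class_h_0 M f h g Hf), (class_g_0 M f h g Hf).
    apply injective_projections; simpl; ring. }
  rewrite E0. replace (u - 0)%C with u by ring.
  exact (class_boundary_far M f h g a b u HM Hf Ha Hb Hu).
Qed.

Lemma ln4 : ln 4 = 2 * ln 2.
Proof. replace 4 with (2 * 2) by ring. rewrite ln_mult by lra. ring. Qed.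

Lemma dist_bound_pos M : 0 < M < 1 / (2 * (ln 4 - 1)) -> 0 < dist_bound M.
Proof.
  intros HM. assert (H4 : 1 < ln 4).
  { rewrite <- (ln_exp 1). apply ln_increasing; [apply exp_pos|]. generalize exp_le_3. lra. }
  unfold dist_bound. rewrite ln4 in *.
  assert (K : M * (2 * (2 * ln 2 - 1)) < 1 / (2 * (2 * ln 2 - 1)) * (2 * (2 * ln 2 - 1)))
    by (apply Rmult_lt_compat_r; lra).
  replace (1 / (2 * (2 * ln 2 - 1)) * (2 * (2 * ln 2 - 1))) with 1 in K by (field; lra). lra.
Qed.

Theorem theorem3p1 (M beta mu lambda : R) (q : nat) (lam : nat -> R) (m N : nat)
    (hM : 0 < M < 1 / (2 * (ln 4 - 1)))
    (hbeta : 0 <= beta) (hmu : 0 <= mu) (hlambda : 0 <= lambda)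
    (hlam : forall i : nat, (1 <= i <= q)%nat -> 0 <= lam i)
    (hm : (1 <= m)%nat) (hN : (5 <= N)%nat) :
  ((exists r : R, 0 < r < 1 /\ 0 < Phi M beta mu lambda q lam m N r) ->
   exists! Rad : R, 0 < Rad < 1 /\ Phi M beta mu lambda q lam m N Rad = 0)
  /\
  (forall Rad : R, 0 < Rad < 1 -> Phi M beta mu lambda q lam m N Rad = 0 ->
    (forall (f h g : C -> C) (a b : nat -> C),
       in_P0H M f h g -> power_expansion h a -> power_expansion g b ->
       forall z : C, Cmod z <= Rad ->
         bohr_ineq beta mu lambda q lam m N f h g a b z)
    /\
    (M <= 1 / ln 4 -> best_possible M beta mu lambda q lam m N Rad)).
Proof.
  assert (HL := dist_bound_pos M hM). destruct hM as [HM _]. split.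
  - apply Phi_unique_root; assumption.
  - intros Rad HRad HPhi. split.
    + intros f h g a b Hf Ha Hb z Hz.
      apply class_bohr_ineq with M Rad; assumption.
    + intros HM4. apply ext_best_possible; auto.
      rewrite ln4 in HM4. assert (Hln : 0 < ln 2) by (rewrite <- ln_1; apply ln_increasing; lra).
      apply Rmult_le_compat_r with (r := 2 * ln 2) in HM4; [|lra].
      replace (1 / (2 * ln 2) * (2 * ln 2)) with 1 in HM4 by (field; lra). lra.
Qed.
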